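(* Let $U\subset\mathbb{R}^2$ be open with coordinates $(x,y)$, let $h,H:U\to\mathbb{R}$ be positive smooth functions such that $\Delta\ln H=2h^2$ on $U$, where $\Delta=\partial_x^2+\partial_y^2$. Let $M=U\times N$ with $N=\{(z,t)\in\mathbb{R}^2: z<0\}$, and let $g=\theta_1^2+\theta_2^2+\theta_3^2+\theta_4^2$, i.e. $g(X,Y)=\sum_{i=1}^4\theta_i(X)\theta_i(Y)$, where $$\theta_1=zh\,dx,\qquad \theta_2=zh\,dy,$$ $$\theta_3=-\tfrac{z}{2}\,dt+\big(\cos(\tfrac t2)\,H+z\,l_2\big)dx+\big(-\sin(\tfrac t2)\,H+z\,n_2\big)dy,$$ $$\theta_4=dz-\sin(\tfrac t2)\,H\,dx-\cos(\tfrac t2)\,H\,dy,$$ with $l_2=-(\ln H)_y$, $n_2=(\ln H)_x$ (here $h,H,l_2,n_2$ are evaluated at $(x,y)$). Let $\{E_1,E_2,E_3,E_4\}$ be the $g$-orthonormal frame dual to $\{\theta_1,\theta_2,\theta_3,\theta_4\}$, let $\mathcal{D}=\mathrm{span}\{E_3,E_4\}$ and $\mathcal{D}^\perp=\mathrm{span}\{E_1,E_2\}$, let $\bar J$ be the Kähler structure with Kähler form $\bar\Omega=\theta_1\wedge\theta_2+\theta_4\wedge\theta_3$ and $J$ the Hermitian structure with Kähler form $\Omega=\theta_1\wedge\theta_2+\theta_3\wedge\theta_4$, with Lee form $\theta=-\alpha\theta_4$, $\alpha=-\frac2z$. Then: (i) $\Delta\ln H=2h^2$ on $U$. (ii) $\Gamma^2_{11}=-\dfrac{\cos(\frac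 t2)H}{z^2h}-\dfrac{h_y}{zh^2}$ and $\Gamma^1_{22}=-\dfrac{\sin(\frac t2)H}{z^2h}-\dfrac{h_x}{zh^2}$. (iii) In the frame $\{E_1,E_2,E_3,E_4\}$ the Ricci tensor of $(M,g)$ is $$Ric=\mathrm{diag}\Big(-\tfrac{\Delta\ln h}{z^2h^2}-\tfrac{4}{z^2},\ -\tfrac{\Delta\ln h}{z^2h^2}-\tfrac4{z^2},\ 0,\ 0\Big).$$ (iv) The scalar curvature of $(M,g)$ is $\tau=-\dfrac{2\Delta\ln h}{z^2h^2}-\dfrac8{z^2}$. (v) The conformal scalar curvature is $\kappa=-\dfrac{2\Delta\ln h}{z^2h^2}-\dfrac8{z^2}$. (vi) In the frame $\{\Omega,\phi,\psi\}$, where $\{\phi,\psi\}$ is any (local) orthonormal basis of $LM$, the Weyl tensor $W^-$ is $$W^-=\mathrm{diag}\Big(-\tfrac{\Delta\ln h}{3z^2h^2}-\tfrac4{3z^2},\ \tfrac{\Delta\ln h}{6z^2h^2}+\tfrac2{3z^2},\ \tfrac{\Delta\ln h}{6z^2h^2}+\tfrac2{3z^2}\Big).$$ (vii) The sectional curvature of $(M,g)$ on $\mathcal{D}^\perp$ is $K(E_1,E_2)=-\dfrac{\Delta\ln h}{z^2h^2}-\dfrac4{z^2}$ and on $\mathcal{D}$ is $K(E_3,E_4)=0$. (viii) $(M,g)$ is a space form if and only if $\Delta\ln h=-4h^2$ on $U$; in that case it is locally isometric to $\mathbb{C}^2$ with its standard metric of constant holomorphic sectional curvature $0$.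
   Context: It is known from earlier work that, for this metric, $\bar J$ is a Kähler structure and $J$ is an integrable orthogonal complex structure (inducing the opposite orientation) which is not locally conformally Kähler. Conventions. The Kähler form of an almost Hermitian structure $J$ is $\Omega(X,Y)=g(JX,Y)$; thus here $\bar JE_1=E_2$, $\bar JE_3=-E_4$, $JE_1=E_2$, $JE_3=E_4$. $M$ is oriented so that $\bar\Omega$ is self-dual; then $\Omega$ is anti-self-dual. $LM$ denotes the rank-2 bundle of anti-self-dual 2-forms orthogonal to $\Omega$. The Lee form $\theta$ of $(M,g,J)$ is defined by $d\Omega=2\theta\wedge\Omega$. $\Gamma^k_{ij}=g(\nabla_{E_i}E_j,E_k)$, with $\nabla$ the Levi-Civita connection. The curvature tensor is $R(X,Y)Z=([\nabla_X,\nabla_Y]-\nabla_{[X,Y]})Z$, $R(X,Y,Z,W)=g(R(X,Y)Z,W)$, and $K(X,Y)=R(X,Y,Y,X)$ for orthonormal $X,Y$. $Ric(X,Y)=\sum_i g(R(E_i,X)Y,E_i)$, and $\tau=\mathrm{tr}_g Ric$. The conformal scalar curvature (of $(M,g,J)$) is $\kappa=\tau-6(|\theta|^2+\delta\theta)$, where $\delta\theta=-\sum_i(\nabla_{E_i}\theta)(E_i)$. $W^-$ is the anti-self-dual part of the Weyl tensor, viewed as a symmetric endomorphism of the bundle of anti-self-dual 2-forms, normalized so that the curvature operator of a space of constant sectional curvature $1$ is the identity on 2-forms. ''Space form'' means that the Kähler surface $(M,g,\bar J)$ has constant holomorphic sectional curvature $R(X,\bar JX,\bar JX,X)$, $|X|=1$.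 *)

(* Defs.v *)
From HB Require Import structures.
From mathcomp Require Import all_boot all_order all_algebra.
From mathcomp Require Import all_classical all_reals all_analysis.

Set Implicit Arguments.
Unset Strict Implicit.
Unset Printing Implicit Defensive.

Import Order.TTheory GRing.Theory Num.Theory numFieldNormedType.Exports.

Local Open Scope classical_set_scope.
Local Open Scope ring_scope.

(* [i1, ..., i4] are the indices 1, ..., 4 of the frames on R^4, and also of  *)
(* its coordinates (x, y, z, t).                                              *)
Definition i1 : 'I_4 := @Ordinal 4 0 isT.
Definition i2 : 'I_4 := @Ordinal 4 1 isT.
Definition i3 : 'I_4 := @Ordinal 4 2 isT.
Definition i4 : 'I_4 := @Ordinal 4 3 isT.

(* On an open set [A] of a finite-dimensional space this is being C^oo:       *)
(* [vs] ranges over all finite lists of directions, so every iterated         *)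
(* directional derivative of [f] is Frechet differentiable on [A].            *)
Definition smooth_on {R : realType} {V W : normedModType R}
    (A : set V) (f : V -> W) : Prop :=
  forall (vs : seq V) (p : V), A p ->
    differentiable (foldr (fun v k => 'D_v k) f vs) p.

Definition partial {R : realType} {n : nat} (i : 'I_n) (f : 'rV[R]_n -> R) :
    'rV[R]_n -> R :=
  'D_(delta_mx 0 i) f.

Definition laplacian {R : realType} (f : 'rV[R]_2 -> R) (q : 'rV[R]_2) : R :=
  \sum_(i < 2) partial i (partial i f) q.

Definition logf {R : realType} {n : nat} (f : 'rV[R]_n -> R) :
    'rV[R]_n -> R :=
  fun q => ln (f q).

(* Every tangent space is identified with R^4 through the coordinates, and
   fields are functions defined on all of R^4, of which only the values on the
   open set under consideration matter. *)

Section Geometry.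
Context {R : realType}.
Local Notation R4 := 'rV[R]_4.
Local Notation vector_field := (R4 -> R4).
Local Notation covector_field := (R4 -> R4 -> R).
Local Notation form2 := (R4 -> R4 -> R).
Local Notation form2_field := (R4 -> form2).

Implicit Types (M : set R4) (p u v w s : R4) (X Y Z : vector_field).
Implicit Types (g : form2_field) (E : 'I_4 -> vector_field).

Definition gram g p : 'M[R]_4 :=
  \matrix_(i, j) g p (delta_mx 0 i) (delta_mx 0 j).

(* [christoffel g p i j k] is the coefficient of d_k in nabla_{d_i} d_j for   *)
(* the Levi-Civita connection [nabla g].                                      *)
Definition christoffel g p (i j k : 'I_4) : R :=
  2^-1 * \sum_(l < 4) invmx (gram g p) k l *
    (partial i (fun q => gram g q j l) p
     + partial j (fun q => gram g q i l) p
     - partial l (fun q => gram g q i j) p).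

Definition nabla g X Y : vector_field := fun p =>
  'D_(X p) Y p
  + \row_k \sum_(i < 4) \sum_(j < 4) X p 0 i * Y p 0 j * christoffel g p i j k.

Definition bracket X Y : vector_field := fun p => 'D_(X p) Y p - 'D_(Y p) X p.

Definition curvature g X Y Z : vector_field := fun p =>
  nabla g X (nabla g Y Z) p - nabla g Y (nabla g X Z) p
  - nabla g (bracket X Y) Z p.

(* R(u, v, w, s) for tangent vectors at [p].  Since the curvature is          *)
(* tensorial, [u], [v], [w] may be extended to vector fields in any smooth    *)
(* way; the extension used is the one with constant coordinates.              *)
Definition riem g p u v w s : R :=
  g p (curvature g (fun=> u) (fun=> v) (fun=> w) p) s.

Definition sec g p u v : R := riem g p u v v u.

(* In the following definitions [E] is a [g]-orthonormal frame. *)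

Definition ricci g E p u v : R := \sum_(i < 4) riem g p (E i p) u v (E i p).

Definition scal g E p : R := \sum_(i < 4) ricci g E p (E i p) (E i p).

Definition Gamma g E (i j k : 'I_4) p : R := g p (nabla g (E i) (E j) p) (E k p).

Definition nabla_form g X (a : covector_field) Y p : R :=
  'D_(X p) (fun q => a q (Y q)) p - a p (nabla g X Y p).

Definition codiff g E (a : covector_field) p : R :=
  - \sum_(i < 4) nabla_form g (E i) a (E i) p.

Definition sqnorm E (a : covector_field) p : R := \sum_(i < 4) a p (E i p) ^+ 2.

(* Conformal scalar curvature of an almost Hermitian structure with Lee form  *)
(* [lee].                                                                     *)
Definition conf_scal g E (lee : covector_field) p : R :=
  scal g E p - 6 * (sqnorm E lee p + codiff g E lee p).

Definition wedge11 (a b : covector_field) : form2_field := fun p u v =>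
  a p u * b p v - b p u * a p v.

Definition wedge12 (a : covector_field) (F : form2_field) p u v w : R :=
  a p u * F p v w - a p v * F p u w + a p w * F p u v.

(* Exterior derivative, evaluated on coordinate-constant vector fields, for   *)
(* which the bracket terms vanish.                                            *)
Definition extd2 (F : form2_field) p u v w : R :=
  'D_u (fun q => F q v w) p - 'D_v (fun q => F q u w) p
  + 'D_w (fun q => F q u v) p.

Definition is_lee_form M (F : form2_field) (lee : covector_field) : Prop :=
  forall p, M p -> forall u v w,
    extd2 F p u v w = 2 * wedge12 lee F p u v w.

(* The almost complex structure J with Kaehler form [F], that is, the one     *)
(* with g(J u, v) = F(u, v).                                                  *)
Definition complex_structure E (F : form2_field) p u : R4 :=
  \sum_(i < 4) F p u (E i p) *: E i p.

Definition weyl g E p u v w s : R :=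
  riem g p u v w s
  - 2^-1 * (ricci g E p v w * g p u s - ricci g E p u w * g p v s
            + g p v w * ricci g E p u s - g p u w * ricci g E p v s)
  + scal g E p / 6 * (g p v w * g p u s - g p u w * g p v s).

Definition is_form2 (f : form2) : Prop :=
  (forall (a : R) u v w, f (a *: u + v) w = a * f u w + f v w) /\
  (forall u v, f u v = - f v u).

Definition inner2 E p (f k : form2) : R :=
  2^-1 * \sum_(i < 4) \sum_(j < 4) f (E i p) (E j p) * k (E i p) (E j p).

(* Half of F /\ F.  For the Kaehler form [F] of an almost Hermitian structure *)
(* this is the volume form of the orientation making [F] self-dual.           *)
Definition volume (F : form2_field) p u v w s : R :=
  F p u v * F p w s - F p u w * F p v s + F p u s * F p v w.

Definition hodge E (F : form2_field) p (f : form2) : form2 := fun u v =>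
  2^-1 * \sum_(i < 4) \sum_(j < 4)
    volume F p u v (E i p) (E j p) * f (E i p) (E j p).

Definition anti_self_dual E F p (f : form2) : Prop :=
  forall u v, hodge E F p f u v = - f u v.

Definition asd_part E F p (f : form2) : form2 := fun u v =>
  2^-1 * (f u v - hodge E F p f u v).

(* The Weyl tensor acting on 2-forms.  The sign and the factor are such that  *)
(* the same formula with [riem] in place of [weyl] gives the identity in      *)
(* constant sectional curvature 1.                                            *)
Definition weyl_op g E p (f : form2) : form2 := fun u v =>
  2^-1 * \sum_(i < 4) \sum_(j < 4)
    weyl g E p u v (E j p) (E i p) * f (E i p) (E j p).

(* W^- for the orientation making [F] self-dual. *)
Definition weyl_minus g E F p (f : form2) : form2 :=
  asd_part E F p (weyl_op g E p (asd_part E F p f)).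

(* ([f], [k]) is an orthonormal basis of the fibre at [p] of the bundle LM of *)
(* the anti-self-dual forms orthogonal to [Om].                               *)
Definition LM_orthonormal E F (Om : form2_field) p (f k : form2) : Prop :=
  [/\ is_form2 f, is_form2 k,
      anti_self_dual E F p f & anti_self_dual E F p k] /\
  [/\ inner2 E p f (Om p) = 0, inner2 E p k (Om p) = 0,
      inner2 E p f f = 1, inner2 E p k k = 1 & inner2 E p f k = 0].

Definition hol_sec_const M g (J : R4 -> R4 -> R4) (c : R) : Prop :=
  forall p, M p -> forall u, g p u u = 1 -> riem g p u (J p u) (J p u) u = c.

Definition space_form M g (J : R4 -> R4 -> R4) : Prop :=
  exists c : R, hol_sec_const M g J c.

(* The standard flat Kaehler metric of C^2, identified with R^4. *)
Definition euclid u v : R := \sum_(i < 4) u 0 i * v 0 i.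

Definition locally_isometric_to_C2 M g : Prop :=
  forall p, M p -> exists (V W : set R4) (F G : R4 -> R4),
    [/\ open V, V p, V `<=` M & open W] /\
    [/\ smooth_on V F, smooth_on W G,
        forall q, V q -> W (F q) /\ G (F q) = q,
        forall q, W q -> V (G q) /\ F (G q) = q &
        forall q u v, V q -> euclid ('D_u F q) ('D_v F q) = g q u v].

End Geometry.

Section Metric.
Context {R : realType}.
Local Notation R4 := 'rV[R]_4.

Definition base (p : R4) : 'rV[R]_2 :=
  \row_j (if j == 0 then p 0 i1 else p 0 i2).

Definition total_space (U : set 'rV[R]_2) : set R4 :=
  [set p | U (base p) /\ p 0 i3 < 0].

Definition l2 (H : 'rV[R]_2 -> R) (q : 'rV[R]_2) : R := - partial 1 (logf H) q.
Definition n2 (H : 'rV[R]_2 -> R) (q : 'rV[R]_2) : R := partial 0 (logf H) q.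

(* theta_k(u) at p = (x, y, z, t); the components of [u] are dx(u), dy(u),    *)
(* dz(u), dt(u).                                                              *)
Definition coframe (h H : 'rV[R]_2 -> R) (k : 'I_4) (p u : R4) : R :=
  let q := base p in
  let z := p 0 i3 in let t := p 0 i4 in
  let dx := u 0 i1 in let dy := u 0 i2 in let dz := u 0 i3 in let dt := u 0 i4 in
  match val k with
  | 0%N => z * h q * dx
  | 1%N => z * h q * dy
  | 2%N => - (z / 2) * dt + (cos (t / 2) * H q + z * l2 H q) * dx
           + (- sin (t / 2) * H q + z * n2 H q) * dy
  | _ => dz - sin (t / 2) * H q * dx - cos (t / 2) * H q * dy
  end.

Definition metric (theta : 'I_4 -> R4 -> R4 -> R) (p u v : R4) : R :=
  \sum_(k < 4) theta k p u * theta k p v.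

(* [dual_frame theta j] is the field E_j with theta_k(E_j) = delta_jk,        *)
(* wherever [theta] is a coframe.                                             *)
Definition dual_frame (theta : 'I_4 -> R4 -> R4 -> R) (j : 'I_4) (p : R4) : R4 :=
  row j (invmx (\matrix_(i, k) theta k p (delta_mx 0 i))).

End Metric.

(* Main.v *)
(** The coframe admits a skew-symmetric matrix A of 1-forms with d theta = theta /\ A
    whose coefficients are explicit in dx, dy, dt; by Koszul's formula A is the matrix
    of the Levi-Civita connection.  The equation Laplacian (ln H) = 2 h^2 is used twice:
    it is the integrability condition making d theta = theta /\ A hold, and it reduces
    the curvature form of A to a multiple of theta_1 /\ theta_2 in the plane (E_1, E_2).
    All curvature quantities are then algebraic in the single function
    K = - (Laplacian (ln h) + 4 h^2) / (z^2 h^2), and constancy of the holomorphic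
    sectional curvature forces K = 0, because that of the plane (E_3, E_4) vanishes.
    When K = 0 the system df = sum_k P_k theta_k, dP = - P A (P a row) is completely
    integrable; solving the linear differential equation along rays from a point gives
    four functions with orthonormal differentials, and they form an isometric chart. *)

(* The curvature is defined through coordinate Christoffel symbols, so the frame calculus is tied to
   them once, in [christoffelE]. Afterwards tangent vectors are row vectors, [Th] turns coordinate
   components into frame components, and the covariant derivative of a row x of frame components is
   dx + x A. For the structure and curvature equations, the values and derivatives of h, H, cos and
   sin at a point are replaced by free real numbers, with (ln H)_yy written as 2 h^2 - (ln H)_xx;
   both equations then become identities between rational expressions. The analytic obstacle is that
   a solution built ray by ray has a priori no derivative across the rays. Complete integrability
   supplies a candidate for that derivative, and the error of the resulting first-order expansion
   satisfies a linear equation along the ray with a source of size O(|v|^2). A Gronwall estimate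
   then yields differentiability, and the equation itself yields smoothness by bootstrapping. *)
Require Import Defs.
From HB Require Import structures.
From mathcomp Require Import all_boot all_order all_algebra.
From mathcomp Require Import all_classical all_reals all_analysis.
From mathcomp Require Import ring lra.

Import Order.TTheory GRing.Theory Num.Theory numFieldNormedType.Exports.

Local Open Scope classical_set_scope.
Local Open Scope ring_scope.

Set Implicit Arguments.
Unset Strict Implicit.
Unset Printing Implicit Defensive.

(** * Differential calculus *)

Section Differentiability.
Context {R : realType} {V W : normedModType R}.
Implicit Types (f g : V -> W) (A : set V).

(** The solution of the total differential equation and the local inverse come with explicit epsilon
    estimates; this criterion turns such an estimate into the differential. *)
Lemma differentiable_approx f p (L : {linear V -> W}) : continuous L ->
    (forall e : R, 0 < e ->
      \forall k \near (0 : V), `|f (k + p) - f p - L k| <= e * `|k|) ->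
  differentiable f p /\ 'd f p = L :> (V -> W).
Proof.
move=> cL H.
have fE : f \o shift p = cst (f p) + L +o_ (0 : V) id.
  apply/eqaddoP => e e0; near=> k.
  by rewrite !fctE /= opprD addrA; near: k; exact: H.
have dE := diff_unique cL fE.
split=> //; apply/diff_locallyP; rewrite dE; split=> //.
Unshelve. all: by end_near. Qed.

Lemma differentiable_littleo f p : differentiable f p ->
  forall e : R, 0 < e ->
    \forall k \near (0 : V), `|f (k + p) - f p - 'd f p k| <= e * `|k|.
Proof.
move=> /diff_locally /eqaddoP H e /H; apply: filterS => k.
by rewrite !fctE /= opprD addrA.
Qed.

Lemma near_eq_differentiable f g p : (\near p, f p = g p) ->
  differentiable f p -> differentiable g p.
Proof.
move=> fg df; have cd : continuous ('d f p) by exact: diff_continuous.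
have [//|+ _] := @differentiable_approx g p ('d f p) cd.
move=> e e0; near=> k; rewrite -(nbhs_singleton fg).
have <- : f (k + p) = g (k + p).
  near: k; move: fg; rewrite (near_shift 0 p) subr0.
  by apply: filterS => k.
near: k; exact: differentiable_littleo.
Unshelve. all: by end_near. Qed.

Lemma near_open A p (P : V -> Prop) : open A -> A p ->
  (forall q, A q -> P q) -> \near p, P p.
Proof. by move=> oA Ap AP; apply: filterS AP _; exact: open_nbhs_nbhs. Qed.

Lemma eq_on_differentiable A f g p : open A -> (forall q, A q -> f q = g q) ->
  A p -> differentiable f p -> differentiable g p.
Proof.
by move=> oA fg Ap; apply: near_eq_differentiable; exact: near_open fg.
Qed.

Lemma eq_on_derive A f g p v : open A -> (forall q, A q -> f q = g q) ->
  A p -> 'D_v f p = 'D_v g p.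
Proof. by move=> oA fg Ap; apply: near_eq_derive; exact: near_open fg. Qed.

Lemma derive_linear f p (a : R) u v : differentiable f p ->
  'D_(a *: u + v) f p = a *: 'D_u f p + 'D_v f p.
Proof. by move=> df; rewrite !deriveE// linearP. Qed.

End Differentiability.

(** * Smoothness as differentiability of every finite order *)

Section Smooth.
Context {R : realType}.

(* Being n+1 times differentiable.  This is the form of smoothness that
   lends itself to induction. *)
Fixpoint ndiff {V W : normedModType R} (n : nat) (A : set V) (f : V -> W)
    : Prop :=
  (forall p, A p -> differentiable f p) /\
  if n is n'.+1 then forall v, ndiff n' A ('D_v f) else True.

Lemma ndiff_differentiable {V W : normedModType R} n (A : set V) (f : V -> W) p :
  A p -> ndiff n A f -> differentiable f p.
Proof. by move=> Ap; case: n => [|n] [df _]; exact: df. Qed.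

Lemma ndiffS {V W : normedModType R} n (A : set V) (f : V -> W) :
  ndiff n.+1 A f -> ndiff n A f.
Proof.
by elim: n f => [|n IH] f [df Df]; split=> // v; apply: IH; exact: Df.
Qed.

Lemma smooth_differentiable {V W : normedModType R} (A : set V) (f : V -> W) p :
  smooth_on A f -> A p -> differentiable f p.
Proof. by move=> sf Ap; exact: (sf [::]). Qed.

Lemma smooth_derive {V W : normedModType R} (A : set V) (f : V -> W) v :
  smooth_on A f -> smooth_on A ('D_v f).
Proof.
move=> sf vs p Ap; have := sf (rcons vs v) p Ap.
by rewrite -cats1 foldr_cat.
Qed.

Lemma smooth_ndiff {V W : normedModType R} (A : set V) (f : V -> W) :
  smooth_on A f <-> forall n, ndiff n A f.
Proof.
split=> [sf n|cf vs p Ap].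
  elim: n f sf => [|n IH] f sf; split=> //; try exact: (sf [::]).
  by move=> v; apply: IH; exact: smooth_derive.
have {cf} : ndiff (size vs) A f by exact: cf.
(* In [foldr] the innermost derivative is along the last direction of the list, hence the induction
   from the right end. *)
elim/last_ind: vs f => [|vs v IH] f; first by case=> /(_ _ Ap).
by rewrite size_rcons -cats1 foldr_cat => -[_ /(_ v)]; exact: IH.
Qed.

Lemma eq_ndiff {V W : normedModType R} n (A : set V) (f g : V -> W) :
  open A -> (forall p, A p -> f p = g p) -> ndiff n A f -> ndiff n A g.
Proof.
move=> oA; elim: n f g => [|n IH] f g fg [df Df].
  by split=> // p Ap; apply: (eq_on_differentiable oA fg) => //; exact: df.
split=> [p Ap|v]; first by apply: (eq_on_differentiable oA fg) => //; exact: df.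
by apply: IH (Df v) => p Ap; exact: eq_on_derive oA fg Ap.
Qed.

Lemma eq_smooth {V W : normedModType R} (A : set V) (f g : V -> W) :
  open A -> (forall p, A p -> f p = g p) -> smooth_on A f -> smooth_on A g.
Proof.
move=> oA fg /smooth_ndiff sf; apply/smooth_ndiff => n.
exact: eq_ndiff oA fg (sf n).
Qed.

Lemma smooth_subset {V W : normedModType R} (A B : set V) (f : V -> W) :
  A `<=` B -> smooth_on B f -> smooth_on A f.
Proof. by move=> AB sf vs p /AB; exact: sf. Qed.

Lemma ndiff_cst {V W : normedModType R} n (A : set V) (a : W) :
  ndiff n A (fun _ : V => a).
Proof.
elim: n a => [|n IH] a; (split; first by move=> p _; apply: differentiable_cst) => //.
move=> v.
have -> : 'D_v (fun _ : V => a) = fun=> 0 by apply/funext => p; rewrite derive_cst.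
exact: IH.
Qed.

Lemma ndiffD {V W : normedModType R} n (A : set V) (f g : V -> W) : open A ->
  ndiff n A f -> ndiff n A g -> ndiff n A (fun p => f p + g p).
Proof.
move=> oA; elim: n f g => [|n IH] f g [df Df] [dg Dg].
  by split=> // p Ap; apply: (@differentiableD _ _ _ f g); [exact: df|exact: dg].
split=> [p Ap|v].
  by apply: (@differentiableD _ _ _ f g); [exact: df|exact: dg].
apply: (eq_ndiff oA (f := fun p => 'D_v f p + 'D_v g p)).
  move=> p Ap; rewrite -(@deriveD _ _ _ f g)//.
    by apply: diff_derivable; exact: df.
  by apply: diff_derivable; exact: dg.
by apply: IH; [exact: Df|exact: Dg].
Qed.

Lemma ndiff_sum {V W : normedModType R} n (A : set V) (I : Type) (s : seq I)
    (P : pred I) (f : I -> V -> W) : open A ->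
  (forall i, P i -> ndiff n A (f i)) ->
  ndiff n A (fun p => \sum_(i <- s | P i) f i p).
Proof.
move=> oA sf; elim: s => [|i s IH].
  apply: (eq_ndiff oA (f := fun=> 0)) => [p _|]; first by rewrite big_nil.
  exact: ndiff_cst.
apply: (eq_ndiff oA (f := fun p =>
    (if P i then f i p else 0) + \sum_(i <- s | P i) f i p)).
  by move=> p _; rewrite big_cons; case: (P i); rewrite ?add0r.
by apply: ndiffD => //; case E: (P i); [exact: sf|exact: ndiff_cst].
Qed.

Lemma ndiffM {V : normedModType R} n (A : set V) (f g : V -> R) : open A ->
  ndiff n A f -> ndiff n A g -> ndiff n A (fun p => f p * g p).
Proof.
move=> oA; elim: n f g => [|n IH] f g cf cg; split=> //.
- move=> p Ap; apply: (@differentiableM _ _ f g);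
    [exact: ndiff_differentiable cf|exact: ndiff_differentiable cg].
- move=> p Ap; apply: (@differentiableM _ _ f g);
    [exact: ndiff_differentiable cf|exact: ndiff_differentiable cg].
move=> v; apply: (eq_ndiff oA (f := fun p => f p * 'D_v g p + g p * 'D_v f p)).
  by move=> p Ap; rewrite -(@deriveM _ _ f g)//; apply: diff_derivable;
    [exact: ndiff_differentiable cf|exact: ndiff_differentiable cg].
apply: ndiffD => //; apply: IH; try exact: ndiffS.
  by case: cg => _; exact.
by case: cf => _; exact.
Qed.

(** The chain rule replaces the outer function [k] by ['D_1 k], so the induction on the order ranges
    over all outer functions. *)
Lemma ndiff_comp {V : normedModType R} n (A : set V) (B : set R) (f : V -> R)
    (k : R -> R) : open A ->
  (forall p, A p -> B (f p)) -> ndiff n B k -> ndiff n A f ->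
  ndiff n A (fun p => k (f p)).
Proof.
move=> oA AB; elim: n f k AB => [|n IH] f k AB ck cf; split=> //.
- by move=> p Ap; apply: (@differentiable_comp _ _ _ _ f k);
    [exact: ndiff_differentiable cf|exact: ndiff_differentiable (AB _ Ap) ck].
- by move=> p Ap; apply: (@differentiable_comp _ _ _ _ f k);
    [exact: ndiff_differentiable cf|exact: ndiff_differentiable (AB _ Ap) ck].
move=> v; apply: (eq_ndiff oA (f := fun p => 'D_1 k (f p) * 'D_v f p)).
  move=> p Ap; have df := ndiff_differentiable Ap cf.
  have dk := ndiff_differentiable (AB _ Ap) ck.
  rewrite [RHS]deriveE; last exact: (@differentiable_comp _ _ _ _ f k).
  rewrite (@diff_comp _ _ _ _ f k)//= deriveE// deriveE// mulrC.
  by rewrite -[X in _ = 'd k _ X]mulr1 [RHS]linearZ.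
apply: ndiffM => //; last by case: cf => _; exact.
apply: (IH f ('D_1 k)) => //; last exact: ndiffS.
by case: ck => _; exact.
Qed.

End Smooth.

(** * Restriction to lines and mean value estimates *)

Section LineRestriction.
Context {R : realType} {V W : normedModType R}.
Implicit Types f : V -> W.

(** The difference quotients of [f] along [d] and of its restriction to the line are literally the
    same, so derivability in the one direction [d] suffices. *)
Lemma is_derive_line f (x d : V) (s : R) : derivable f (x + s *: d) d ->
  is_derive s (1 : R) (fun s => f (x + s *: d)) ('D_d f (x + s *: d)).
Proof.
have E : (fun h : R => h^-1 *: (((fun s => f (x + s *: d)) \o shift s) (h *: 1)
      - f (x + s *: d))) =
    (fun h => h^-1 *: ((f \o shift (x + s *: d)) (h *: d) - f (x + s *: d))).
  apply/funext => h /=; rewrite [h *: 1]mulr1 scalerDl.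
  by congr (_ *: (f _ - _)); rewrite addrCA.
by rewrite /derivable => df; split; rewrite ?/derivable ?/derive E.
Qed.

Lemma derive_shift_arg f (a p d : V) :
  'D_d (fun q => f (q + a)) p = 'D_d f (p + a).
Proof.
rewrite /derive; under eq_fun do rewrite /= -addrA.
by [].
Qed.

Lemma differentiable_shift_arg f (a p : V) : differentiable f (p + a) ->
  differentiable (fun q => f (q + a)) p.
Proof.
by move=> df; apply: (@differentiable_comp _ _ _ _ (fun q => q + a) f).
Qed.

Lemma deriveZ_dir f (p v : V) (a : R) : differentiable f p ->
  'D_(a *: v) f p = a *: 'D_v f p.
Proof. by move=> df; rewrite !deriveE// linearZ. Qed.

Lemma deriveD_dir f (p u v : V) : differentiable f p ->
  'D_(u + v) f p = 'D_u f p + 'D_v f p.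
Proof. by move=> df; rewrite !deriveE// linearD. Qed.

End LineRestriction.

Section MeanValue.
Context {R : realType} {V : normedModType R}.
Implicit Types f : V -> R.

Lemma mean_value_line f (x d : V) :
    (forall s : R, 0 <= s <= 1 -> differentiable f (x + s *: d)) ->
  exists2 c : R, 0 <= c <= 1 & f (x + d) - f x = 'D_d f (x + c *: d).
Proof.
move=> df; pose g (s : R) := f (x + s *: d).
have dg (s : R) : 0 <= s <= 1 -> is_derive s (1 : R) g ('D_d f (x + s *: d)).
  by move=> s01; apply: is_derive_line; apply/diff_derivable/df.
have cg : {within `[0, 1], continuous g}.
  apply: derivable_within_continuous => t; rewrite in_itv/= => t01.
  by have [] := dg _ t01.
have dgo (s : R) : s \in `]0, 1[ -> is_derive s (1 : R) g ('D_d f (x + s *: d)).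
  by move=> /itvP s01; apply: dg; rewrite !s01.
have [c cI] := MVT_segment ler01 dgo cg.
rewrite /g scale1r scale0r addr0 subr0 mulr1 => ->.
by exists c => //; rewrite in_itv/= in cI.
Qed.

Lemma lipschitz_line f (x d : V) (C : R) :
    (forall s : R, 0 <= s <= 1 -> differentiable f (x + s *: d)) ->
    (forall s : R, 0 <= s <= 1 -> `|'D_d f (x + s *: d)| <= C) ->
  `|f (x + d) - f x| <= C.
Proof. by move=> df bf; have [c c01 ->] := mean_value_line df; exact: bf. Qed.

Lemma derive_eq0_line f (x d : V) :
    (forall s : R, 0 <= s <= 1 -> differentiable f (x + s *: d)) ->
    (forall s : R, 0 <= s <= 1 -> 'D_d f (x + s *: d) = 0) ->
  f (x + d) = f x.
Proof.
move=> df f0; have [c c01 /eqP] := mean_value_line df.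
by rewrite f0// subr_eq0 => /eqP.
Qed.

End MeanValue.

(** * Symmetry of second derivatives *)

Section Schwarz.
Context {R : realType} {V : normedModType R}.
Implicit Types f : V -> R.

(** The mean value theorem in direction [v], applied to q -> f (q + s u) - f q, turns the second
    difference into s times an increment of ['D_v f]. Differentiability of ['D_v f] at the single
    point [p] then evaluates this increment up to o(s). *)
Local Lemma second_difference f (A : set V) (p u v : V) : open A -> A p ->
    (forall q, A q -> differentiable f q) -> differentiable ('D_v f) p ->
  forall e : R, 0 < e -> exists2 r : R, 0 < r & forall s : R, 0 < s < r ->
    `|f (p + s *: u + s *: v) - f (p + s *: u) - f (p + s *: v) + f p
      - s ^+ 2 * 'D_u ('D_v f) p| <= e * s ^+ 2.
Proof.
move=> oA Ap df ddf e e0.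
(* Two increments of ['D_v f], with arguments of norm at most s (|u| + |v|), are each estimated with
   relative error e / C; the summand 1 keeps [C] positive. *)
pose C : R := 2 * (`|u| + `|v|) + 1.
have C0 : 0 < C by rewrite ltr_wpDl// mulr_ge0// addr_ge0.
have /nbhs_normP[r1 /= r10 H1] := differentiable_littleo ddf (divr_gt0 e0 C0).
have /nbhs_normP[r2 /= r20 H2] := open_nbhs_nbhs (conj oA Ap).
pose r := Num.min r1 r2.
have r0 : 0 < r by rewrite lt_min r10.
exists (r / C); first by rewrite divr_gt0.
move=> s /andP[s0 sr].
have small (a b : R) : 0 <= a <= s -> 0 <= b <= s ->
    `|a *: u + b *: v| <= s * (`|u| + `|v|).
  move=> /andP[a0 as_] /andP[b0 bs]; rewrite mulrDr.
  by rewrite (le_trans (ler_normD _ _))// !normrZ !ger0_norm// lerD// ler_wpM2r.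
have smallr (a b : R) : 0 <= a <= s -> 0 <= b <= s -> `|a *: u + b *: v| < r.
  move=> aI bI; rewrite (le_lt_trans (small _ _ aI bI))//.
  rewrite (@le_lt_trans _ _ (s * C))//; last by rewrite -ltr_pdivlMr.
  rewrite ler_wpM2l ?(ltW s0)// /C mulr2n mulrDl mul1r -addrA lerDl.
  by rewrite addr_ge0// addr_ge0.
have inA (a b : R) : 0 <= a <= s -> 0 <= b <= s -> A (p + (a *: u + b *: v)).
  move=> aI bI; apply: H2 => /=; rewrite opprD addNKr normrN.
  by rewrite (lt_le_trans (smallr _ _ aI bI))// ge_min lexx orbT.
have s_in : 0 <= s <= s by rewrite lexx ltW.
have o_in : 0 <= (0 : R) <= s by rewrite lexx ltW.
pose F q := f (q + s *: u) - f q.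
have cs (c : R) : 0 <= c <= 1 -> 0 <= c * s <= s.
  by move=> /andP[c0 c1]; rewrite mulr_ge0 ?(ltW s0)//= ler_piMl// ltW.
have dF (c : R) : 0 <= c <= 1 ->
    differentiable f (p + c *: (s *: v)) /\
    differentiable f (p + c *: (s *: v) + s *: u).
  move=> /cs c01; rewrite scalerA; split; apply: df.
    by have := inA 0 (c * s) o_in c01; rewrite scale0r add0r.
  by have := inA s (c * s) s_in c01; rewrite addrAC addrA.
have [c c01 Fc] : exists2 c : R, 0 <= c <= 1 &
    F (p + s *: v) - F p = 'D_(s *: v) F (p + c *: (s *: v)).
  apply: mean_value_line => c /dF[d1 d2]; apply: differentiableB => //.
  exact: differentiable_shift_arg.
have {Fc} -> : f (p + s *: u + s *: v) - f (p + s *: u) - f (p + s *: v) + f p =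
    s * ('D_v f (p + (s *: u + (c * s) *: v)) - 'D_v f (p + (0 *: u + (c * s) *: v))).
  have [d1 d2] := dF _ c01.
  transitivity (F (p + s *: v) - F p).
    rewrite /F opprB addrA [p + s *: v + _]addrAC.
    by rewrite [_ - f (p + s *: v) + _]addrC !addrA addrC !addrA; ring.
  rewrite Fc deriveB; last 2 first.
  - by apply/diff_derivable/differentiable_shift_arg.
  - exact: diff_derivable.
  rewrite derive_shift_arg (deriveZ_dir _ _ d1) (deriveZ_dir _ _ d2) -scalerBr.
  by rewrite scale0r add0r addrA [p + s *: u + _]addrAC scalerA.
rewrite expr2 -mulrA -mulrBr normrM gtr0_norm// mulrCA ler_pM2l//.
have key (a b : R) : 0 <= a <= s -> 0 <= b <= s ->
  `|'D_v f (p + (a *: u + b *: v)) - 'D_v f p - 'd ('D_v f) p (a *: u + b *: v)|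
     <= e / C * (s * (`|u| + `|v|)).
  move=> aI bI; rewrite [p + _]addrC (le_trans (H1 _ _))//=.
    by rewrite sub0r normrN (lt_le_trans (smallr _ _ aI bI))// ge_min lexx.
  by rewrite ler_wpM2l ?small// divr_ge0// ltW.
have k1 := key s (c * s) s_in (cs _ c01); have k0 := key 0 (c * s) o_in (cs _ c01).
rewrite (deriveE u ddf).
have := lerD k1 k0; rewrite -[X in _ + X]normrN => /(le_trans (ler_normD _ _)).
set X : R := 'D_v f (_ + _); set Y : R := 'D_v f (_ + _); set Z : R := 'D_v f p.
rewrite !linearD !linearZ /= => le1.
rewrite (le_trans _ (le_trans le1 _))//.
  rewrite le_eqVlt; apply/orP; left; apply/eqP; congr `|_|.
  by rewrite /GRing.scale/=; ring.
rewrite -mulrDr -mulrDr.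
set N := `|u| + `|v|.
rewrite (_ : e / C * _ = e * s * ((N + N) / C)); last by ring.
rewrite ler_piMr ?mulr_ge0 ?(ltW e0) ?(ltW s0)// ler_pdivrMr// mul1r /C -/N.
lra.
Qed.

(** The second difference is symmetric in [u] and [v]; divided by s^2 it tends to both iterated
    derivatives. *)
Lemma derive_comm f (A : set V) (p u v : V) : open A -> A p ->
  smooth_on A f -> 'D_u ('D_v f) p = 'D_v ('D_u f) p.
Proof.
move=> oA Ap sf; apply/eqP; rewrite -subr_eq0 -normr_le0.
apply/ler_addgt0Pr => e e0; rewrite add0r.
have df q : A q -> differentiable f q by exact: smooth_differentiable.
have dd w : differentiable ('D_w f) p.
  by apply: smooth_differentiable Ap; exact: smooth_derive.
have e20 : 0 < e / 2 by rewrite divr_gt0.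
have [r1 r10 H1] := second_difference u oA Ap df (dd v) e20.
have [r2 r20 H2] := second_difference v oA Ap df (dd u) e20.
pose s := Num.min r1 r2 / 2.
have m0 : 0 < Num.min r1 r2 by rewrite lt_min r10.
have s0 : 0 < s by rewrite divr_gt0.
have sm : s < Num.min r1 r2 by rewrite ltr_pdivrMr// ltr_pMr// ltr1n.
move: (sm); rewrite lt_min => /andP[sr1 sr2].
have h1 : 0 < s < r1 by rewrite s0.
have h2 : 0 < s < r2 by rewrite s0.
have {H1} := H1 _ h1; have {H2} := H2 _ h2.
rewrite [p + s *: v + _]addrAC.
move: (f (p + s *: u + s *: v)) (f (p + s *: u)) (f (p + s *: v)) (f p)
  ('D_u ('D_v f) p) ('D_v ('D_u f) p) => a b c d D D'.
rewrite !ler_norml => /andP[l1 l2] /andP[l3 l4].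
have q0 : 0 < s ^+ 2 by rewrite exprn_gt0.
by apply/andP; split; rewrite -(ler_pM2l q0); lra.
Qed.

End Schwarz.

(** * Closure properties of smooth functions and elementary examples *)

Section SmoothFunctions.
Context {R : realType} {V : normedModType R}.
Variable A : set V.
Hypothesis oA : open A.
Implicit Types f g : V -> R.

Lemma smooth_cst {W : normedModType R} (a : W) : smooth_on A (fun=> a).
Proof. by apply/smooth_ndiff => n; exact: ndiff_cst. Qed.

Lemma smoothD {W : normedModType R} (f g : V -> W) :
  smooth_on A f -> smooth_on A g -> smooth_on A (fun p => f p + g p).
Proof.
by move=> /smooth_ndiff sf /smooth_ndiff sg; apply/smooth_ndiff => n; exact: ndiffD.
Qed.

Lemma smoothM f g :
  smooth_on A f -> smooth_on A g -> smooth_on A (fun p => f p * g p).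
Proof.
by move=> /smooth_ndiff sf /smooth_ndiff sg; apply/smooth_ndiff => n; exact: ndiffM.
Qed.

Lemma smooth_comp (B : set R) f (k : R -> R) : (forall p, A p -> B (f p)) ->
  smooth_on B k -> smooth_on A f -> smooth_on A (fun p => k (f p)).
Proof.
move=> AB /smooth_ndiff sk /smooth_ndiff sf; apply/smooth_ndiff => n.
exact: (ndiff_comp oA AB).
Qed.

Lemma smoothN f : smooth_on A f -> smooth_on A (fun p => - f p).
Proof.
move=> sf; apply: (eq_smooth oA (f := fun p => -1 * f p)).
  by move=> p _; rewrite mulN1r.
by apply: smoothM => //; exact: smooth_cst.
Qed.

Lemma smoothB f g :
  smooth_on A f -> smooth_on A g -> smooth_on A (fun p => f p - g p).
Proof. by move=> sf sg; apply: smoothD => //; exact: smoothN. Qed.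

Lemma smooth_sum {W : normedModType R} (I : Type) (s : seq I) (P : pred I)
    (f : I -> V -> W) :
  (forall i, P i -> smooth_on A (f i)) ->
  smooth_on A (fun p => \sum_(i <- s | P i) f i p).
Proof.
move=> sf; apply/smooth_ndiff => n; apply: ndiff_sum => // i /sf.
by move=> /smooth_ndiff.
Qed.

Lemma smooth_prod (I : Type) (s : seq I) (f : I -> V -> R) :
  (forall i, smooth_on A (f i)) ->
  smooth_on A (fun p => \prod_(i <- s) f i p).
Proof.
move=> sf; elim: s => [|i s IH].
  apply: (eq_smooth oA (f := fun=> (1 : R))) => [p _|]; first by rewrite big_nil.
  exact: smooth_cst.
apply: (eq_smooth oA (f := fun p => f i p * \prod_(i <- s) f i p)).
  by move=> p _; rewrite big_cons.
exact: smoothM.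
Qed.

End SmoothFunctions.

Section SmoothPrecomposition.
Context {R : realType} {V V' W : normedModType R}.

Lemma derive_precomp_linear (L : {linear V -> V'}) (k : V' -> W) p v :
  continuous L -> differentiable k (L p) ->
  'D_v (fun q => k (L q)) p = 'D_(L v) k (L p).
Proof.
move=> cL dk; have dL : differentiable L p by exact: linear_differentiable.
rewrite [LHS]deriveE; last exact: (@differentiable_comp _ _ _ _ L k).
by rewrite (@diff_comp _ _ _ _ L k)//= diff_lin// deriveE.
Qed.

Lemma smooth_precomp_linear (A : set V) (B : set V') (L : {linear V -> V'})
    (k : V' -> W) : open A -> (forall p, A p -> B (L p)) -> continuous L ->
  smooth_on B k -> smooth_on A (fun p => k (L p)).
Proof.
move=> oA AB cL /smooth_ndiff sk; apply/smooth_ndiff => n.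
have {sk} : ndiff n B k by exact: sk.
elim: n k => [|n IH] k sk; have dk p : A p -> differentiable (fun p => k (L p)) p.
- move=> Ap; apply: (@differentiable_comp _ _ _ _ L k).
    exact: linear_differentiable.
  exact: ndiff_differentiable (AB _ Ap) sk.
- by split.
- move=> Ap; apply: (@differentiable_comp _ _ _ _ L k).
    exact: linear_differentiable.
  exact: ndiff_differentiable (AB _ Ap) sk.
split=> // v; apply: (eq_ndiff oA (f := fun p => 'D_(L v) k (L p))).
  move=> p Ap; rewrite derive_precomp_linear//.
  exact: ndiff_differentiable (AB _ Ap) sk.
by apply: (IH ('D_(L v) k)); case: sk => _; exact.
Qed.

End SmoothPrecomposition.

Section Elementary.
Context {R : realType}.

Lemma derive1_dir (f : R -> R) (x v : R) : differentiable f x ->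
  'D_v f x = v * 'D_1 f x.
Proof.
move=> df; rewrite -[X in 'D_X _ _]mulr1 -[v * 1]/(v *: (1 : R)).
by rewrite (deriveZ_dir _ _ df).
Qed.

Lemma is_derive1_differentiable (f : R -> R) (x df : R) :
  is_derive x 1 f df -> differentiable f x.
Proof. by case=> + _; move/derivable1_diffP. Qed.

Let ndiff_cos_sin n : ndiff n setT (@cos R) /\ ndiff n setT (@sin R).
Proof.
have dc (x : R) : differentiable (@cos R) x.
  exact: (is_derive1_differentiable (is_derive_cos x)).
have ds (x : R) : differentiable (@sin R) x.
  exact: (is_derive1_differentiable (is_derive_sin x)).
elim: n => [|n [IHc IHs]]; first by do 2?split.
split; split=> // v.
  apply: (eq_ndiff openT (f := fun x : R => (- v) * sin x)) => [x _|].
    by rewrite derive1_dir// (@derive_val _ _ _ _ _ _ _ (is_derive_cos x)) mulrN mulNr.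
  by apply: ndiffM openT _ IHs; exact: ndiff_cst.
apply: (eq_ndiff openT (f := fun x : R => v * cos x)) => [x _|].
  by rewrite derive1_dir// (@derive_val _ _ _ _ _ _ _ (is_derive_sin x)).
by apply: ndiffM openT _ IHc; exact: ndiff_cst.
Qed.

Lemma smooth_cos : smooth_on setT (@cos R).
Proof. by apply/smooth_ndiff => n; have [] := ndiff_cos_sin n. Qed.

Lemma smooth_sin : smooth_on setT (@sin R).
Proof. by apply/smooth_ndiff => n; have [] := ndiff_cos_sin n. Qed.

Let open_neq0 : open [set x : R | x != 0].
Proof.
rewrite (_ : [set _ | _] = [set x | x < 0] `|` [set x | 0 < x]).
  by apply: openU; [exact: open_lt|exact: open_gt].
by apply/seteqP; split=> x /=; rewrite neq_lt => /orP.
Qed.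

Lemma derive_inv (x v : R) : x != 0 -> 'D_v (@GRing.inv R) x = - (x^-1 * x^-1) * v.
Proof.
move=> x0; have : differentiable (@GRing.inv R) x by exact: differentiable_Rinv.
by move=> df; rewrite deriveE// diff_Rinv//= expr2 invfM.
Qed.

(** In a fixed direction the derivative is a constant multiple of the square of the inverse, so the
    product rule closes the induction. *)
Lemma smooth_inv : smooth_on [set x : R | x != 0] (@GRing.inv R).
Proof.
apply/smooth_ndiff; elim=> [|n IH]; split=> //; try exact: differentiable_Rinv.
move=> v; apply: (eq_ndiff open_neq0 (f := fun x : R => (- v) * (x^-1 * x^-1))).
  by move=> x x0; rewrite derive_inv// mulNr mulrC mulNr.
apply: ndiffM => //; first exact: ndiff_cst.
exact: ndiffM.
Qed.

Lemma smooth_ln : smooth_on [set x : R | 0 < x] (@ln R).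
Proof.
have dl (x : R) : 0 < x -> differentiable (@ln R) x.
  by move=> x0; exact: (is_derive1_differentiable (is_derive1_ln x0)).
apply/smooth_ndiff => -[|n]; split=> // v.
have o : open [set x : R | 0 < x] by exact: open_gt.
apply: (eq_ndiff o (f := fun x : R => v * x^-1)) => [x x0|].
  by rewrite (derive1_dir _ (dl _ x0)); have [_ ->] := is_derive1_ln x0.
apply: ndiffM => //; first exact: ndiff_cst.
suff : smooth_on [set x : R | 0 < x] (@GRing.inv R) by move=> /smooth_ndiff.
by apply: smooth_subset smooth_inv => x /= x0; rewrite gt_eqF.
Qed.

End Elementary.

Section SmoothV.
Context {R : realType} {V : normedModType R}.

Lemma smoothV (A : set V) (f : V -> R) : open A -> (forall p, A p -> f p != 0) ->
  smooth_on A f -> smooth_on A (fun p => (f p)^-1).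
Proof. by move=> oA f0; apply: smooth_comp => //; last exact: smooth_inv. Qed.

Lemma derive_comp1 (f : V -> R) (k : R -> R) p v : differentiable f p ->
  differentiable k (f p) -> 'D_v (fun q => k (f q)) p = 'D_1 k (f p) * 'D_v f p.
Proof.
move=> df dk; rewrite [LHS]deriveE; last exact: (@differentiable_comp _ _ _ _ f k).
rewrite (@diff_comp _ _ _ _ f k)//= -(deriveE _ dk) (derive1_dir _ dk) mulrC.
by rewrite -(deriveE _ df).
Qed.

End SmoothV.

Lemma differentiable_bigsum {R : realType} {V W : normedModType R} (I : Type)
    (s : seq I) (f : I -> V -> W) p :
  (forall i, differentiable (f i) p) ->
  differentiable (fun q => \sum_(i <- s) f i q) p.
Proof.
move=> df; elim: s => [|i s IH].
  under eq_fun do rewrite big_nil.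
  exact: differentiable_cst.
under eq_fun do rewrite big_cons.
exact: (@differentiableD _ _ _ (f i)).
Qed.

Lemma is_derive_bigsum {R : realType} {V W : normedModType R} (I : Type)
    (s : seq I) (f : I -> V -> W) (df : I -> W) p v :
  (forall i, is_derive p v (f i) (df i)) ->
  is_derive p v (fun q => \sum_(i <- s) f i q) (\sum_(i <- s) df i).
Proof.
move=> Df; elim: s => [|i s IH].
  under eq_fun do rewrite big_nil.
  by rewrite big_nil; exact: is_derive_cst.
under eq_fun do rewrite big_cons.
by rewrite big_cons; exact: (@is_deriveD _ _ _ (f i)).
Qed.

(** * Entrywise calculus of matrix-valued functions *)

Section MatrixValued.
Context {R : realType}.

Lemma linear_continuous_rV m (W : normedModType R) (L : {linear 'rV[R]_m -> W}) :
  continuous L.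
Proof.
have -> : (L : _ -> _) = fun p => \sum_(i < m) p 0 i *: L (delta_mx 0 i).
  apply/funext => p; rewrite {1}(row_sum_delta p) linear_sum.
  by apply: eq_bigr => i _; rewrite linearZ.
move=> p; apply: differentiable_continuous.
apply: differentiable_bigsum => i; apply: differentiableZl.
exact: differentiable_coord.
Qed.

Context {V : normedModType R}.

Lemma differentiable_mx m n (F : V -> 'M[R]_(m, n)) p :
  (forall i j, differentiable (fun q => F q i j) p) -> differentiable F p.
Proof.
move=> dF.
have -> : F = fun q => \sum_(i < m) \sum_(j < n) F q i j *: delta_mx i j.
  by apply/funext => q; rewrite -matrix_sum_delta.
do 2!apply: differentiable_bigsum => ?; exact: differentiableZl.
Qed.

Lemma differentiable_entry m n (F : V -> 'M[R]_(m, n)) p i j :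
  differentiable F p -> differentiable (fun q => F q i j) p.
Proof.
move=> dF; apply: (@differentiable_comp _ _ _ _ F (fun M : 'M[R]_(m, n) => M i j)) => //.
exact: differentiable_coord.
Qed.

Lemma derive_entry m n (F : V -> 'M[R]_(m, n)) p v i j : derivable F p v ->
  'D_v F p i j = 'D_v (fun q => F q i j) p.
Proof. by move=> dF; rewrite derive_mx// mxE. Qed.

Lemma smooth_mx (A : set V) m n (F : V -> 'M[R]_(m, n)) : open A ->
  (forall i j, smooth_on A (fun q => F q i j)) -> smooth_on A F.
Proof.
move=> oA sF; apply/smooth_ndiff => k.
have {sF} : forall i j, ndiff k A (fun q => F q i j).
  by move=> i j; move: (sF i j) => /smooth_ndiff.
elim: k F => [|k IH] F sF; have dF p : A p -> differentiable F p.
- by move=> Ap; apply: differentiable_mx => i j; case: (sF i j) => /(_ _ Ap).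
- by split.
- by move=> Ap; apply: differentiable_mx => i j; case: (sF i j) => /(_ _ Ap).
split=> // v; apply: IH => i j; have [_ /(_ v)] := sF i j.
apply: eq_ndiff => // p Ap; rewrite derive_entry//.
exact/diff_derivable/dF.
Qed.

Lemma differentiable_mulmx m n k (X : V -> 'M[R]_(m, n)) (Y : V -> 'M[R]_(n, k)) p :
  differentiable X p -> differentiable Y p ->
  differentiable (fun q => X q *m Y q) p.
Proof.
move=> dX dY; apply: differentiable_mx => i j; under eq_fun do rewrite mxE.
apply: differentiable_bigsum => l.
by apply: (@differentiableM _ _ (fun q => X q i l) (fun q => Y q l j));
  exact: differentiable_entry.
Qed.

Lemma derivable_mulmx m n k (X : V -> 'M[R]_(m, n)) (Y : V -> 'M[R]_(n, k)) p v :
  derivable X p v -> derivable Y p v -> is_derive p v (fun q => X q *m Y q)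
    ('D_v X p *m Y p + X p *m 'D_v Y p).
Proof.
move=> dX dY; have dX' := (derivable_mxP _ _ _).1 dX.
have dY' := (derivable_mxP _ _ _).1 dY.
have E i j : is_derive p v (fun q => (X q *m Y q) i j)
    (('D_v X p *m Y p + X p *m 'D_v Y p) i j).
  rewrite !mxE -big_split/=.
  under eq_fun do rewrite mxE.
  apply: is_derive_bigsum => l; apply: is_derive_eq.
    by apply: is_deriveM; [exact: derivableP (dX' i l)|exact: derivableP (dY' l j)].
  by rewrite !derive_entry// /GRing.scale/= addrC; congr (_ + _); exact: mulrC.
have dXY : derivable (fun q => X q *m Y q) p v.
  by apply/derivable_mxP => i j; have [] := E i j.
split=> //; apply/matrixP => i j; rewrite derive_entry//.
by have [_ ->] := E i j.
Qed.

Lemma is_derive_mx m n (F : V -> 'M[R]_(m, n)) p v (D : 'M[R]_(m, n)) :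
  (forall i j, is_derive p v (fun q => F q i j) (D i j)) -> is_derive p v F D.
Proof.
move=> dF; have D' : derivable F p v.
  by apply/derivable_mxP => i j; have [] := dF i j.
split=> //; apply/matrixP => i j; apply: etrans (derive_entry i j D') _.
by have [_ ->] := dF i j.
Qed.

End MatrixValued.

Lemma ord4_ind (P : 'I_4 -> Prop) : P i1 -> P i2 -> P i3 -> P i4 -> forall i, P i.
Proof.
move=> P1 P2 P3 P4 [[|[|[|[|//]]]] i4].
- by rewrite (_ : Ordinal i4 = i1)//; exact: val_inj.
- by rewrite (_ : Ordinal i4 = i2)//; exact: val_inj.
- by rewrite (_ : Ordinal i4 = i3)//; exact: val_inj.
- by rewrite (_ : Ordinal i4 = Defs.i4)//; exact: val_inj.
Qed.

Lemma sum_ord4 (W : nmodType) (F : 'I_4 -> W) :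
  \sum_(i < 4) F i = F i1 + F i2 + F i3 + F i4.
Proof.
rewrite !big_ord_recl big_ord0 addr0 !addrA.
by do !congr (_ + _); congr F; exact: val_inj.
Qed.

Section PointwiseDerivatives.
Context {R : realType} {V : normedModType R}.
Implicit Types f g : V -> R.

Lemma is_derive_add f g p v a b : is_derive p v f a -> is_derive p v g b ->
  is_derive p v (fun q => f q + g q) (a + b).
Proof. by move=> df dg; exact: (is_deriveD (f := f)). Qed.

Lemma is_derive_opp f p v a : is_derive p v f a ->
  is_derive p v (fun q => - f q) (- a).
Proof. by move=> df; exact: (is_deriveN (f := f)). Qed.

Lemma is_derive_mul f g p v a b : is_derive p v f a -> is_derive p v g b ->
  is_derive p v (fun q => f q * g q) (a * g p + f p * b).
Proof.
move=> df dg; apply: (is_derive_eq (is_deriveM df dg)).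
by rewrite /GRing.scale/= addrC; congr (_ + _); exact: mulrC.
Qed.

End PointwiseDerivatives.

Section Base.
Context {R : realType}.
Local Notation R4 := 'rV[R]_4.

Lemma base_is_linear : linear (@base R).
Proof.
by move=> a u v; apply/rowP => j; rewrite !mxE; case: (j == 0).
Qed.
HB.instance Definition _ := GRing.isLinear.Build R R4 'rV[R]_2 *:%R (@base R)
  base_is_linear.

Lemma continuous_base : continuous (@base R).
Proof. exact: linear_continuous_rV. Qed.

Lemma baseE (u : R4) : base u = u 0 i1 *: delta_mx 0 0 + u 0 i2 *: delta_mx 0 1.
Proof.
apply/rowP => j; rewrite !mxE eqxx/=.
by case: j => [[|[|//]] j2]; rewrite /= ?(mulr1, mulr0, addr0, add0r).
Qed.

Lemma is_derive_base (k : 'rV[R]_2 -> R) (p u : R4) : differentiable k (base p) ->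
  is_derive p u (fun q => k (base q))
    (u 0 i1 * partial 0 k (base p) + u 0 i2 * partial 1 k (base p)).
Proof.
move=> dk; have cb := @continuous_base.
have db : differentiable (@base R) p by exact: linear_differentiable.
split.
  by apply: diff_derivable; exact: (@differentiable_comp _ _ _ _ (@base R) k).
apply: etrans (derive_precomp_linear u cb dk) _.
by rewrite [LHS](_ : _ = 'D_(base u) k (base p))// (baseE u) deriveD_dir// !deriveZ_dir.
Qed.

Lemma is_derive_coord n (p u : 'rV[R]_n) i :
  is_derive p u (fun q : 'rV[R]_n => q 0 i) (u 0 i).
Proof.
have D : derivable (@id 'rV[R]_n) p u by exact: derivable_id.
split; first by have /derivable_mxP := D; exact.
by rewrite -(derive_entry 0 i D) derive_id.
Qed.

Lemma smooth_coord n (A : set 'rV[R]_n) i : smooth_on A (fun p => p 0 i).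
Proof.
apply/smooth_ndiff => -[|k]; first by split=> // p _; exact: differentiable_coord.
split=> [p _|v]; first exact: differentiable_coord.
have -> : 'D_v (fun p : 'rV[R]_n => p 0 i) = fun=> v 0 i.
  by apply/funext => p; have [_ ->] := is_derive_coord p v i.
exact: ndiff_cst.
Qed.

Lemma is_derive_cos_coord (p u : R4) i :
  is_derive p u (fun q : R4 => cos (q 0 i / 2)) (- sin (p 0 i / 2) * (u 0 i / 2)).
Proof.
have D : is_derive p u (fun q : R4 => q 0 i / 2) (u 0 i / 2).
  apply: is_derive_eq; first by apply: is_derive_mul; exact: is_derive_coord.
  by rewrite mulr0 addr0.
have df : differentiable (fun q : R4 => q 0 i / 2) p.
  apply: (@differentiableM _ _ (fun q : R4 => q 0 i)) => //.
  exact: differentiable_coord.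
have dc := is_derive1_differentiable (is_derive_cos (p 0 i / 2)).
split.
  apply: diff_derivable.
  exact: (@differentiable_comp _ _ _ _ (fun q : R4 => q 0 i / 2) cos).
have [_ <-] := D; have [_ <-] := is_derive_cos (p 0 i / 2).
exact: derive_comp1 df dc.
Qed.

Lemma is_derive_sin_coord (p u : R4) i :
  is_derive p u (fun q : R4 => sin (q 0 i / 2)) (cos (p 0 i / 2) * (u 0 i / 2)).
Proof.
have D : is_derive p u (fun q : R4 => q 0 i / 2) (u 0 i / 2).
  apply: is_derive_eq; first by apply: is_derive_mul; exact: is_derive_coord.
  by rewrite mulr0 addr0.
have df : differentiable (fun q : R4 => q 0 i / 2) p.
  apply: (@differentiableM _ _ (fun q : R4 => q 0 i)) => //.
  exact: differentiable_coord.
have dc := is_derive1_differentiable (is_derive_sin (p 0 i / 2)).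
split.
  apply: diff_derivable.
  exact: (@differentiable_comp _ _ _ _ (fun q : R4 => q 0 i / 2) sin).
have [_ <-] := D; have [_ <-] := is_derive_sin (p 0 i / 2).
exact: derive_comp1 df dc.
Qed.

End Base.

(** * Linear differential equations *)

Section MatrixNorm.
Context {R : realType}.

Lemma norm_mx_entry m n (A : 'M[R]_(m, n)) i j : `|A i j| <= `|A|.
Proof.
rewrite [leRHS]/Num.Def.normr/= mx_normrE.
exact: (le_bigmax _ (fun ij => `|A ij.1 ij.2|) (i, j)).
Qed.

Lemma norm_mx_le m n (A : 'M[R]_(m, n)) (C : R) : 0 <= C ->
  (forall i j, `|A i j| <= C) -> `|A| <= C.
Proof.
move=> C0 AC; rewrite [leLHS]/Num.Def.normr/= mx_normrE.
by apply: bigmax_le => // -[i j] _ /=.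
Qed.

Lemma norm_mulmx_le m n k (A : 'M[R]_(m, n)) (B : 'M[R]_(n, k)) :
  `|A *m B| <= n%:R * `|A| * `|B|.
Proof.
apply: norm_mx_le; first by rewrite !mulr_ge0.
move=> i j; rewrite mxE (le_trans (ler_norm_sum _ _ _))//.
rewrite -mulrA mulr_natl -[X in _ *+ X](card_ord n) -sumr_const.
by apply: ler_sum => l _; rewrite normrM ler_pM ?norm_mx_entry.
Qed.

(** The norm is the largest absolute value of an entry, so the scalar mean value inequality applies
    entry by entry without loss in [C]. The minimum and maximum allow either order of the
    endpoints. *)
Lemma norm_mx_lipschitz m n (Y dY : R -> 'M[R]_(m, n)) (C a b : R) : 0 <= C ->
  (forall x, Num.min a b <= x <= Num.max a b -> is_derive x 1 Y (dY x) /\ `|dY x| <= C) ->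
  `|Y b - Y a| <= C * `|b - a|.
Proof.
move=> C0 H; apply: norm_mx_le => [|i j]; first by rewrite mulr_ge0.
have H' (s : R) : 0 <= s <= 1 -> is_derive (a + s *: (b - a)) 1 Y (dY (a + s *: (b - a)))
    /\ `|dY (a + s *: (b - a))| <= C.
  move=> /andP[s0 s1]; apply: H; rewrite /GRing.scale/= ge_min le_max.
  have [ab|ba] := leP a b.
    by apply/andP; split; apply/orP; [left|right]; nra.
  by apply/andP; split; apply/orP; [right|left]; nra.
have dF (s : R) : 0 <= s <= 1 -> differentiable (fun q => Y q i j) (a + s *: (b - a)).
  move=> /H'[[dYs _] _]; apply: differentiable_entry.
  exact/derivable1_diffP.
have := @lipschitz_line R R (fun q => Y q i j) a (b - a) (C * `|b - a|) dF.
rewrite subrKC !mxE; apply=> s s01; have [[dYs vY] le] := H' s s01.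
rewrite (derive1_dir _ (dF _ s01)) -(derive_entry i j dYs) vY normrM mulrC.
by rewrite ler_wpM2r// (le_trans (norm_mx_entry _ _ _)).
Qed.

End MatrixNorm.

Section Primitive.
Context {R : realType}.

(** Integrating from -3 makes every x with |x| < 3 interior to [-3, 3]. The iterates below are
    estimated for |x| <= 2, which leaves room for two-sided derivatives at the endpoints. *)
Lemma continuous_primitive (f : R -> R) : continuous f ->
  exists2 F : R -> R, F 0 = 0 & forall x : R, `|x| < 3 -> is_derive x 1 F (f x).
Proof.
move=> cf; pose G (x : R) : R := (\int[lebesgue_measure]_(t in `[- 3 : R, x]) f t)%R.
exists (fun x => G x - G 0); first by rewrite subrr.
move=> x; rewrite ltr_norml => /andP[x3 x3'].
have [dG vG] : derivable G x 1 /\ derive1 G x = f x.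
  apply: (@continuous_FTC1_closed R f (- 3) x 3) => //; last exact: cf.
  apply: continuous_compact_integrable; first exact: segment_compact.
  exact: continuous_subspaceT.
have DG : is_derive x 1 G (f x) by split; [exact: dG|rewrite -derive1E].
have := is_derive_add DG (is_derive_cst (- G 0) x 1); rewrite addr0.
exact.
Qed.

Lemma continuous_primitive_mx m n (f : R -> 'M[R]_(m, n)) : continuous f ->
  exists2 F : R -> 'M[R]_(m, n), F 0 = 0 &
    forall x : R, `|x| < 3 -> is_derive x 1 F (f x).
Proof.
move=> cf; have P i j : exists F : R -> R, F 0 = 0 /\
    forall x : R, `|x| < 3 -> is_derive x 1 F (f x i j).
  have cij : continuous (fun x => f x i j).
    move=> x; apply: (@continuous_comp _ _ _ f (fun A : 'M[R]_(m, n) => A i j)).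
      exact: cf.
    exact: coord_continuous.
  by have [F F0 dF] := continuous_primitive cij; exists F.
pose F i j := projT1 (cid (P i j)).
exists (fun x => \matrix_(i, j) F i j x).
  by apply/matrixP => i j; rewrite !mxE; have [] := projT2 (cid (P i j)).
move=> x x3; apply: is_derive_mx => i j; under eq_fun do rewrite mxE.
by have [_] := projT2 (cid (P i j)); exact.
Qed.

End Primitive.

Section GeometricTail.
Context {R : realType}.

Lemma geometric_sum_le (N m : nat) :
  \sum_(N <= k < N + m) (2^-1 ^+ k : R) <= 2 * 2^-1 ^+ N.
Proof.
suff -> : \sum_(N <= k < N + m) (2^-1 ^+ k : R) = 2 * 2^-1 ^+ N * (1 - 2^-1 ^+ m).
  have x0 k : 0 <= 2^-1 ^+ k :> R by rewrite exprn_ge0// invr_ge0.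
  by apply: ler_piMr; [exact: mulr_ge0|rewrite gerBl].
elim: m => [|m IH]; first by rewrite addn0 big_geq// expr0 subrr mulr0.
rewrite addnS big_nat_recr ?leq_addr//= IH exprS exprD; by field.
Qed.

(** The limit comes with an explicit rate, so that later inequalities pass to the limit through
    [le0_geometric]. *)
Lemma summable_geometric (y : nat -> R) : (forall k, `|y k| <= 2^-1 ^+ k) ->
  exists a : R, forall N, `|a - \sum_(0 <= k < N) y k| <= 2 * 2^-1 ^+ N.
Proof.
move=> yle.
have cy : cvgn (series y).
  apply: (@normed_cvg R R^o).
  apply: (@series_le_cvg R (fun k => `|y k|) (geometric 1 2^-1)) => [k|k|k|].
  - exact: normr_ge0.
  - by rewrite /geometric/= mul1r exprn_ge0// invr_ge0.
  - by rewrite /geometric/= mul1r.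
  - by apply: is_cvg_geometric_series; rewrite ger0_norm ?invr_ge0// invf_lt1// ltr1n.
exists (limn (series y)) => N; apply/ler_addgt0Pl => e e0.
have /cvgrPdist_le/(_ e e0) := cy.
move=> [n0 _ Hn]; have := Hn (maxn N n0) (leq_maxr _ _) => /=.
rewrite /series/= (@big_cat_nat _ _ _ N) ?leq_maxl//=.
set S := \sum_(0 <= k < N) y k; set T := \sum_(N <= k < _) y k => le1.
have le2 : `|T| <= 2 * 2^-1 ^+ N.
  rewrite /T (le_trans (ler_norm_sum _ _ _))//.
  rewrite (le_trans _ (geometric_sum_le N (maxn N n0 - N)))// subnKC ?leq_maxl//.
  exact: ler_sum.
rewrite (_ : _ - S = (limn (fun n => \sum_(0 <= k < n) y k) - (S + T)) + T); last first.
  by rewrite opprD addrA subrK.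
exact: le_trans (ler_normD _ _) (lerD le1 le2).
Qed.

End GeometricTail.

Section ContinuousMatrix.
Context {R : realType} {T : topologicalType}.

Lemma continuous_mx m n (F : T -> 'M[R]_(m, n)) x :
  (forall i j, {for x, continuous (fun y => F y i j)}) -> {for x, continuous F}.
Proof.
move=> cF; apply/cvgrPdist_le => /= e e0.
have H : \forall y \near x, forall ij : 'I_m * 'I_n, `|F x ij.1 ij.2 - F y ij.1 ij.2| <= e.
  apply: filter_forall => -[i j]; have /cvgrPdist_le := cF i j.
  exact.
apply: filterS H => y H; apply: norm_mx_le => [|i j]; first exact: ltW.
by rewrite !mxE; exact: (H (i, j)).
Qed.

Lemma continuous_entry m n (F : T -> 'M[R]_(m, n)) x i j :
  {for x, continuous F} -> {for x, continuous (fun y => F y i j)}.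
Proof.
move=> cF; apply: (@continuous_comp _ _ _ F (fun A : 'M[R]_(m, n) => A i j)) => //.
exact: coord_continuous.
Qed.

Lemma continuous_mulmx m n k (X : T -> 'M[R]_(m, n)) (Y : T -> 'M[R]_(n, k)) x :
  {for x, continuous X} -> {for x, continuous Y} ->
  {for x, continuous (fun y => X y *m Y y)}.
Proof.
move=> cX cY; apply: continuous_mx => i j.
suff : (fun y => (X y *m Y y) i j) @ x --> (X x *m Y x) i j by [].
rewrite mxE; under eq_fun do rewrite mxE.
pose G s y := \sum_(l <- s) X y i l * Y y l j.
suff : forall s, G s @ x --> G s x by exact.
elim=> [|l s IH].
  have -> : G [::] = fun=> 0 by apply/funext => y; rewrite /G big_nil.
  exact: cvg_cst.
have -> : G (l :: s) = fun y => X y i l * Y y l j + G s y.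
  by apply/funext => y; rewrite /G big_cons.
apply: cvgD => //; apply: cvgM.
  exact: (@continuous_entry _ _ X x i l cX).
exact: (@continuous_entry _ _ Y x l j cY).
Qed.

End ContinuousMatrix.

Lemma le0_geometric {R : realType} (x C : R) :
  (forall N, x <= C * 2^-1 ^+ N) -> x <= 0.
Proof.
move=> H; apply/ler_addgt0Pl => e e0; rewrite addr0.
have : geometric C 2^-1 @ \oo --> (0 : R).
  by apply: cvg_geometric; rewrite ger0_norm ?invr_ge0// invf_lt1// ltr1n.
move=> /cvgrPdist_le/(_ e e0)[N _ /(_ N (leqnn N))/=].
by rewrite sub0r normrN => /(le_trans (ler_norm _)); exact: le_trans.
Qed.

Lemma is_derive_approx {R : realType} {W : normedModType R} (Y : R -> W) (s : R) D :
  (forall e : R, 0 < e -> exists2 d : R, 0 < d & forall t, `|t - s| < d ->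
     `|Y t - Y s - (t - s) *: D| <= e * `|t - s|) ->
  is_derive s (1 : R) Y D.
Proof.
move=> H; suff C : (fun k : R => k^-1 *: ((Y \o shift s) (k *: 1) - Y s)) @ 0^' --> D.
  by split; [apply/cvg_ex; exists D|exact: cvg_lim C].
apply/cvgrPdist_le => e e0; have [d d0 Hd] := H e e0.
exists d => //= k /=; rewrite sub0r normrN => kd k0.
have := Hd (k + s); rewrite addrK => /(_ kd) le1.
rewrite [k *: 1]mulr1 -[X in `|X - _|]scale1r -(mulVf k0) -scalerA -scalerBr normrZ.
rewrite normfV ler_pdivrMl ?normr_gt0// mulrC distrC.
by rewrite mulrC [leRHS]mulrC.
Qed.

(** * Picard iteration for Y' = Y c on a fixed interval *)

Section LinearODE.
Context {R : realType} (n : nat) (c : R -> 'M[R]_n).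
Hypothesis cc : continuous c.
Hypothesis c_small : forall s, n%:R * `|c s| <= 4^-1.

(** Truncation to [-2, 2] makes the integrands continuous on the whole line and leaves them
    unchanged on the interval of interest. *)
Let clamp (x : R) : R := Num.max (- 2) (Num.min x 2).

Let continuous_clamp : continuous clamp.
Proof.
move=> x; apply: (@continuous_max _ _ (fun=> - 2) (fun y : R => Num.min y 2)).
  exact: cst_continuous.
apply: (@continuous_min _ _ id (fun=> 2)); first exact: cvg_id.
exact: cst_continuous.
Qed.

Let clamp_id x : `|x| <= 2 -> clamp x = x.
Proof. by rewrite ler_norml => /andP[x2 x2']; rewrite /clamp min_l// max_r. Qed.

Let clamp_le x : `|clamp x| <= 2.
Proof.
rewrite ler_norml /clamp le_max lexx/= ge_max ge_min lexx orbT andbT.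
by rewrite (@le_trans _ _ 0)// oppr_le0.
Qed.

Let picard_step_rel (Y F : R -> 'M[R]_n) := F 0 = 0 /\
  forall x : R, `|x| < 3 -> is_derive x 1 F (Y (clamp x) *m c x).

(** Chooses a primitive vanishing at 0. The default 0 is never reached along the iteration, by
    [picardS]. *)
Let picard_step (Y : R -> 'M[R]_n) : R -> 'M[R]_n :=
  if pselect (exists F, picard_step_rel Y F) is left e then projT1 (cid e) else 0.

(** The k-th term of the series of iterated integrals rather than the k-th approximation: the
    solution is the sum of all terms. *)
Let picard k : R -> 'M[R]_n := iter k picard_step (fun=> 1%:M).

Let picardS k : (forall x : R, `|x| < 3 -> derivable (picard k) x 1) ->
  picard_step_rel (picard k) (picard k.+1).
Proof.
move=> dY; rewrite /picard iterS -/(picard k) /picard_step; case: pselect => [e|].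
  exact: projT2 (cid e).
case; have cY : continuous (fun x => picard k (clamp x) *m c x).
  move=> x; apply: (@continuous_mulmx _ _ _ _ _ (fun x => picard k (clamp x)) c).
    apply: (@continuous_comp _ _ _ clamp (picard k)); first exact: continuous_clamp.
    apply: differentiable_continuous; apply/derivable1_diffP; apply: dY.
    by rewrite (le_lt_trans (clamp_le _))// ltr_nat.
  exact: cc.
by have [F F0 dF] := continuous_primitive_mx cY; exists F.
Qed.

Let picard_derivable k (x : R) : `|x| < 3 -> derivable (picard k) x 1.
Proof.
elim: k x => [|k IH] x x3; first exact: derivable_cst.
by have [_ /(_ _ x3)[]] := picardS IH.
Qed.

Let picard_derive k := picardS (@picard_derivable k).

Let mulc_le (A : 'M[R]_n) (C s : R) : `|A| <= C -> `|A *m c s| <= C / 4.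
Proof.
move=> AC; have C0 : 0 <= C := le_trans (normr_ge0 _) AC.
rewrite (le_trans (norm_mulmx_le _ _))// mulrAC mulrC.
by apply: ler_pM => //; exact: mulr_ge0.
Qed.

Let in3 (x : R) : `|x| <= 2 -> `|x| < 3.
Proof. by move=> /le_lt_trans; apply; rewrite ltr_nat. Qed.

Let between_le (a b x : R) : `|a| <= 2 -> `|b| <= 2 ->
  Num.min a b <= x <= Num.max a b -> `|x| <= 2.
Proof.
rewrite !ler_norml => /andP[a1 a2] /andP[b1 b2] /andP[x1 x2].
apply/andP; split; first by rewrite (le_trans _ x1)// le_min a1.
by rewrite (le_trans x2)// ge_max a2.
Qed.

Let between_dist (a b x : R) : Num.min a b <= x <= Num.max a b -> `|x - a| <= `|b - a|.
Proof.
rewrite ge_min le_max => /andP[/orP[l1|l1] /orP[l2|l2]].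
- by rewrite (_ : x = a) ?subrr ?normr0//; lra.
- by rewrite !ger0_norm; lra.
- by rewrite !ler0_norm; lra.
- by rewrite (_ : x = b)//; lra.
Qed.

Let zero_le2 : `|0 : R| <= 2. Proof. by rewrite normr0. Qed.

(** Each integration covers a length of at most 2 and gains the factor 1/4 from [c_small], hence the
    ratio 1/2. *)
Let picard_le k s : `|s| <= 2 -> `|picard k s| <= 2^-1 ^+ k.
Proof.
elim: k s => [|k IH] s s2.
  apply: norm_mx_le; first by rewrite expr0.
  by move=> i j; rewrite mxE expr0; case: (i == j); rewrite ?normr1 ?normr0.
have [F0 dF] := picard_derive k.
have k0 : 0 <= 2^-1 ^+ k :> R by rewrite exprn_ge0// invr_ge0.
have := @norm_mx_lipschitz R n n (picard k.+1) (fun x => picard k (clamp x) *m c x)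
  (2^-1 ^+ k / 4) 0 s.
rewrite F0 !subr0 => H; apply: le_trans (H _ _) _.
- by rewrite mulr_ge0.
- move=> x x0s; have x2 := between_le zero_le2 s2 x0s; split; first exact/dF/in3.
  by rewrite clamp_id//; apply: mulc_le; exact: IH.
rewrite exprS -mulrA mulrC -mulrA mulrCA; nra.
Qed.

Let S N s := \sum_(0 <= k < N) picard k s.

Let S_le N s : `|s| <= 2 -> `|S N s| <= 2.
Proof.
move=> s2; rewrite (le_trans (ler_norm_sum _ _ _))//.
have := @geometric_sum_le R 0 N; rewrite expr0 mulr1 add0n; apply: le_trans.
by apply: ler_sum => k _; exact: picard_le.
Qed.

Let S_derive N (x : R) : `|x| <= 2 -> is_derive x 1 (S N.+1) (S N x *m c x).
Proof.
move=> x2; have -> : S N.+1 = fun y => 1%:M + \sum_(0 <= k < N) picard k.+1 y.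
  by apply/funext => y; rewrite /S big_nat_recl.
rewrite -[X in is_derive _ _ _ X]add0r; apply: (@is_deriveD _ _ _ (fun=> 1%:M)).
rewrite /S mulmx_suml; apply: is_derive_bigsum => k.
have [_ /(_ _ (in3 x2))] := picard_derive k; rewrite clamp_id//.
Qed.

Let S_lipschitz N s t : `|s| <= 2 -> `|t| <= 2 -> `|S N t - S N s| <= 2^-1 * `|t - s|.
Proof.
move=> s2 t2; case: N => [|N].
  by rewrite /S !big_geq// subrr normr0 mulr_ge0// invr_ge0.
apply: (@norm_mx_lipschitz R n n (S N.+1) (fun x => S N x *m c x)) => [|x xst].
  by rewrite invr_ge0.
have x2 := between_le s2 t2 xst; split; first exact: S_derive.
by apply: le_trans (mulc_le _ (S_le N x2)) _; lra.
Qed.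

(** A first-order expansion of the partial sums whose error is uniform in [N], so that it passes to
    the limit directly. The 1/8 is the Lipschitz constant 1/2 of [S] times the bound 1/4 for the
    coefficient; the factor 2 bounds [S] itself. *)
Let S_step N s t (w : R) : `|s| <= 2 -> `|t| <= 2 -> 0 <= w ->
  (forall x, Num.min s t <= x <= Num.max s t -> n%:R * `|c x - c s| <= w) ->
  `|S N.+1 t - S N.+1 s - (t - s) *: (S N s *m c s)| <= (`|t - s| / 8 + 2 * w) * `|t - s|.
Proof.
move=> s2 t2 w0 cw.
set D := S N s *m c s.
have -> : S N.+1 t - S N.+1 s - (t - s) *: D = (S N.+1 t - t *: D) - (S N.+1 s - s *: D).
  by apply/matrixP => i j; rewrite !mxE; ring.
apply: (@norm_mx_lipschitz R n n (fun x => S N.+1 x - x *: D)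
  (fun x => S N x *m c x - D)) => [|x xst].
  by rewrite addr_ge0// ?mulr_ge0// divr_ge0.
have x2 := between_le s2 t2 xst; split.
  apply: (@is_deriveB _ _ _ (S N.+1) (fun x => x *: D)); first exact: S_derive.
  have d1 : derivable (@id 'M[R]_n) (0 + x *: D) D by exact: derivable_id.
  have := is_derive_line d1; rewrite derive_id.
  by under eq_fun do rewrite add0r.
have -> : S N x *m c x - D = (S N x - S N s) *m c x + S N s *m (c x - c s).
  by rewrite mulmxBl mulmxBr addrA subrK.
rewrite (le_trans (ler_normD _ _))// lerD//.
  apply: le_trans (mulc_le _ (S_lipschitz N s2 x2)) _.
  have := between_dist xst.
  lra.
rewrite (le_trans (norm_mulmx_le _ _))// mulrAC mulrC ler_pM ?mulr_ge0 ?S_le ?cw//.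
Qed.

Lemma linear_ode : exists2 Y : R -> 'M[R]_n, Y 0 = 1%:M &
  forall s : R, `|s| < 2 -> is_derive s 1 Y (Y s *m c s).
Proof.
have P s : exists A : 'M[R]_n, `|s| <= 2 -> forall N, `|A - S N s| <= 2 * 2^-1 ^+ N.
  have [s2|s2] := leP `|s| 2; last by exists 0.
  have H i j : exists a : R, forall N, `|a - \sum_(0 <= k < N) picard k s i j| <= 2 * 2^-1 ^+ N.
    apply: summable_geometric => k.
    by apply: le_trans (norm_mx_entry _ _ _) _; exact: picard_le.
  have [a Ha] := choice (fun ij : 'I_n * 'I_n => H ij.1 ij.2).
  exists (\matrix_(i, j) a (i, j)) => _ N.
  apply: norm_mx_le => [|i j]; first by rewrite mulr_ge0// exprn_ge0// invr_ge0.
  by rewrite !mxE summxE; exact: (Ha (i, j)).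
have [Y HY] := choice P; exists Y.
  apply/eqP; rewrite -subr_eq0 -normr_le0; apply: (@le0_geometric _ _ 1) => N.
  have := HY 0 zero_le2 N.+1; rewrite {1}/S big_nat_recl// big1 => [|k _].
    by rewrite addr0 exprS mulrA mulfV ?pnatr_eq0//.
  by have [] := picard_derive k.
move=> s s2; apply: is_derive_approx => e e0.
have e80 : 0 < e / (8 * (n%:R + 1)) by rewrite divr_gt0// mulr_gt0// ltr_wpDl.
have /cvgrPdist_le/(_ _ e80)[d1 /= d10 Hd] := @cc s.
(* The three bounds control the oscillation of [c], make |t - s| / 8 at most e / 8, and keep t in
   [-2, 2]. *)
pose d := Num.min d1 (Num.min e (2 - `|s|)).
have d0 : 0 < d by rewrite !lt_min d10 e0 subr_gt0.
exists d => // t; rewrite !lt_min => /and3P[td1 te ts2].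
have sl2 := ltW s2.
have tl2 : `|t| <= 2.
  by rewrite -(subrK s t) (le_trans (ler_normD _ _))// -lerBrDr ltW.
have cw x : Num.min s t <= x <= Num.max s t -> n%:R * `|c x - c s| <= e / 8.
  move=> xst; rewrite distrC (@le_trans _ _ (n%:R * (e / (8 * (n%:R + 1)))))//.
    rewrite ler_wpM2l// Hd//= distrC; apply: le_lt_trans td1.
    exact: between_dist.
  have n1 : 0 < n%:R + 1 :> R by rewrite ltr_wpDl.
  by rewrite mulrA ler_pdivrMr ?mulr_gt0//; lra.
have e8 : 0 <= e / 8 by rewrite divr_ge0// ltW.
have ts4 : `|t - s| <= 4.
  by rewrite (le_trans (ler_normB _ _))// (le_trans (lerD tl2 sl2))// -natrD.
rewrite -subr_le0; apply: (@le0_geometric _ _ 4) => N; rewrite lerBlDl.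
have YtS := HY t tl2 N.+1; have YsS := HY s sl2 N.+1; have YS := HY s sl2 N.
(* The expansion of the limit is that of a partial sum plus a remainder of size O(2^-N), which
   disappears as N grows. *)
have -> : Y t - Y s - (t - s) *: (Y s *m c s) =
  (S N.+1 t - S N.+1 s - (t - s) *: (S N s *m c s))
  + ((Y t - S N.+1 t) - (Y s - S N.+1 s) - (t - s) *: ((Y s - S N s) *m c s)).
  by rewrite mulmxBl; apply/matrixP => i j; rewrite !mxE; ring.
rewrite (le_trans (ler_normD _ _))// lerD//.
  apply: le_trans (S_step N sl2 tl2 e8 cw) _; rewrite ler_wpM2r//.
  by lra.
rewrite (le_trans (ler_normB _ _))// normrZ.
have B1 := le_trans (ler_normB _ _) (lerD YtS YsS); have B2 := mulc_le s YS.
have k0 : 0 <= 2^-1 ^+ N :> R by rewrite exprn_ge0// invr_ge0.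
have B3 : `|t - s| * `|(Y s - S N s) *m c s| <= 4 * (2 * 2^-1 ^+ N / 4).
  by rewrite ler_pM.
by apply: le_trans (lerD B1 B3) _; rewrite exprS; lra.
Qed.

End LinearODE.

(** * Total differential equations and local inverses *)

Section LocalBounds.
Context {R : realType} {m : nat}.
Local Notation V := 'rV[R]_m.
Implicit Types (f : V -> R) (p q w : V) (r C : R).

Lemma derive_sum_partial f p w : differentiable f p ->
  'D_w f p = \sum_(i < m) w 0 i * 'D_(delta_mx 0 i) f p.
Proof.
move=> df; rewrite {1}(row_sum_delta w) deriveE// linear_sum.
by apply: eq_bigr => i _; rewrite linearZ/= -deriveE.
Qed.

Lemma derive_le f p w C : differentiable f p ->
  (forall i, `|'D_(delta_mx 0 i) f p| <= C) -> `|'D_w f p| <= m%:R * C * `|w|.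
Proof.
move=> df fC; rewrite derive_sum_partial// (le_trans (ler_norm_sum _ _ _))//.
rewrite -mulrA mulr_natl -[X in _ *+ X](card_ord m) -sumr_const.
by apply: ler_sum => i _; rewrite normrM mulrC ler_pM ?norm_mx_entry.
Qed.

Lemma segment_ball (p0 : V) p w r (s : R) : `|p - p0| < r -> `|p + w - p0| < r ->
  0 <= s <= 1 -> `|p + s *: w - p0| < r.
Proof.
move=> pr pwr /andP[s0 s1].
have -> : p + s *: w - p0 = (1 - s) *: (p - p0) + s *: (p + w - p0).
  by apply/rowP => i; rewrite !mxE; ring.
rewrite (le_lt_trans (ler_normD _ _))// !normrZ !ger0_norm ?subr_ge0//.
have [->|sn0] := eqVneq s 0; first by rewrite subr0 mul1r mul0r addr0.
have s0' : 0 < s by rewrite lt_neqAle eq_sym sn0.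
have : s * `|p + w - p0| < s * r by rewrite ltr_pM2l.
have : (1 - s) * `|p - p0| <= (1 - s) * r by rewrite ler_wpM2l ?subr_ge0// ltW.
lra.
Qed.

Lemma lipschitz_ball f (p0 : V) r C p w :
  (forall q, `|q - p0| < r -> differentiable f q /\
     forall i, `|'D_(delta_mx 0 i) f q| <= C) ->
  `|p - p0| < r -> `|p + w - p0| < r -> `|f (p + w) - f p| <= m%:R * C * `|w|.
Proof.
move=> H pr pwr; apply: lipschitz_line => s s01;
  have [df fC] := H _ (segment_ball pr pwr s01) => //.
exact: derive_le.
Qed.

(** One constant serves for the function, its increments and its second-order remainder, so that
    finite families are handled by taking maxima of constants. *)
Definition taylor_bound f (p0 : V) r C := forall p w, `|p - p0| < r -> `|p + w - p0| < r ->
  [/\ `|f p| <= C, `|f (p + w) - f p| <= C * `|w| &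
      `|f (p + w) - f p - 'D_w f p| <= C * `|w| ^+ 2].

Lemma locally_bounded f (p0 : V) : differentiable f p0 ->
  exists C, \forall p \near p0, `|f p| <= C.
Proof.
move=> /differentiable_continuous /cvgrPdist_le/(_ 1 ltr01) H.
exists (`|f p0| + 1); apply: filterS H => p.
by rewrite distrC -lerBlDl; apply: le_trans; exact: lerB_dist.
Qed.

(** The sum of the absolute values dominates each individual constant, and monotonicity carries
    every bound over to it. *)
Lemma near_forall_finite (I : finType) (P : I -> R -> V -> Prop) (p0 : V) :
  (forall i C C' p, C <= C' -> P i C p -> P i C' p) ->
  (forall i, exists C, \forall p \near p0, P i C p) ->
  exists2 C, 0 <= C & \forall p \near p0, forall i, P i C p.
Proof.
move=> mono H; have [C HC] := choice H.
exists (\sum_i `|C i|); first exact: sumr_ge0.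
pose Q i p := P i (\sum_i `|C i|) p.
suff : \forall p \near p0, forall i, Q i p by [].
apply: (@filter_forall _ _ Q _ (nbhs_filter p0)) => i.
apply: filterS (HC i) => p; apply: mono.
rewrite (le_trans (ler_norm _))// (bigD1 i)//= lerDl; exact: sumr_ge0.
Qed.

Lemma smooth_taylor_bound (M : set V) f (p0 : V) : open M -> M p0 -> smooth_on M f ->
  exists2 r, 0 < r & exists2 C, 0 <= C & taylor_bound f p0 r C.
Proof.
move=> oM Mp0 sf.
pose e (i : 'I_m) : V := delta_mx 0 i.
have sD i : smooth_on M ('D_(e i) f) by exact: smooth_derive.
have sDD i j : smooth_on M ('D_(e j) ('D_(e i) f)) by exact: smooth_derive.
have [C0 H0] := locally_bounded (smooth_differentiable sf Mp0).
have [C1 C10 H1] : exists2 C, 0 <= C & \forall p \near p0, forall i, `|'D_(e i) f p| <= C.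
  apply: near_forall_finite => [i C C' p CC' /le_trans|i]; first exact.
  exact: locally_bounded (smooth_differentiable (sD i) Mp0).
have [C2 C20 H2] : exists2 C, 0 <= C & \forall p \near p0,
    forall ij : 'I_m * 'I_m, `|'D_(e ij.2) ('D_(e ij.1) f) p| <= C.
  apply: near_forall_finite => [i C C' p CC' /le_trans|i]; first exact.
  exact: locally_bounded (smooth_differentiable (sDD i.1 i.2) Mp0).
have HM : \forall p \near p0, M p by exact: open_nbhs_nbhs.
have : \forall q \near p0, (`|f q| <= C0 /\ forall i, `|'D_(e i) f q| <= C1) /\
    ((forall ij : 'I_m * 'I_m, `|'D_(e ij.2) ('D_(e ij.1) f) q| <= C2) /\ M q).
  exact: filterI (filterI H0 H1) (filterI H2 HM).
move=> /nbhs_normP[r /= r0 Hr'].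
have Hr q : `|q - p0| < r -> (`|f q| <= C0 /\ forall i, `|'D_(e i) f q| <= C1) /\
    ((forall ij : 'I_m * 'I_m, `|'D_(e ij.2) ('D_(e ij.1) f) q| <= C2) /\ M q).
  by rewrite distrC => /Hr'.
exists r => //; pose K := `|C0| + m%:R * C1 + m%:R * (m%:R * C2).
have m0 : 0 <= m%:R :> R by [].
have mC1 : 0 <= m%:R * C1 by rewrite mulr_ge0.
have mC2 : 0 <= m%:R * (m%:R * C2) by rewrite !mulr_ge0.
have K0 : 0 <= K by rewrite !addr_ge0.
exists K => // p w pr pwr; have [[f0 _] [_ Mp]] := Hr _ pr; split.
- rewrite (le_trans f0)// (le_trans (ler_norm _))// /K -addrA lerDl addr_ge0//.
- apply: (@le_trans _ _ (m%:R * C1 * `|w|)).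
    apply: (lipschitz_ball _ pr pwr) => q /Hr[[_ f1] [_ Mq]]; split=> //.
    exact: smooth_differentiable Mq.
  by rewrite ler_wpM2r// /K -addrAC lerDr addr_ge0.
have df (s : R) : 0 <= s <= 1 -> differentiable f (p + s *: w).
  by move=> s01; have [_ [_ Mq]] := Hr _ (segment_ball pr pwr s01); exact: smooth_differentiable Mq.
(* The remainder becomes the increment of the first derivative between p and p + s w, which is
   bounded by the second derivatives. *)
have [s s01 ->] := mean_value_line df.
have dfp := smooth_differentiable sf Mp.
rewrite (derive_sum_partial w (df _ s01)) (derive_sum_partial w dfp) -sumrB.
apply: (@le_trans _ _ (m%:R * (m%:R * C2) * `|w| ^+ 2)); last first.
  by rewrite ler_wpM2r ?exprn_ge0// /K lerDr addr_ge0.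
rewrite (le_trans (ler_norm_sum _ _ _))//.
rewrite -!mulrA mulr_natl -[X in _ *+ X](card_ord m) -sumr_const.
apply: ler_sum => i _; rewrite -mulrBr normrM expr2.
rewrite [leRHS](_ : _ = `|w| * (m%:R * C2 * `|w|)); last by ring.
rewrite ler_pM ?norm_mx_entry//.
have swr := segment_ball pr pwr s01.
have le1 : `|'D_(e i) f (p + s *: w) - 'D_(e i) f p| <= m%:R * C2 * `|s *: w|.
  apply: (@lipschitz_ball ('D_(e i) f) p0 r C2 p (s *: w) _ pr swr) => q /Hr[_ [f2 Mq]]; split.
    exact: smooth_differentiable (sD i) Mq.
  by move=> j; exact: (f2 (i, j)).
apply: le_trans le1 _; rewrite ler_wpM2l ?mulr_ge0// normrZ.
by have /andP[s0 s1] := s01; rewrite ger0_norm// ler_piMl.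
Qed.

Lemma uniform_taylor_bound (I : finType) (F : I -> V -> R) (M : set V) (p0 : V) : open M -> M p0 ->
  (forall i, smooth_on M (F i)) ->
  exists2 r, 0 < r & exists2 C, 0 <= C & forall i, taylor_bound (F i) p0 r C.
Proof.
move=> oM Mp0 sF.
suff [r r0 [C C0 H]] : exists2 r, 0 < r & exists2 C, 0 <= C &
    forall i, i \in enum I -> taylor_bound (F i) p0 r C.
  by exists r => //; exists C => // i; apply: H; rewrite mem_enum.
elim: (enum I) => [|i s [r r0 [C C0 IH]]]; first by exists 1 => //; exists 0.
have [r' r'0 [C' C'0 H]] := smooth_taylor_bound oM Mp0 (sF i).
exists (Num.min r r'); first by rewrite lt_min r0.
exists (Num.max C C'); first by rewrite le_max C0.
move=> j; rewrite inE => /orP[/eqP->|js] p w; rewrite !lt_min => /andP[p1 p2] /andP[w1 w2].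
  have [a1 a2 a3] := H p w p2 w2.
  split; [apply: le_trans a1 _|apply: le_trans a2 _|apply: le_trans a3 _];
    by rewrite ?ler_wpM2r ?exprn_ge0// le_max lexx orbT.
have [a1 a2 a3] := IH j js p w p1 w1.
split; [apply: le_trans a1 _|apply: le_trans a2 _|apply: le_trans a3 _];
  by rewrite ?ler_wpM2r ?exprn_ge0// le_max lexx.
Qed.

End LocalBounds.

Section SmallGronwall.
Context {R : realType} {m n : nat}.

(* With the constant 1/2 < 1 on [0, 1], Gronwall's inequality is just the mean
   value inequality at a point where the norm is maximal. *)
Lemma small_gronwall (X dX : R -> 'M[R]_(m, n)) (e : R) : X 0 = 0 ->
  (forall s : R, 0 <= s <= 1 -> is_derive s 1 X (dX s) /\ `|dX s| <= 2^-1 * `|X s| + e) ->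
  forall s : R, 0 <= s <= 1 -> `|X s| <= 2 * e.
Proof.
move=> X0 H.
have cX : {within `[0, 1], continuous (fun s => `|X s| : R)}.
  apply: continuous_in_subspaceT => s /set_mem /=; rewrite in_itv/= => s01.
  have [[dXs _] _] := H s s01.
  have cXs : {for s, continuous X}.
    by apply: differentiable_continuous; exact/derivable1_diffP.
  exact: (continuous_comp cXs (@norm_continuous _ _ (X s))).
have [t + tmax] := EVT_max ler01 cX; rewrite in_itv/= => t01.
have [t0 t1] : 0 <= t /\ t <= 1 by move: t01 => /andP.
have [_ le0t] := H t t01.
have K0 : 0 <= 2^-1 * `|X t| + e by exact: le_trans le0t.
have := @norm_mx_lipschitz R m n X dX (2^-1 * `|X t| + e) 0 t K0.
rewrite X0 !subr0 ger0_norm// => /(_ _) K.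
have {}K : `|X t| <= (2^-1 * `|X t| + e) * t.
  apply: K => x; rewrite min_l// max_r// => /andP[x0 xt].
  have x01 : 0 <= x <= 1 by rewrite x0 (le_trans xt).
  have [dx le] := H x x01; split=> //; apply: le_trans le _.
  by rewrite lerD2r ler_pM2l ?invr_gt0// tmax// in_itv.
have {}K : `|X t| <= 2^-1 * `|X t| + e by rewrite (le_trans K)// ler_piMr.
move=> s s01; have : `|X s| <= `|X t| by apply: tmax; rewrite in_itv.
lra.
Qed.

End SmallGronwall.

Lemma is_derive_scale {R : realType} m n (A : R -> 'M[R]_(m, n)) (s : R) dA :
  is_derive s 1 A dA -> is_derive s 1 (fun s => s *: A s) (A s + s *: dA).
Proof.
move=> [dAs vA]; apply: is_derive_mx => i j; under eq_fun do rewrite mxE.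
have Aij : is_derive s 1 (fun s => A s i j) (dA i j).
  split; first by have /derivable_mxP := dAs; exact.
  by rewrite -vA derive_entry.
apply: (is_derive_eq (is_derive_mul (is_derive_id s 1) Aij)).
by rewrite mul1r !mxE.
Qed.

(** * Completely integrable linear systems dY = Y B *)

Section TotalDifferentialEquation.
Context {R : realType} {m n : nat}.
Local Notation V := 'rV[R]_m.
Variables (M : set V) (B : V -> V -> 'M[R]_n) (p0 : V).
Hypothesis oM : open M.
Hypothesis Mp0 : M p0.
Hypothesis linB : forall p (a : R) u v, B p (a *: u + v) = a *: B p u + B p v.
Hypothesis smB : forall u i j, smooth_on M (fun p => B p u i j).
Hypothesis flatB : forall p u v, M p ->
  'D_u (B ^~ v) p + B p u *m B p v = 'D_v (B ^~ u) p + B p v *m B p u.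
Implicit Types (u v w d : V).

Let B0 p : B p 0 = 0.
Proof.
have := linB p 1 0 0; rewrite !scale1r addr0 => /eqP.
by rewrite -subr_eq subrr => /eqP.
Qed.

Let BD p u v : B p (u + v) = B p u + B p v.
Proof. by have := linB p 1 u v; rewrite !scale1r. Qed.

Let BZ p a u : B p (a *: u) = a *: B p u.
Proof. by have := linB p a u 0; rewrite B0 !addr0. Qed.

Let Bsum p u i j : B p u i j = \sum_(k < m) u 0 k * B p (delta_mx 0 k) i j.
Proof.
rewrite {1}(row_sum_delta u).
suff -> : forall s : seq 'I_m, B p (\sum_(k <- s) u 0 k *: delta_mx 0 k) =
    \sum_(k <- s) u 0 k *: B p (delta_mx 0 k).
  by rewrite summxE; apply: eq_bigr => k _; rewrite mxE.
elim=> [|k s IH]; first by rewrite !big_nil B0.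
by rewrite !big_cons BD BZ IH.
Qed.

Let dB p u : M p -> differentiable (B ^~ u) p.
Proof.
by move=> Mp; apply: differentiable_mx => i j; exact: smooth_differentiable (smB u i j) Mp.
Qed.

(** Estimates uniform in the base point and homogeneous in the direction [v]. They persist when [r]
    shrinks, which is how the smallness conditions on [r] are reached later. *)
Definition ball_bound (r C : R) := [/\ 0 < r, 0 <= C,
  forall p, `|p - p0| < r -> M p,
  forall p v, `|p - p0| < r -> `|B p v| <= C * `|v| &
  forall p w v, `|p - p0| < r -> `|p + w - p0| < r ->
    `|B (p + w) v - B p v| <= C * `|w| * `|v| /\
    `|B (p + w) v - B p v - 'D_w (B ^~ v) p| <= C * `|w| ^+ 2 * `|v|].

Lemma exists_ball_bound : exists r C, ball_bound r C.
Proof.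
pose F (x : 'I_m * 'I_n * 'I_n) p := B p (delta_mx 0 x.1.1) x.1.2 x.2.
have [r r0 [C C0 HC]] := uniform_taylor_bound (F := F) oM Mp0
  (fun x => smB (delta_mx 0 x.1.1) x.1.2 x.2).
have /nbhs_normP[r' /= r'0 Hr'] := open_nbhs_nbhs (conj oM Mp0).
have rM p : `|p - p0| < Num.min r r' -> M p.
  by rewrite lt_min => /andP[_ pr]; apply: Hr'; rewrite /= distrC.
have K0 : 0 <= m%:R * C by rewrite mulr_ge0.
have sum_le (a b : 'I_m -> R) (D e : R) : 0 <= D -> (forall k, `|a k| <= D) ->
    (forall k, `|b k| <= e) -> `|\sum_k b k * a k| <= m%:R * D * e.
  move=> D0 aD be; rewrite (le_trans (ler_norm_sum _ _ _))//.
  rewrite -mulrA mulr_natl -[X in _ *+ X](card_ord m) -sumr_const.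
  by apply: ler_sum => k _; rewrite normrM mulrC ler_pM.
exists (Num.min r r'), (m%:R * C); split=> //; first by rewrite lt_min r0.
  move=> p v; rewrite lt_min => /andP[pr _].
  apply: norm_mx_le => [|i j]; first by rewrite mulr_ge0.
  rewrite Bsum; apply: sum_le => // k; last exact: norm_mx_entry.
  by have [] := HC (k, i, j) p 0 pr; rewrite ?addr0.
move=> p w v pr0 pwr0; have Mp := rM _ pr0.
move: pr0 pwr0; rewrite !lt_min => /andP[pr _] /andP[pwr _]; split.
  apply: norm_mx_le => [|i j]; first by rewrite !mulr_ge0.
  rewrite !mxE !Bsum -sumrB; under eq_bigr do rewrite -mulrBr.
  rewrite -[m%:R * C * _]mulrA; apply: sum_le => [|k|k]; last exact: norm_mx_entry.
    by rewrite mulr_ge0.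
  by have [] := HC (k, i, j) p w pr pwr.
apply: norm_mx_le => [|i j]; first by rewrite !mulr_ge0 ?exprn_ge0.
have DB : 'D_w (B ^~ v) p i j = \sum_k v 0 k * 'D_w (F (k, i, j)) p.
  have dBp : derivable (B ^~ v) p w by exact/diff_derivable/dB.
  apply: etrans (derive_entry i j dBp) _.
  under eq_fun do rewrite Bsum.
  have D k : is_derive p w (fun q => v 0 k * B q (delta_mx 0 k) i j)
      (v 0 k * 'D_w (F (k, i, j)) p).
    have dF : is_derive p w (F (k, i, j)) ('D_w (F (k, i, j)) p).
      split=> //; apply: diff_derivable.
      exact: smooth_differentiable (smB _ _ _) Mp.
    by apply: (is_derive_eq (is_derive_mul (is_derive_cst (v 0 k) p w) dF)); rewrite mul0r add0r.
  by have [] := is_derive_bigsum (index_enum _) D.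
rewrite !mxE DB !Bsum -!sumrB.
under eq_bigr do rewrite -!mulrBr.
rewrite -[m%:R * C * _]mulrA; apply: sum_le => [|k|k]; last exact: norm_mx_entry.
  by rewrite mulr_ge0 ?exprn_ge0.
by have [] := HC (k, i, j) p w pr pwr.
Qed.

Let unit_clamp (x : R) : R := Num.max 0 (Num.min x 1).

Let continuous_unit_clamp : continuous unit_clamp.
Proof.
move=> x; apply: (@continuous_max _ _ (fun=> 0) (fun y : R => Num.min y 1)).
  exact: cst_continuous.
apply: (@continuous_min _ _ id (fun=> 1)); first exact: cvg_id.
exact: cst_continuous.
Qed.

Let unit_clamp_id x : 0 <= x <= 1 -> unit_clamp x = x.
Proof. by move=> /andP[x0 x1]; rewrite /unit_clamp min_l// max_r. Qed.

Let unit_clamp01 x : 0 <= unit_clamp x <= 1.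
Proof. by rewrite /unit_clamp le_max lexx/= ge_max ler01/= ge_min lexx orbT. Qed.

Variables (r C : R).
Hypothesis rC : ball_bound r C.
Hypothesis r_small : r <= 1 /\ (n%:R + 1) * C * r <= 4^-1.

Let r0 : 0 < r. Proof. by case: rC. Qed.
Let C0 : 0 <= C. Proof. by case: rC. Qed.
Let n0 : 0 <= n%:R :> R. Proof. by []. Qed.

Let ray d (s : R) : `|d| < r -> 0 <= s <= 1 -> `|p0 + s *: d - p0| < r.
Proof.
move=> dr s01; apply: segment_ball s01; first by rewrite subrr normr0.
by rewrite addrAC subrr add0r.
Qed.

Let B_le d (s : R) v : `|d| < r -> 0 <= s <= 1 -> `|B (p0 + s *: d) v| <= C * `|v|.
Proof. by case: rC => _ _ _ H _ dr s01; apply: H; exact: ray. Qed.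

(** The factor n + 1 in [r_small] covers both bounds: the first feeds [linear_ode], the second is
    the source term when [Z] is compared with the identity. *)
Let B_small d (s : R) : `|d| < r -> 0 <= s <= 1 ->
  n%:R * `|B (p0 + s *: d) d| <= 4^-1 /\ `|B (p0 + s *: d) d| <= 4^-1.
Proof.
move=> dr s01; have Bd := B_le d dr s01.
have Cdr : C * `|d| <= C * r by rewrite ler_wpM2l// ltW.
have [_ sm] := r_small; have Cr : 0 <= C * r by rewrite mulr_ge0// ltW.
have bCr := le_trans Bd Cdr.
have nCr : 0 <= n%:R * (C * r) by exact: mulr_ge0.
have nb : n%:R * `|B (p0 + s *: d) d| <= n%:R * (C * r) by exact: ler_wpM2l.
by split; lra.
Qed.

(** [B] is controlled on the ball only; clamping the ray parameter to [0, 1] gives a coefficient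
    that is continuous and small on the whole line, as [linear_ode] asks. Outside the ball [Z] is a
    default. *)
Let radial_ode d : exists Z : R -> 'M[R]_n, `|d| < r -> Z 0 = 1%:M /\
  forall s : R, 0 <= s <= 1 -> is_derive s 1 Z (Z s *m B (p0 + s *: d) d).
Proof.
have [dr|dr] := ltP `|d| r; last by exists 0.
pose c s := B (p0 + unit_clamp s *: d) d.
have cc : continuous c.
  move=> s; have : {for p0 + unit_clamp s *: d, continuous (B ^~ d)}.
    apply: differentiable_continuous; apply: dB.
    by case: rC => _ _ H _ _; apply: H; exact: ray.
  apply: (@continuous_comp _ _ _ (fun s => p0 + unit_clamp s *: d)).
  apply: (@cvgD _ _ _ _ _ (fun=> p0)); first exact: cvg_cst.
  by apply: cvgZr_tmp; exact: continuous_unit_clamp.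
have cs s : n%:R * `|c s| <= 4^-1 by have [] := B_small dr (unit_clamp01 s).
have [Z Z0 dZ] := linear_ode cc cs; exists Z => _; split=> // s s01.
have /dZ : `|s| < 2.
  by move: s01 => /andP[s0 s1]; rewrite ger0_norm// (le_lt_trans s1)// ltr1n.
by rewrite /c unit_clamp_id.
Qed.

(** The solution is Y p = [Z (p - p0) 1], the end value along the ray from p0 to p. The derivative
    of [Z d s] in direction [v] is expected to be s (Z d s) B(p0 + s d) v, and at s = 1 this is the
    asserted equation. *)
Lemma total_differential_solution : exists2 Y : V -> 'M[R]_n, Y p0 = 1%:M &
  forall p, `|p - p0| < r ->
    differentiable Y p /\ forall v, 'D_v Y p = Y p *m B p v.
Proof.
have [Z HZ] := choice radial_ode.
have norm1 : `|1%:M : 'M[R]_n| <= 1.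
  by apply: norm_mx_le => // i j; rewrite mxE; case: (i == j); rewrite ?normr1 ?normr0.
have mul_small (A D : 'M[R]_n) : n%:R * `|D| <= 4^-1 -> `|A *m D| <= 4^-1 * `|A|.
  move=> Ds; rewrite (le_trans (norm_mulmx_le _ _))// mulrAC ler_wpM2r//.
have Z_le d s : `|d| < r -> 0 <= s <= 1 -> `|Z d s| <= 2.
  move=> dr s01; have [Z0 dZ] := HZ d dr.
  have X0 : Z d 0 - 1%:M = 0 by rewrite Z0 subrr.
  have := @small_gronwall R n n (fun s => Z d s - 1%:M)
    (fun s => Z d s *m B (p0 + s *: d) d) 4^-1 X0.
  move=> G; rewrite -(subrK 1%:M (Z d s)) (le_trans (ler_normD _ _))//.
  apply: le_trans (lerD (G _ s s01) norm1) _; last by lra.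
  move=> x x01; have [s1 s2] := B_small dr x01; split.
    have := @is_deriveB _ _ _ (Z d) (fun=> 1%:M) x 1 _ 0 (dZ x x01) (is_derive_cst _ _ _).
    by rewrite subr0.
  rewrite -{1}(subrK 1%:M (Z d x)) mulmxDl mul1mx (le_trans (ler_normD _ _))//.
  rewrite lerD// (le_trans (mul_small _ _ s1))//.
  by have := normr_ge0 (Z d x - 1%:M); lra.
have Z_derive d (x : R) : `|d| < r -> 0 <= x <= 1 ->
    is_derive x 1 (Z d) (Z d x *m B (p0 + x *: d) d).
  by move=> dr; have [_] := HZ d dr; exact.
have Z0 d : `|d| < r -> Z d 0 = 1%:M by move=> dr; have [] := HZ d dr.
have [_ _ rM _ B2] := rC; have [r1 _] := r_small.
have ray2 d v (s : R) : `|d| < r -> `|d + v| < r -> 0 <= s <= 1 ->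
    `|p0 + s *: d + s *: v - p0| < r.
  by move=> dr dvr s01; rewrite -[p0 + _ + _]addrA -scalerDr; exact: ray.
have coef_le d v (s : R) : `|d| < r -> `|d + v| < r -> 0 <= s <= 1 ->
    `|B (p0 + s *: (d + v)) (d + v) - B (p0 + s *: d) d| <= 2 * C * `|v|.
  move=> dr dvr s01; have Bv := B_le v dvr s01.
  have [H _] := B2 _ (s *: v) d (ray dr s01) (ray2 d v s dr dvr s01).
  rewrite BD -addrA addrC -addrA (le_trans (ler_normD _ _))//.
  rewrite [2 * C]mulr_natl mulr2n mulrDl lerD//.
  rewrite [- _ + _]addrC scalerDr addrA (le_trans H)//.
  have /andP[s0 s1] := s01.
  rewrite normrZ ger0_norm// -!mulrA ler_wpM2l// mulrCA ler_piMr// ?mulr_ge0//.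
  by rewrite mulr_ile1// (le_trans (ltW dr)).
have Z_lip d v (s : R) : `|d| < r -> `|d + v| < r -> 0 <= s <= 1 ->
    `|Z (d + v) s - Z d s| <= 8 * n%:R * C * `|v|.
  move=> dr dvr s01.
  have X0 : Z (d + v) 0 - Z d 0 = 0 by rewrite !Z0// subrr.
  have := @small_gronwall R n n (fun s => Z (d + v) s - Z d s)
    (fun s => Z (d + v) s *m B (p0 + s *: (d + v)) (d + v) - Z d s *m B (p0 + s *: d) d)
    (4 * n%:R * C * `|v|) X0.
  move=> G; apply: le_trans (G _ s s01) _; last by lra.
  move=> x x01; split.
    by apply: (@is_deriveB _ _ _ (Z (d + v)) (Z d)); exact: Z_derive.
  have -> : Z (d + v) x *m B (p0 + x *: (d + v)) (d + v) - Z d x *m B (p0 + x *: d) d =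
    (Z (d + v) x - Z d x) *m B (p0 + x *: d) d + Z (d + v) x
      *m (B (p0 + x *: (d + v)) (d + v) - B (p0 + x *: d) d).
    by rewrite mulmxBl mulmxBr [RHS]addrC addrA subrK.
  rewrite (le_trans (ler_normD _ _))// lerD//.
    have [s1 _] := B_small dr x01; rewrite (le_trans (mul_small _ _ s1))//.
    by have := normr_ge0 (Z (d + v) x - Z d x); lra.
  rewrite (le_trans (norm_mulmx_le _ _))//.
  have := coef_le d v x dr dvr x01; have := Z_le (d + v) x dvr x01.
  set a := `|Z _ _|; set b := `|_ - _| => a2 bC.
  have a0 : 0 <= a by exact: normr_ge0. have b0 : 0 <= b by exact: normr_ge0.
  rewrite (_ : 4 * _ * _ * _ = n%:R * 2 * (2 * C * `|v|)); last by ring.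
  by rewrite ler_pM ?mulr_ge0// ler_wpM2l.
(* Twice a bound for the source term, by [small_gronwall]. The first product estimates the change of
   [Z] times the change of the coefficient, the second [Z] times the second-order error of the
   coefficient. *)
pose K := 2 * (n%:R * (8 * n%:R * C) * (2 * C) + n%:R * 2 * (2 * C)).
have Z_taylor d v : `|d| < r -> `|d + v| < r ->
    `|Z (d + v) 1 - Z d 1 - Z d 1 *m B (p0 + d) v| <= K * `|v| ^+ 2.
  move=> dr dvr.
  (* The error of the expected first-order expansion at time s; it vanishes at s = 0. *)
  pose X s := Z (d + v) s - Z d s - s *: (Z d s *m B (p0 + s *: d) v).
  have X0 : X 0 = 0 by rewrite /X !Z0// subrr scale0r subr0.
  pose D s := 'D_d (B ^~ v) (p0 + s *: d).
  pose dX s := Z (d + v) s *m B (p0 + s *: (d + v)) (d + v) - Z d s *m B (p0 + s *: d) d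
    - (Z d s *m B (p0 + s *: d) v
       + s *: (Z d s *m B (p0 + s *: d) d *m B (p0 + s *: d) v + Z d s *m D s)).
  have := @small_gronwall R n n X dX (K / 2 * `|v| ^+ 2) X0.
  move=> G; have {G} : `|X 1| <= 2 * (K / 2 * `|v| ^+ 2).
    apply: G => [s s01|]; last by rewrite ler01 lexx.
    have dBv : derivable (B ^~ v) (p0 + s *: d) d.
      by apply/diff_derivable/dB/rM/ray.
    have [dZ vZ] := Z_derive d s dr s01; have [dL vL] := is_derive_line dBv.
    split.
      apply: (@is_deriveB _ _ _ (fun s => Z (d + v) s - Z d s)).
        by apply: (@is_deriveB _ _ _ (Z (d + v)) (Z d)); exact: Z_derive.
      apply: is_derive_scale; apply: (is_derive_eq (derivable_mulmx dZ dL)).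
      by rewrite vZ vL.
    pose c' := B (p0 + s *: (d + v)) (d + v); pose c := B (p0 + s *: d) d.
    pose Bv := B (p0 + s *: d) v; pose Dv := 'D_v (B ^~ d) (p0 + s *: d).
    (* Flatness trades the derivative of B(., v) along [d] for that of B(., d) along [v]. What
       remains is linear in [X] plus a source quadratic in [v]. *)
    have -> : dX s = X s *m c + ((Z (d + v) s - Z d s) *m (c' - c)
        + Z d s *m (c' - c - Bv - s *: Dv)).
      have fl : D s + c *m Bv = Dv + Bv *m c by apply: flatB; apply: rM; exact: ray.
      rewrite /dX /X -/c -/c' -/Bv -mulmxA -mulmxDr [c *m Bv + _]addrC fl.
      rewrite !(mulmxBl, mulmxBr, mulmxDr) -!(scalemxAl, scalemxAr) -!mulmxA.
      move: (Z (d + v) s *m c') (Z (d + v) s *m c) (Z d s *m c') (Z d s *m c)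
        (Z d s *m Bv) (Z d s *m Dv) (Z d s *m (Bv *m c)) => a1 a2 a3 a4 a5 a6 a7.
      by apply/matrixP => i j; rewrite !mxE; ring.
    have [cs _] := B_small dr s01.
    rewrite (le_trans (ler_normD _ _))// lerD//.
      by rewrite (le_trans (mul_small _ _ cs))//; have := normr_ge0 (X s); lra.
    have bra : `|c' - c - Bv - s *: Dv| <= 2 * C * `|v| ^+ 2.
      have /andP[s0 s1] := s01.
      have [_ H1] := B2 _ (s *: v) d (ray dr s01) (ray2 d v s dr dvr s01).
      have [H2 _] := B2 _ (s *: v) v (ray dr s01) (ray2 d v s dr dvr s01).
      have dBd : differentiable (B ^~ d) (p0 + s *: d) by apply/dB/rM/ray.
      rewrite (deriveZ_dir v s dBd) -/Dv in H1.
      have -> : c' - c - Bv - s *: Dv =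
          (B (p0 + s *: d + s *: v) d - c - s *: Dv) + (B (p0 + s *: d + s *: v) v - Bv).
        rewrite /c' -[p0 + _ + _]addrA -scalerDr BD.
        by apply/matrixP => i j; rewrite !mxE; ring.
      have svv : `|s *: v| <= `|v| by rewrite normrZ ger0_norm// ler_piMl.
      have d1 : `|d| <= 1 by rewrite (le_trans (ltW dr)).
      have v2 : `|s *: v| ^+ 2 <= `|v| ^+ 2 by rewrite lerXn2r ?nnegrE.
      have e1 : C * `|s *: v| ^+ 2 * `|d| <= C * `|v| ^+ 2.
        rewrite -mulrA ler_wpM2l// (@le_trans _ _ (`|s *: v| ^+ 2))//.
        by rewrite ler_piMr// exprn_ge0.
      have e2 : C * `|s *: v| * `|v| <= C * `|v| ^+ 2.
        by rewrite -mulrA ler_wpM2l// expr2 ler_wpM2r.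
      apply: le_trans (ler_normD _ _) _.
      by apply: le_trans (lerD (le_trans H1 e1) (le_trans H2 e2)) _; lra.
    have cc := coef_le d v s dr dvr s01; have zl := Z_lip d v s dr dvr s01.
    have z2 := Z_le d s dr s01.
    have -> : K / 2 * `|v| ^+ 2 = n%:R * (8 * n%:R * C * `|v|) * (2 * C * `|v|)
        + n%:R * 2 * (2 * C * `|v| ^+ 2) by rewrite /K; field.
    rewrite (le_trans (ler_normD _ _))// lerD//.
      rewrite (le_trans (norm_mulmx_le _ _))// ler_pM ?mulr_ge0//.
      by rewrite ler_wpM2l.
    rewrite (le_trans (norm_mulmx_le _ _))// ler_pM ?mulr_ge0//.
    by rewrite ler_wpM2l.
  rewrite /X !scale1r => /le_trans; apply; rewrite le_eqVlt; apply/orP; left.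
  by apply/eqP; field.
have K0 : 0 <= K by rewrite /K !(mulr_ge0, addr_ge0).
exists (fun p => Z (p - p0) 1).
  (* Along the zero ray the coefficient is [B p0 0] = 0, so [Z 0] stays the identity. *)
  rewrite subrr; have r00 : `|0 : V| < r by rewrite normr0.
  have X0 : Z 0 0 - 1%:M = 0 by rewrite Z0// subrr.
  apply/eqP; rewrite -subr_eq0 -normr_le0 -[leRHS](mulr0 2).
  apply: (@small_gronwall R n n (fun s => Z 0 s - 1%:M) (fun=> 0) 0 X0); last first.
    by rewrite ler01 lexx.
  move=> s s01; split.
    have := @is_deriveB _ _ _ (Z 0) (fun=> 1%:M) s 1 _ 0 (Z_derive 0 s r00 s01) (is_derive_cst _ _ _).
    by rewrite B0 mulmx0 subr0.
  by rewrite normr0 addr0 mulr_ge0// invr_ge0.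
move=> p pr; pose L v := Z (p - p0) 1 *m B p v.
have linL : linear L by move=> a u v; rewrite /L linB mulmxDr -scalemxAr.
pose LL := GRing.isLinear.Build R V 'M[R]_n *:%R L linL.
pose Ll : {linear V -> 'M[R]_n} := HB.pack L LL.
have cL : continuous Ll by exact: linear_continuous_rV.
have [e e0|dY vY] := @differentiable_approx R V 'M[R]_n (fun p => Z (p - p0) 1) p Ll cL.
  have K1 : 0 < K + 1 by rewrite ltr_wpDl.
  pose dlt := Num.min (r - `|p - p0|) (e / (K + 1)).
  apply/nbhs_normP; exists dlt; first by rewrite /= lt_min subr_gt0 pr divr_gt0.
  move=> k /=; rewrite sub0r normrN lt_min => /andP[k1 k2].
  have dvr : `|p - p0 + k| < r.
    by rewrite (le_lt_trans (ler_normD _ _))// -ltrBrDl.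
  have := Z_taylor (p - p0) k pr dvr.
  rewrite subrKC [k + p - p0]addrC [- p0 + _]addrA [- p0 + k]addrC -addrA [_ + p]addrC addrC.
  move=> le1; apply: le_trans le1 _; rewrite expr2 mulrA ler_wpM2r//.
  rewrite (@le_trans _ _ ((K + 1) * `|k|))//; first by rewrite ler_wpM2r// lerDl.
  by rewrite mulrC -ler_pdivlMr// ltW.
by split=> // v; rewrite deriveE// vY.
Qed.

End TotalDifferentialEquation.

Lemma flat_total_differential {R : realType} {m n : nat} (M : set 'rV[R]_m)
    (B : 'rV[R]_m -> 'rV[R]_m -> 'M[R]_n) (p0 : 'rV[R]_m) :
  open M -> M p0 ->
  (forall p (a : R) u v, B p (a *: u + v) = a *: B p u + B p v) ->
  (forall u i j, smooth_on M (fun p => B p u i j)) ->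
  (forall p u v, M p ->
    'D_u (B ^~ v) p + B p u *m B p v = 'D_v (B ^~ u) p + B p v *m B p u) ->
  exists2 r : R, 0 < r & (forall p, `|p - p0| < r -> M p) /\
    exists2 Y : 'rV[R]_m -> 'M[R]_n, Y p0 = 1%:M &
      forall p, `|p - p0| < r ->
        differentiable Y p /\ forall v, 'D_v Y p = Y p *m B p v.
Proof.
move=> oM Mp0 linB smB flatB.
have [r [C [r0 C0 rM B1 B2]]] := exists_ball_bound oM Mp0 linB smB.
(* The radius is shrunk until [r_small] holds; C + 1 keeps the denominator positive also for C =
   0. *)
pose r' := Num.min r (Num.min 1 (4 * (n%:R + 1) * (C + 1))^-1).
have n1 : 0 < n%:R + 1 :> R by rewrite ltr_wpDl.
have C1 : 0 < C + 1 by rewrite ltr_wpDl.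
have q0 : 0 < 4 * (n%:R + 1) * (C + 1) by rewrite !mulr_gt0.
have r'0 : 0 < r' by rewrite !lt_min r0 ltr01/= invr_gt0.
have r'r (x : R) : x < r' -> x < r by rewrite lt_min => /andP[].
have bb : ball_bound M B p0 r' C.
  split=> //.
  - by move=> p /r'r; exact: rM.
  - by move=> p v /r'r; exact: B1.
  - by move=> p w v /r'r pr /r'r; exact: B2.
have small : r' <= 1 /\ (n%:R + 1) * C * r' <= 4^-1.
  split; first by rewrite /r' !ge_min lexx orbT.
  have : r' <= (4 * (n%:R + 1) * (C + 1))^-1 by rewrite /r' !ge_min lexx !orbT.
  rewrite -[leRHS]mulr1 ler_pdivlMl// => H.
  have nr : 0 <= (n%:R + 1) * r' by rewrite mulr_ge0// ltW.
  by rewrite -(ler_pM2l (ltr0n R 4)) mulfV ?pnatr_eq0//; lra.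
exists r' => //; split; first by move=> p /r'r; exact: rM.
exact: total_differential_solution bb small.
Qed.

(** * A local inverse by contraction *)

Section InverseFunction.
Context {R : realType} {n : nat}.
Local Notation V := 'rV[R]_n.

(** The iterates stay in the ball because r / 2 + r / 2 = r, and r <= 1 gives the k-th step the
    summable bound 2^-k. *)
Lemma contraction_fixed_point (phi : V -> V) (p0 : V) (r : R) : 0 < r <= 1 ->
  (forall x x', `|x - p0| <= r -> `|x' - p0| <= r ->
    `|phi x - phi x'| <= 2^-1 * `|x - x'|) ->
  `|phi p0 - p0| <= r / 2 -> exists2 x, `|x - p0| <= r & phi x = x.
Proof.
move=> /andP[r0 r1] lip start; pose x k := iter k phi p0.
have pr : `|p0 - p0| <= r by rewrite subrr normr0 ltW.
have stay k : `|x k - p0| <= r.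
  elim: k => [|k IH] //; rewrite -(subrK (phi p0) (x k.+1)) -addrA.
  rewrite (le_trans (ler_normD _ _))// (le_trans (lerD (lip _ _ IH pr) start))//.
  lra.
have step k : `|x k.+1 - x k| <= 2^-1 ^+ k.
  elim: k => [|k IH].
    by rewrite expr0 (le_trans start)//; lra.
  rewrite exprS; apply: le_trans (lip _ _ (stay k.+1) (stay k)) _.
  by rewrite ler_wpM2l// invr_ge0.
have xN N : x N = p0 + \sum_(0 <= k < N) (x k.+1 - x k).
  by rewrite telescope_sumr// addrCA subrr addr0.
have lim : exists l : V, forall N, `|l - x N| <= 2 * 2^-1 ^+ N.
  have H j : exists a : R, forall N,
      `|a - \sum_(0 <= k < N) (x k.+1 - x k) 0 j| <= 2 * 2^-1 ^+ N.
    apply: summable_geometric => k.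
    by apply: le_trans (norm_mx_entry _ _ _) _; exact: step.
  have [a Ha] := choice H; exists (p0 + \row_j a j) => N.
  apply: norm_mx_le => [|i j]; first by rewrite mulr_ge0// exprn_ge0// invr_ge0.
  rewrite xN opprD addrACA subrr add0r (ord1 i) !mxE summxE; exact: Ha.
have [l Hl] := lim.
have lr : `|l - p0| <= r.
  rewrite -subr_le0; apply: (@le0_geometric _ _ 2) => N; rewrite lerBlDl.
  have -> : l - p0 = (x N - p0) + (l - x N) by rewrite [RHS]addrC addrA subrK.
  exact: le_trans (ler_normD _ _) (lerD (stay N) (Hl N)).
exists l => //; apply/eqP; rewrite -subr_eq0 -normr_le0.
apply: (@le0_geometric _ _ 2) => N.
have -> : phi l - l = (phi l - x N.+1) + (x N.+1 - l) by rewrite addrA subrK.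
apply: le_trans (ler_normD _ _) _.
have := lip _ _ lr (stay N); have := Hl N; have := Hl N.+1.
rewrite [`|x N.+1 - l|]distrC exprS -/(x N.+1) => h1 h2 h3.
apply: le_trans (lerD h3 h1) _; lra.
Qed.

Variables (F : V -> V) (J : V -> 'M[R]_n) (p0 : V) (r0 : R).
Hypothesis r0_gt0 : 0 < r0.
Hypothesis dF : forall p, `|p - p0| < r0 -> differentiable F p.
Hypothesis FJ : forall p v, `|p - p0| < r0 -> 'D_v F p = v *m J p.
Hypothesis uJ : forall p, `|p - p0| < r0 -> J p \in unitmx.
Hypothesis cJ : {for p0, continuous J}.

Let K := invmx (J p0).
Let p0r : `|p0 - p0| < r0. Proof. by rewrite subrr normr0. Qed.

Let exists_radius : exists r, [/\ 0 < r, r <= r0, r <= 1 &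
  forall p, `|p - p0| < r -> n%:R * `|1%:M - J p *m K| <= 2^-1].
Proof.
have cJK : {for p0, continuous (fun p => J p *m K)}.
  by apply: continuous_mulmx => //; exact: cst_continuous.
have e0 : 0 < (2 * (n%:R + 1))^-1 :> R by rewrite invr_gt0 mulr_gt0// ltr_wpDl.
have : \forall p \near p0, `|J p0 *m K - J p *m K| <= (2 * (n%:R + 1))^-1.
  by move/cvgrPdist_le : cJK; exact.
move=> /nbhs_normP[r /= r_gt0 Hr].
exists (Num.min r (Num.min r0 1)); split.
- by rewrite !lt_min r_gt0 r0_gt0 ltr01.
- by rewrite !ge_min lexx !orbT.
- by rewrite !ge_min lexx !orbT.
move=> p; rewrite lt_min => /andP[pr _]; have := Hr p; rewrite /= distrC => /(_ pr).
rewrite mulmxV ?uJ// => H.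
apply: (@le_trans _ _ (n%:R * (2 * (n%:R + 1))^-1)); first by rewrite ler_wpM2l.
have n1 : 0 < n%:R + 1 :> R by rewrite ltr_wpDl.
by rewrite ler_pdivrMr ?mulr_gt0//; lra.
Qed.

(* The Newton-type map x - (F x - y) K is a contraction near p0. *)
Let almost_linear r : r <= r0 ->
  (forall p, `|p - p0| < r -> n%:R * `|1%:M - J p *m K| <= 2^-1) ->
  forall x x', `|x - p0| < r -> `|x' - p0| < r ->
    `|(x - x') - (F x - F x') *m K| <= 2^-1 * `|x - x'|.
Proof.
move=> rr0 H x x' xr x'r; apply: norm_mx_le => [|i j]; first by rewrite mulr_ge0// invr_ge0.
pose w := x - x'; have xE : x = x' + w by rewrite /w subrKC.
pose f q := (q - F q *m K) i j.
have seg s : 0 <= s <= 1 -> `|x' + s *: w - p0| < r.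
  by apply: segment_ball => //; rewrite -xE.
have seg0 s : 0 <= s <= 1 -> `|x' + s *: w - p0| < r0.
  by move=> /seg /lt_le_trans; exact.
have dG q : `|q - p0| < r0 -> differentiable (fun q => q - F q *m K) q.
  move=> qr; apply: (@differentiableB _ _ _ id (fun q => F q *m K)) => //.
  by apply: differentiable_mulmx; [exact: dF|exact: differentiable_cst].
have df s : 0 <= s <= 1 -> differentiable f (x' + s *: w).
  by move=> s01; apply: differentiable_entry; apply: dG; exact: seg0.
have -> : (x - x' - (F x - F x') *m K) i j = f (x' + w) - f x'.
  by rewrite -xE /f mulmxBl !mxE; ring.
apply: lipschitz_line => // s s01; have qr := seg0 s s01.
have dGq : derivable (fun q => q - F q *m K) (x' + s *: w) w.
  by apply/diff_derivable/dG.
rewrite -(derive_entry i j dGq).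
have -> : 'D_w (fun q => q - F q *m K) (x' + s *: w) = w *m (1%:M - J (x' + s *: w) *m K).
  have dFq : derivable F (x' + s *: w) w by exact/diff_derivable/dF.
  have [dFK vFK] := derivable_mulmx dFq (derivable_cst K (x' + s *: w) w).
  have did : derivable (@id V) (x' + s *: w) w by exact: derivable_id.
  apply: etrans (@deriveB _ _ _ id (fun q => F q *m K) _ w did dFK) _.
  by rewrite derive_id vFK derive_cst mulmx0 addr0 FJ// mulmxBr mulmx1 mulmxA.
rewrite (le_trans (norm_mx_entry _ _ _))// (le_trans (norm_mulmx_le _ _))//.
by rewrite mulrAC ler_wpM2r// H// seg.
Qed.

Lemma local_inverse : exists (A W : set V) (G : V -> V),
  [/\ open A, A p0, A `<=` [set p | `|p - p0| < r0] & open W] /\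
  [/\ forall q, A q -> W (F q) /\ G (F q) = q,
      forall q, W q -> A (G q) /\ F (G q) = q &
      forall q, W q -> differentiable G q /\ forall v, 'D_v G q = v *m invmx (J (G q))].
Proof.
have [r [r_gt0 rr0 r1 H]] := exists_radius.
have AL := almost_linear rr0 H.
(* By [AL], |x - x'| <= |x - x'| / 2 + n |K| |F x - F x'|, so [F] contracts distances at most by the
   factor 1 / k. The summand 1 makes [k] positive. *)
pose k := 2 * (n%:R * `|K|) + 1.
have nK : 0 <= n%:R * `|K| by rewrite mulr_ge0.
have k_gt0 : 0 < k by rewrite ltr_wpDl// mulr_ge0.
have expand x x' : `|x - p0| < r -> `|x' - p0| < r -> `|x - x'| <= k * `|F x - F x'|.
  move=> xr x'r; have := AL x x' xr x'r; have := norm_mulmx_le (F x - F x') K.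
  have : `|x - x'| <= `|x - x' - (F x - F x') *m K| + `|(F x - F x') *m K|.
    by rewrite -{1}(subrK ((F x - F x') *m K) (x - x')); exact: ler_normD.
  have := normr_ge0 (F x - F x'); rewrite /k; lra.
(* For |y - F p0| < d the Newton map moves p0 by at most n |K| d <= r / 8, within half the radius r
   / 2 of the ball on which the fixed point is sought. *)
pose d := r / (4 * k).
have d0 : 0 < d by rewrite divr_gt0// mulr_gt0.
pose W := [set y | `|y - F p0| < d].
have surj y : W y -> exists2 x, `|x - p0| < r & F x = y.
  move=> Wy; pose phi x := x - (F x - y) *m K.
  have r2 : 0 < r / 2 <= 1 by apply/andP; split; lra.
  have r2r x : `|x - p0| <= r / 2 -> `|x - p0| < r by move=> /le_lt_trans; apply; lra.
  have [x xr xE] : exists2 x, `|x - p0| <= r / 2 & phi x = x.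
    apply: contraction_fixed_point => // [x x' /r2r xr /r2r x'r|].
      rewrite (_ : phi x - phi x' = x - x' - (F x - F x') *m K); first exact: AL.
      by rewrite /phi !mulmxBl; apply/rowP => j; rewrite !mxE; ring.
    rewrite (_ : phi p0 - p0 = - ((F p0 - y) *m K)); last by rewrite /phi addrAC subrr add0r.
    rewrite normrN (le_trans (norm_mulmx_le _ _))// distrC.
    have : `|y - F p0| <= d by exact: ltW.
    rewrite /d ler_pdivlMr ?mulr_gt0// /k; have := normr_ge0 (y - F p0); lra.
  exists x; first exact: r2r.
  have : (F x - y) *m K = 0.
    by move: xE => /eqP; rewrite /phi -subr_eq0 addrAC subrr add0r oppr_eq0 => /eqP.
  move=> /(congr1 (mulmx^~ (J p0))); rewrite mul0mx mulmxKV ?uJ// => /eqP.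
  by rewrite subr_eq0 => /eqP.
have [G HG] : exists G : V -> V, forall y, W y -> `|G y - p0| < r /\ F (G y) = y.
  have P y : exists x, W y -> `|x - p0| < r /\ F x = y.
    have [Wy|nWy] := pselect (W y); last by exists 0.
    by have [x xr xE] := surj y Wy; exists x.
  by have [G HG] := choice P; exists G.
have oW : open W.
  rewrite (_ : W = ball (F p0) d); first exact: ball_open.
  by apply/seteqP; split=> y; rewrite -ball_normE /= distrC.
pose A := [set x | `|x - p0| < r] `&` [set x | W (F x)].
have rb : [set x | `|x - p0| < r] = ball p0 r.
  by apply/seteqP; split=> y; rewrite -ball_normE /= distrC.
have uniq x x' : `|x - p0| < r -> `|x' - p0| < r -> F x = F x' -> x = x'.
  move=> xr x'r FE; have := expand x x' xr x'r; rewrite FE subrr normr0 mulr0.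
  by rewrite normr_le0 subr_eq0 => /eqP.
exists A, W, G; split; split=> //.
- rewrite openE => x [xr Wx]; apply: filterI.
    by apply: open_nbhs_nbhs; split=> //; rewrite rb; exact: ball_open.
  have : {for x, continuous F}.
    by apply: differentiable_continuous; apply: dF; exact: lt_le_trans rr0.
  by apply; exact: open_nbhs_nbhs.
- by split; rewrite /W /= ?subrr ?normr0.
- by move=> x [xr _]; exact: lt_le_trans rr0.
- move=> x [xr Wx]; split=> //; have [Gr FG] := HG _ Wx; exact: uniq.
- by move=> y Wy; have [Gr FG] := HG y Wy; split=> //; split=> //; rewrite /= FG.
move=> y Wy; have [Gr FG] := HG y Wy; have Gr0 := lt_le_trans Gr rr0.
pose D := invmx (J (G y)); pose L (v : V) := v *m D.
have linL : linear L by move=> a u v; rewrite /L mulmxDl -scalemxAl.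
pose LL := GRing.isLinear.Build R V V *:%R L linL.
pose Ll : {linear V -> V} := HB.pack L LL.
have cL : continuous Ll by exact: linear_continuous_rV.
have [e e0|dG vG] := @differentiable_approx R V V G y Ll cL; last first.
  by split=> // v; rewrite deriveE// vG.
pose e' := e / (k * (n%:R * `|D| + 1)).
have nD : 0 < n%:R * `|D| + 1 by rewrite ltr_wpDl// mulr_ge0.
have e'0 : 0 < e' by rewrite divr_gt0// mulr_gt0.
have /nbhs_normP[s /= s0 Hs] := differentiable_littleo (dF Gr0) e'0.
have : \forall v \near (0 : V), W (v + y) /\ `|v| < s / k.
  have /nbhs_normP[t /= t0 Ht] := open_nbhs_nbhs (conj oW Wy).
  apply/nbhs_normP; exists (Num.min t (s / k)); first by rewrite /= lt_min t0 divr_gt0.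
  move=> v /=; rewrite sub0r normrN lt_min => /andP[vt ->]; split=> //.
  by apply: Ht; rewrite /= opprD addrCA subrr addr0 normrN.
apply: filterS => v [Wv vs]; have [Gvr FGv] := HG _ Wv.
have ex := expand _ _ Gvr Gr; rewrite FGv FG addrK in ex.
have xs : `|G (v + y) - G y| < s by rewrite (le_lt_trans ex)// mulrC -ltr_pdivlMr.
have := Hs (G (v + y) - G y); rewrite /= sub0r normrN => /(_ xs).
rewrite subrK FGv FG addrK -(deriveE _ (dF Gr0)) FJ//.
move: (G (v + y) - G y) ex => w ex le1.
(* The expansion error of the inverse is that of [F] at [G y], sent through the inverse Jacobian;
   [ex] bounds |w| by k |v|, so both errors are of the same order. *)
have -> : w - L v = - ((v - w *m J (G y)) *m D).
  by rewrite mulmxBl mulmxK ?uJ// opprB.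
rewrite normrN (le_trans (norm_mulmx_le _ _))//.
have le2 : `|v - w *m J (G y)| <= e' * (k * `|v|).
  by rewrite (le_trans le1)// ler_wpM2l// ltW.
apply: (@le_trans _ _ (n%:R * (e' * (k * `|v|)) * `|D|)).
  by rewrite ler_wpM2r// ler_wpM2l.
rewrite (_ : _ * `|D| = e * `|v| * (n%:R * `|D| / (n%:R * `|D| + 1))).
  by rewrite ler_piMr ?mulr_ge0 ?(ltW e0)// ler_pdivrMr// mul1r lerDl.
by rewrite /e'; field; rewrite !gt_eqF.
Qed.

End InverseFunction.

(** * Moving frames *)

Section SmoothInverseMatrix.
Context {R : realType} {V : normedModType R}.
Variable A : set V.
Hypothesis oA : open A.

Lemma smooth_det n (F : V -> 'M[R]_n) : (forall i j, smooth_on A (fun q => F q i j)) ->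
  smooth_on A (fun q => \det (F q)).
Proof.
move=> sF; apply: smooth_sum => // s _.
apply: smoothM => //; first exact: smooth_cst.
exact: smooth_prod.
Qed.

(** By the adjugate formula each entry is a polynomial in the entries of [F] divided by the
    determinant. *)
Lemma smooth_invmx n (F : V -> 'M[R]_n) i j :
  (forall i j, smooth_on A (fun q => F q i j)) ->
  (forall q, A q -> F q \in unitmx) -> smooth_on A (fun q => invmx (F q) i j).
Proof.
move=> sF uF.
apply: (eq_smooth oA (f := fun q => (\det (F q))^-1 * cofactor (F q) j i)).
  by move=> q Aq; rewrite /invmx uF// !mxE.
apply: smoothM => //.
  apply: smoothV => //; last exact: smooth_det.
  by move=> q /uF; rewrite unitmxE unitfE.
apply: smoothM => //; first exact: smooth_cst.
by apply: smooth_det => a b; under eq_fun do rewrite !mxE; exact: sF.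
Qed.

End SmoothInverseMatrix.

(** * Levi-Civita connection and curvature in an orthonormal frame *)

Section MovingFrame.
Context {R : realType}.
Local Notation R4 := 'rV[R]_4.
Variables (M : set R4) (theta : 'I_4 -> R4 -> R4 -> R) (Th : R4 -> 'M[R]_4).
(* [A p u] is the matrix of the connection forms: its entry in row j and column
   k is to be the E_k-component of the covariant derivative of E_j along u. *)
Variable A : R4 -> R4 -> 'M[R]_4.
Hypothesis oM : open M.
Hypothesis thetaE : forall k p u, theta k p u = (u *m Th p) 0 k.
Hypothesis sTh : forall i j, smooth_on M (fun q => Th q i j).
Hypothesis uTh : forall p, M p -> Th p \in unitmx.
Hypothesis linA : forall p a u v, A p (a *: u + v) = a *: A p u + A p v.
Hypothesis skewA : forall p u, (A p u)^T = - A p u.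
Hypothesis sA : forall u i j, smooth_on M (fun q => A q u i j).

(** Row j is to hold the frame components of the covariant derivative of the j-th coordinate field
    along [u]; vanishing torsion is then a symmetry in [u] and [v]. *)
Definition coframe_deriv p u : 'M[R]_4 := 'D_u Th p + Th p *m A p u.

Hypothesis torsion_free : forall p u v, M p ->
  v *m coframe_deriv p u = u *m coframe_deriv p v.

(** The order of the products comes from frame components being rows on which [A] acts from the
    right. *)
Definition curvature_form p u v : 'M[R]_4 :=
  'D_u (A ^~ v) p - 'D_v (A ^~ u) p + A p v *m A p u - A p u *m A p v.

Local Notation Q := coframe_deriv.
Local Notation g := (metric theta).
Local Notation E := (dual_frame theta).

Let dTh p : M p -> differentiable Th p.
Proof.
by move=> Mp; apply: differentiable_mx => i j; exact: smooth_differentiable (sTh i j) Mp.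
Qed.

Let dA p u : M p -> differentiable (A ^~ u) p.
Proof.
by move=> Mp; apply: differentiable_mx => i j; exact: smooth_differentiable (sA u i j) Mp.
Qed.

Let dinvTh p : M p -> differentiable (fun q => invmx (Th q)) p.
Proof.
move=> Mp; apply: differentiable_mx => i j.
apply: smooth_differentiable Mp; exact: smooth_invmx.
Qed.

Lemma metricE p u v : g p u v = (u *m Th p *m (v *m Th p)^T) 0 0.
Proof. by rewrite /metric mxE; apply: eq_bigr => k _; rewrite !thetaE !mxE. Qed.

Lemma dual_frameE j p : E j p = row j (invmx (Th p)).
Proof.
rewrite /dual_frame; congr (row _ (invmx _)); apply/matrixP => i k.
by rewrite mxE thetaE -rowE mxE.
Qed.

Lemma dual_frame_coframe j p : M p -> E j p *m Th p = delta_mx 0 j.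
Proof. by move=> Mp; rewrite dual_frameE -row_mul mulVmx ?uTh// row1. Qed.

Lemma metric_dual_frame p u k : M p -> g p u (E k p) = theta k p u.
Proof.
move=> Mp; rewrite metricE dual_frame_coframe// trmx_delta -colE mxE.
by rewrite thetaE.
Qed.

Lemma theta_dual_frame j k p : M p -> theta k p (E j p) = (j == k)%:R.
Proof.
by move=> Mp; rewrite thetaE dual_frame_coframe// mxE eqxx/= eq_sym.
Qed.

Let linQ p a u v : M p -> Q p (a *: u + v) = a *: Q p u + Q p v.
Proof.
move=> Mp; rewrite /Q derive_linear; last exact: dTh.
rewrite linA; move: ('D_u Th p) ('D_v Th p) => Du Dv.
by rewrite mulmxDr -scalemxAr scalerDr addrACA.
Qed.

Let gramE p : gram g p = Th p *m (Th p)^T.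
Proof.
by apply/matrixP => i j; rewrite mxE metricE -!rowE !mxE; apply: eq_bigr => k _; rewrite !mxE.
Qed.

(** Metric compatibility: in the derivative of Th Th^T the contributions of [A] cancel by skewness,
    so [Q] may stand in for the derivative of [Th]. *)
Let derive_gram p u i j : M p ->
  'D_u (fun q => gram g q i j) p =
    (row i (Q p u) *m (row j (Th p))^T) 0 0 + (row j (Q p u) *m (row i (Th p))^T) 0 0.
Proof.
move=> Mp; have DT : derivable Th p u by exact/diff_derivable/dTh.
have DTt : is_derive p u (fun q => (Th q)^T) ('D_u Th p)^T.
  have D : derivable (fun q => (Th q)^T) p u.
    apply/derivable_mxP => a b; under eq_fun do rewrite mxE.
    by have /derivable_mxP := DT; exact.
  split=> //; apply/matrixP => a b; rewrite derive_entry// mxE derive_entry//.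
  by under eq_fun do rewrite mxE.
have [DTt' _] := DTt; have DG := derivable_mulmx DT DTt'.
have -> : (fun q => gram g q i j) = (fun q => (Th q *m (Th q)^T) i j).
  by apply/funext => q; rewrite gramE.
have [DG' DGv] := DG; rewrite -(derive_entry i j DG').
have -> : 'D_u (fun q => Th q *m (Th q)^T) p = Q p u *m (Th p)^T + Th p *m (Q p u)^T.
  rewrite DGv; have [_ ->] := DTt.
  rewrite /Q mulmxDl linearD/= mulmxDr trmx_mul skewA mulNmx mulmxN -mulmxA.
  by rewrite [Th p *m (A p u *m _)]mulmxA addrACA subrr addr0.
rewrite !mxE; congr (_ + _); apply: eq_bigr => k _; rewrite !mxE//.
by rewrite mulrC.
Qed.

(** Koszul's formula: the three metric derivatives give six products; the symmetry [T] cancels four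
    of them and identifies the other two. *)
Lemma christoffelE p i j k : M p -> christoffel g p i j k =
  ((delta_mx 0 j : R4) *m Q p (delta_mx 0 i) *m invmx (Th p)) 0 k.
Proof.
move=> Mp; pose e i : R4 := delta_mx 0 i.
have T a b : row a (Q p (e b)) = row b (Q p (e a)) by rewrite !rowE torsion_free.
transitivity ((invmx (gram g p) *m Th p *m (row j (Q p (e i)))^T) k 0).
  rewrite /christoffel mulr_sumr -mulmxA mxE; apply: eq_bigr => l _.
  rewrite /partial !derive_gram// -/(e i) -/(e j) -/(e l) mulrCA; congr (_ * _).
  rewrite (T l i) (T l j) (T i j).
  rewrite [RHS](_ : _ = (row j (Q p (e i)) *m (row l (Th p))^T) 0 0); last first.
    by rewrite !mxE; apply: eq_bigr => m _; rewrite !mxE mulrC.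
  by rewrite T; field.
have Tu := uTh Mp.
rewrite gramE (_ : invmx _ = (invmx (Th p))^T *m invmx (Th p)); last first.
  have U : Th p *m (Th p)^T \in unitmx by rewrite unitmx_mul unitmx_tr Tu.
  apply: (can_inj (mulmxK U)); rewrite mulVmx// -mulmxA mulKmx//.
  by rewrite -trmx_mul mulmxV// trmx1.
by rewrite mulmxKV// -trmx_mul mxE rowE.
Qed.

Lemma nabla_frame X Y p : M p -> differentiable Y p ->
  nabla g X Y p *m Th p =
    'D_(X p) (fun q => Y q *m Th q) p + Y p *m Th p *m A p (X p).
Proof.
move=> Mp dY; have DY : derivable Y p (X p) by exact: diff_derivable.
have DT : derivable Th p (X p) by exact/diff_derivable/dTh.
have [_ ->] := derivable_mulmx DY DT.
rewrite /nabla mulmxDl -!addrA; congr (_ + _).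
rewrite (_ : \row_k _ = Y p *m Q p (X p) *m invmx (Th p)).
  by rewrite mulmxKV ?uTh// mulmxDr mulmxA.
have QX : Q p (X p) = \sum_i X p 0 i *: Q p (delta_mx 0 i).
  pose QL := GRing.isLinear.Build R R4 'M[R]_4 *:%R (Q p) (fun a u v => linQ a u v Mp).
  pose Ql : {linear R4 -> 'M[R]_4} := HB.pack (Q p) QL.
  rewrite -[LHS]/(Ql (X p)) {1}(row_sum_delta (X p)) linear_sum.
  by apply: eq_bigr => i _; rewrite linearZ.
apply/rowP => k; rewrite mxE QX mulmx_sumr mulmx_suml summxE; apply: eq_bigr => i _.
rewrite -scalemxAr -scalemxAl mxE.
rewrite [X in X *m _ *m _]row_sum_delta !mulmx_suml summxE mulr_sumr.
by apply: eq_bigr => j _; rewrite -!scalemxAl mxE christoffelE// mulrA.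
Qed.

Lemma GammaE i j k p : M p -> Gamma g E i j k p = A p (E i p) j k.
Proof.
move=> Mp; rewrite /Gamma metric_dual_frame// thetaE nabla_frame//; last first.
  rewrite (_ : E j = fun q => row j (invmx (Th q))); last first.
    by apply/funext => q; rewrite dual_frameE.
  apply: differentiable_mx => a b; under eq_fun do rewrite mxE.
  exact/differentiable_entry/dinvTh.
rewrite (@eq_on_derive _ _ _ M _ (fun=> delta_mx 0 j))//; last first.
  by move=> q Mq; rewrite dual_frame_coframe.
by rewrite derive_cst add0r dual_frame_coframe// -rowE mxE.
Qed.

Lemma connection0 p : A p 0 = 0.
Proof.
have := linA p 1 0 0; rewrite !scale1r addr0 => /eqP.
by rewrite -subr_eq subrr => /eqP.
Qed.

Let smTh : smooth_on M Th. Proof. exact: smooth_mx. Qed.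

Let ddTh p u v : M p -> derivable ('D_v Th) p u.
Proof.
move=> Mp; apply: diff_derivable; apply: smooth_differentiable Mp.
exact: smooth_derive smTh.
Qed.

Let dcoframe_deriv p v : M p -> differentiable (Q ^~ v) p.
Proof.
move=> Mp; apply: (@differentiableD _ _ _ ('D_v Th) (fun q => Th q *m A q v)).
  by apply: smooth_differentiable Mp; exact: smooth_derive.
by apply: differentiable_mulmx; [exact: dTh|exact: dA].
Qed.

Let derive_comm_Th p u v : M p -> 'D_u ('D_v Th) p = 'D_v ('D_u Th) p.
Proof.
move=> Mp; apply/matrixP => i j.
have E w q : M q -> 'D_w Th q i j = 'D_w (fun q => Th q i j) q.
  by move=> Mq; apply: derive_entry; exact/diff_derivable/dTh.
have D a b : 'D_a ('D_b Th) p i j = 'D_a ('D_b (fun q => Th q i j)) p.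
  apply: etrans (derive_entry i j (@ddTh p a b Mp)) _.
  exact: eq_on_derive oM (E b) Mp.
apply: etrans (D u v) (etrans _ (esym (D v u))).
exact: derive_comm oM Mp (sTh i j).
Qed.

Let nabla_cst q v w : M q ->
  nabla g (fun=> v) (fun=> w) q = w *m Q q v *m invmx (Th q).
Proof.
move=> Mq; apply: (can_inj (mulmxK (uTh Mq))).
rewrite nabla_frame ?mulmxKV ?uTh//.
have DT : derivable Th q v by exact/diff_derivable/dTh.
have [_ ->] := derivable_mulmx (derivable_cst w q v) DT.
by rewrite derive_cst mul0mx add0r mulmxDr mulmxA.
Qed.

Let nabla_nabla_cst p u v w : M p ->
  nabla g (fun=> u) (nabla g (fun=> v) (fun=> w)) p *m Th p =
    w *m ('D_u ('D_v Th) p + ('D_u Th p *m A p v + Th p *m 'D_u (A ^~ v) p)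
          + Q p v *m A p u).
Proof.
move=> Mp; have ZE := fun q => @nabla_cst q v w.
have dZ : differentiable (nabla g (fun=> v) (fun=> w)) p.
  have ZE' q (Mq : M q) := esym (ZE q Mq).
  apply: (eq_on_differentiable oM ZE' Mp).
  apply: differentiable_mulmx; last exact: dinvTh.
  by apply: differentiable_mulmx; [exact: differentiable_cst|exact: dcoframe_deriv].
rewrite nabla_frame// (@eq_on_derive _ _ _ M _ (fun q => w *m Q q v))//; last first.
  by move=> q Mq; rewrite ZE// mulmxKV// uTh.
rewrite ZE// mulmxKV ?uTh//.
have DQ : derivable (Q ^~ v) p u by exact/diff_derivable/dcoframe_deriv.
have DT : derivable Th p u by exact/diff_derivable/dTh.
have DA : derivable (A ^~ v) p u by exact/diff_derivable/dA.
have [_ ->] := derivable_mulmx (derivable_cst w p u) DQ.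
rewrite derive_cst mul0mx add0r -mulmxA -mulmxDr.
congr (_ *m (_ + _)).
have DTA := derivable_mulmx DT DA; have [DTA1 DTA2] := DTA.
apply: etrans (congr1 (+%R ('D_u ('D_v Th) p)) DTA2).
exact: (@deriveD _ _ _ ('D_v Th) (fun q => Th q *m A q v) p u (@ddTh p u v Mp) DTA1).
Qed.

(** For constant fields the bracket vanishes. The second derivatives of [Th] cancel by symmetry, the
    products of a first derivative of [Th] with [A] cancel in pairs, and [Th] times the curvature
    form is left. *)
Lemma riemE p u v w s : M p ->
  riem g p u v w s = (w *m Th p *m curvature_form p u v *m (s *m Th p)^T) 0 0.
Proof.
move=> Mp; rewrite /riem metricE; congr ((_ *m _) 0 0).
have E3 : nabla g (bracket (fun=> u) (fun=> v)) (fun=> w) p *m Th p = 0.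
  rewrite nabla_frame// /bracket !derive_cst subrr connection0 mulmx0 addr0.
  exact: derive0.
have E1 := @nabla_nabla_cst p u v w Mp; have E2 := @nabla_nabla_cst p v u w Mp.
rewrite /curvature mulmxBl mulmxBl.
apply: etrans (congr2 +%R (congr2 (fun a b => a - b) E1 E2) (congr1 -%R E3)) _.
rewrite subr0 -mulmxBr -mulmxA; congr (_ *m _).
have alg (D T Du Dv Au Av X Y : 'M[R]_4) :
    D + (Du *m Av + T *m X) + (Dv + T *m Av) *m Au
    - (D + (Dv *m Au + T *m Y) + (Du + T *m Au) *m Av) =
    T *m (X - Y + Av *m Au - Au *m Av).
  rewrite !mulmxDl -!mulmxA !mulmxDr !mulmxN.
  move: (T *m X) (T *m Y) (Du *m Av) (Dv *m Au) => a b c d.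
  move: (T *m (Av *m Au)) (T *m (Au *m Av)) => e f.
  by apply/matrixP => i j; rewrite !mxE; ring.
rewrite (@derive_comm_Th p u v Mp); exact: alg.
Qed.

End MovingFrame.

(** * The explicit coframe *)

Section ExplicitCoframe.
Context {R : realType}.
Local Notation R4 := 'rV[R]_4.
Implicit Types (h H : 'rV[R]_2 -> R) (p u v : R4).

Definition coframe_mx h H p : 'M[R]_4 :=
  \matrix_(i, k) coframe h H k p (delta_mx 0 i).

(** These are the skew matrices commuting with the complex structure E_1 -> E_2, E_4 -> E_3, a copy
    of u(2): the connection of a Kaehler surface takes its values there. *)
Definition connection_mx (a b x y : R) : 'M[R]_4 :=
  \matrix_(j, k) nth 0 (nth [::] [:: [:: 0; a; y; - x];
                                     [:: - a; 0; - x; - y];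
                                     [:: - y; x; 0; - b];
                                     [:: x; y; b; 0]] j) k.

Lemma connection_mx_linear c a b x y a' b' x' y' :
  connection_mx (c * a + a') (c * b + b') (c * x + x') (c * y + y') =
  c *: connection_mx a b x y + connection_mx a' b' x' y'.
Proof.
apply/matrixP; apply: ord4_ind; apply: ord4_ind; rewrite !mxE /=; ring.
Qed.

Lemma connection_mx_skew a b x y :
  (connection_mx a b x y)^T = - connection_mx a b x y.
Proof.
apply/matrixP; apply: ord4_ind; apply: ord4_ind; rewrite !mxE /=; ring.
Qed.

(** [a] and [b] are the rotation forms inside the planes (E_1, E_2) and (E_4, E_3); h dx and h dy
    couple the two planes. *)
Definition connection h H p u : 'M[R]_4 :=
  let q := base p in
  let b := l2 H q * u 0 i1 + n2 H q * u 0 i2 - u 0 i4 / 2 in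
  let a := b - partial 1 (logf h) q * u 0 i1 + partial 0 (logf h) q * u 0 i2 in
  connection_mx a b (h q * u 0 i1) (h q * u 0 i2).

Lemma coframeE h H k p u : coframe h H k p u = (u *m coframe_mx h H p) 0 k.
Proof.
rewrite mxE sum_ord4 !mxE; move: k; apply: ord4_ind;
  by rewrite /coframe /= !mxE /=; ring.
Qed.

Lemma connection_linear h H p a u v :
  connection h H p (a *: u + v) = a *: connection h H p u + connection h H p v.
Proof.
rewrite /connection -connection_mx_linear !mxE.
move: (l2 _ _) (n2 _ _) (partial _ _ _) (partial _ _ _) (h _) => l n m1 m0 k.
move: (u 0 i1) (u 0 i2) (u 0 i4) (v 0 i1) (v 0 i2) (v 0 i4) => u1 u2 u4 v1 v2 v4.
by congr connection_mx; ring.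
Qed.

Lemma connection_skew h H p u : (connection h H p u)^T = - connection h H p u.
Proof. exact: connection_mx_skew. Qed.

Variables (U : set 'rV[R]_2) (h H : 'rV[R]_2 -> R).
Hypothesis oU : open U.
Hypothesis sh : smooth_on U h.
Hypothesis sH : smooth_on U H.
Hypothesis h_gt0 : forall q, U q -> 0 < h q.
Hypothesis H_gt0 : forall q, U q -> 0 < H q.
Local Notation M := (total_space U).

Lemma open_total_space : open M.
Proof.
have -> : M = @base R @^-1` U `&` (fun p : R4 => p 0 i3) @^-1` [set x | x < 0] by [].
apply: openI; apply: open_comp => //.
- by move=> p _; exact: continuous_base.
- by move=> p _; exact: coord_continuous.
Qed.

Lemma smooth_logf (k : 'rV[R]_2 -> R) : smooth_on U k -> (forall q, U q -> 0 < k q) ->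
  smooth_on U (logf k).
Proof. by move=> sk k0; apply: smooth_comp => //; last exact: smooth_ln. Qed.

Lemma partial_logf (k : 'rV[R]_2 -> R) i q : smooth_on U k -> (forall q, U q -> 0 < k q) -> U q ->
  partial i k q = k q * partial i (logf k) q.
Proof.
move=> sk k0 Uq; have dk := smooth_differentiable sk Uq.
have dl := smooth_differentiable smooth_ln (k0 _ Uq).
rewrite /partial (derive_comp1 _ dk dl).
have [_ ->] := is_derive1_ln (k0 _ Uq).
by rewrite mulrA divff ?mul1r// gt_eqF// k0.
Qed.

Let slh : smooth_on U (logf h). Proof. exact: smooth_logf. Qed.
Let slH : smooth_on U (logf H). Proof. exact: smooth_logf. Qed.

Lemma smooth_base (k : 'rV[R]_2 -> R) : smooth_on U k -> smooth_on M (fun p => k (base p)).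
Proof.
move=> sk; apply: (@smooth_precomp_linear _ _ _ _ M U (@base R) k) => //.
- exact: open_total_space.
- by move=> p [].
- exact: continuous_base.
Qed.

Lemma smooth_coord_half (A : set R4) i : open A -> smooth_on A (fun p => p 0 i / 2).
Proof. by move=> oA; apply: smoothM => //; [exact: smooth_coord|exact: smooth_cst]. Qed.

Let oM := open_total_space.

Lemma smooth_coframe k u : smooth_on M (fun p => coframe h H k p u).
Proof.
have sz : smooth_on M (fun p => p 0 i3) by exact: smooth_coord.
have sc : smooth_on M (fun p => cos (p 0 i4 / 2)).
  by apply: (smooth_comp oM (B := setT)) => //; [exact: smooth_cos|exact: smooth_coord_half].
have ss : smooth_on M (fun p => sin (p 0 i4 / 2)).
  by apply: (smooth_comp oM (B := setT)) => //; [exact: smooth_sin|exact: smooth_coord_half].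
have shb := smooth_base sh; have sHb := smooth_base sH.
have sl : smooth_on M (fun p => l2 H (base p)).
  by apply: smooth_base; apply: smoothN => //; exact: smooth_derive.
have sn : smooth_on M (fun p => n2 H (base p)).
  by apply: smooth_base; exact: smooth_derive.
have sC (c : R) : smooth_on M (fun=> c) by exact: smooth_cst.
by move: k; apply: ord4_ind;
  repeat first [exact: sC | exact: sz | exact: sc | exact: ss | exact: shb
    | exact: sHb | exact: sl | exact: sn | apply: smoothN => //
    | apply: smoothM => // | apply: smoothD => //]; exact: smooth_coord_half.
Qed.

Lemma smooth_connection u i j : smooth_on M (fun p => connection h H p u i j).
Proof.
have sC (c : R) : smooth_on M (fun=> c) by exact: smooth_cst.
have shb := smooth_base sh.
have sm k : smooth_on M (fun p => partial k (logf h) (base p)).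
  by apply: smooth_base; exact: smooth_derive.
have sl : smooth_on M (fun p => l2 H (base p)).
  by apply: smooth_base; apply: smoothN => //; exact: smooth_derive.
have sn : smooth_on M (fun p => n2 H (base p)).
  by apply: smooth_base; exact: smooth_derive.
under eq_fun do rewrite mxE.
move: i j; apply: ord4_ind; apply: ord4_ind => /=;
  by repeat first [exact: sC | exact: shb | exact: sm | exact: sl | exact: sn
    | apply: smoothN => // | apply: smoothM => // | apply: smoothB => // | apply: smoothD => //].
Qed.

End ExplicitCoframe.

(** * The structure equation with values and derivatives as free real numbers *)

Section CoframeAt.
Context {R : realType}.
Local Notation R4 := 'rV[R]_4.
Variables (z h H l n s c m1 m2 L11 L12 : R).
Implicit Types (k : 'I_4) (u v : R4).

(** Here l, n stand for the values of [l2] and [n2], s, c for the sine and cosine of t / 2, m1, m2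
    for the first partials of ln h, and L11, L12 for second partials of ln H. *)
Definition coframe_at k u : R :=
  nth 0 [:: z * h * u 0 i1; z * h * u 0 i2;
            - (z / 2) * u 0 i4 + (c * H + z * l) * u 0 i1
            + (- s * H + z * n) * u 0 i2;
            u 0 i3 - s * H * u 0 i1 - c * H * u 0 i2] k.

Let dh u := h * (u 0 i1 * m1 + u 0 i2 * m2).
Let dH u := H * (u 0 i1 * n - u 0 i2 * l).
(** The equation for ln H enters here: 2 h^2 - L11 stands for (ln H)_yy. *)
Let dl u := - (u 0 i1 * L12 + u 0 i2 * (2 * h ^+ 2 - L11)).
Let dn u := u 0 i1 * L11 + u 0 i2 * L12.

Definition coframe_deriv_at k u v : R :=
  nth 0 [:: (u 0 i3 * h + z * dh u) * v 0 i1;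
            (u 0 i3 * h + z * dh u) * v 0 i2;
            - (u 0 i3 / 2) * v 0 i4
            + (- s * (u 0 i4 / 2) * H + c * dH u + u 0 i3 * l + z * dl u) * v 0 i1
            + (- c * (u 0 i4 / 2) * H - s * dH u + u 0 i3 * n + z * dn u) * v 0 i2;
            - (c * (u 0 i4 / 2) * H + s * dH u) * v 0 i1
            - (- s * (u 0 i4 / 2) * H + c * dH u) * v 0 i2] k.

Definition connection_at u : 'M[R]_4 :=
  let b := l * u 0 i1 + n * u 0 i2 - u 0 i4 / 2 in
  connection_mx (b - m2 * u 0 i1 + m1 * u 0 i2) b (h * u 0 i1) (h * u 0 i2).

Lemma torsion_identity k u v :
  coframe_deriv_at k u v + \sum_i coframe_at i v * connection_at u i k =
  coframe_deriv_at k v u + \sum_i coframe_at i u * connection_at v i k.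
Proof.
rewrite !sum_ord4; move: k; apply: ord4_ind;
  rewrite !mxE /coframe_deriv_at /coframe_at /= /dh /dH /dl /dn; by field.
Qed.

End CoframeAt.

Section CoframeDerivative.
Context {R : realType}.
Local Notation R4 := 'rV[R]_4.
Variables (h H : 'rV[R]_2 -> R).
Implicit Types (p u v : R4).

Lemma coframe_atE k p v : coframe h H k p v =
  coframe_at (p 0 i3) (h (base p)) (H (base p)) (l2 H (base p))
      (n2 H (base p)) (sin (p 0 i4 / 2)) (cos (p 0 i4 / 2)) k v.
Proof. by move: k; apply: ord4_ind. Qed.

Lemma is_derive_coframe_at k p u v m1 m2 L11 L12 :
  is_derive p u (fun q => h (base q)) (h (base p) * (u 0 i1 * m1 + u 0 i2 * m2)) ->
  is_derive p u (fun q => H (base q))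
    (H (base p) * (u 0 i1 * n2 H (base p) - u 0 i2 * l2 H (base p))) ->
  is_derive p u (fun q => l2 H (base q))
    (- (u 0 i1 * L12 + u 0 i2 * (2 * h (base p) ^+ 2 - L11))) ->
  is_derive p u (fun q => n2 H (base q)) (u 0 i1 * L11 + u 0 i2 * L12) ->
  is_derive p u (fun q => coframe h H k q v)
    (coframe_deriv_at (p 0 i3) (h (base p)) (H (base p)) (l2 H (base p))
      (n2 H (base p)) (sin (p 0 i4 / 2)) (cos (p 0 i4 / 2)) m1 m2 L11 L12 k u v).
Proof.
move=> dh dH dl dn; move: k; apply: ord4_ind; rewrite /coframe /coframe_deriv_at /=;
  apply: is_derive_eq;
  repeat first
  [ exact: is_derive_cst | exact: is_derive_coord | exact: is_derive_cos_coord
  | exact: is_derive_sin_coord | exact: dh | exact: dH | exact: dn | exact: dl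
  | apply: is_derive_mul | apply: is_derive_add | apply: is_derive_opp ].
all: by rewrite /=; field.
Qed.

End CoframeDerivative.

Lemma laplacianE (R : realType) (f : 'rV[R]_2 -> R) q :
  laplacian f q = partial 0 (partial 0 f) q + partial 1 (partial 1 f) q.
Proof.
rewrite /laplacian big_ord_recl big_ord1.
by have -> : lift ord0 ord0 = 1 :> 'I_2 by exact: val_inj.
Qed.

Section ExplicitCurvature.
Context {R : realType}.
Local Notation R4 := 'rV[R]_4.
Variables (U : set 'rV[R]_2) (h H : 'rV[R]_2 -> R).
Hypothesis oU : open U.
Hypothesis sh : smooth_on U h.
Hypothesis sH : smooth_on U H.
Hypothesis h_gt0 : forall q, U q -> 0 < h q.
Hypothesis H_gt0 : forall q, U q -> 0 < H q.
Hypothesis lapH : forall q, U q -> laplacian (logf H) q = 2 * h q ^+ 2.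
Local Notation M := (total_space U).
Implicit Types (p u v : R4).

Let slh : smooth_on U (logf h). Proof. exact: smooth_logf. Qed.
Let slH : smooth_on U (logf H). Proof. exact: smooth_logf. Qed.

(** The closed form serves to evaluate the connection on E_j; as an explicit inverse it also shows
    that the four forms are independent on [M]. *)
Definition frame_mx p : 'M[R]_4 :=
  let q := base p in let z := p 0 i3 in let t := p 0 i4 in
  \matrix_(j, i) nth 0 (nth [::] [::
    [:: (z * h q)^-1; 0; sin (t / 2) * H q / (z * h q);
        2 * (cos (t / 2) * H q + z * l2 H q) / (z ^+ 2 * h q)];
    [:: 0; (z * h q)^-1; cos (t / 2) * H q / (z * h q);
        2 * (- sin (t / 2) * H q + z * n2 H q) / (z ^+ 2 * h q)];
    [:: 0; 0; 0; - 2 / z];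
    [:: 0; 0; 1; 0]] j) i.

Lemma frame_coframe p : M p -> frame_mx p *m coframe_mx h H p = 1%:M.
Proof.
case=> Up z0; have h0 := h_gt0 Up.
have zn0 : p 0 i3 != 0 by rewrite lt_eqF.
have hn0 : h (base p) != 0 by rewrite gt_eqF.
apply/matrixP; apply: ord4_ind; apply: ord4_ind; rewrite mxE sum_ord4 !mxE /coframe /=;
  rewrite !mxE /=; field; rewrite ?zn0 ?hn0//.
Qed.

Lemma unit_coframe p : M p -> coframe_mx h H p \in unitmx.
Proof. by move=> /frame_coframe /mulmx1_unit[]. Qed.

Lemma dual_frame_mx p j : M p -> dual_frame (coframe h H) j p = row j (frame_mx p).
Proof.
move=> Mp; rewrite (dual_frameE (@coframeE R h H)); congr row.
by apply: (can_inj (mulmxK (unit_coframe Mp))); rewrite mulVmx ?unit_coframe ?frame_coframe.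
Qed.

Lemma is_derive_smooth_base p u (k : 'rV[R]_2 -> R) : smooth_on U k -> M p ->
  is_derive p u (fun q => k (base q))
    (u 0 i1 * partial 0 k (base p) + u 0 i2 * partial 1 k (base p)).
Proof. by move=> sk [Up _]; apply: is_derive_base; exact: smooth_differentiable Up. Qed.

Lemma partial_comm (k : 'rV[R]_2 -> R) q : smooth_on U k -> U q ->
  partial 1 (partial 0 k) q = partial 0 (partial 1 k) q.
Proof. by move=> sk Uq; exact: derive_comm oU Uq sk. Qed.

Lemma is_derive_h p u : M p -> is_derive p u (fun q => h (base q)) (h (base p) *
    (u 0 i1 * partial 0 (logf h) (base p) + u 0 i2 * partial 1 (logf h) (base p))).
Proof.
move=> Mp; have [Up _] := Mp; apply: (is_derive_eq (is_derive_smooth_base u sh Mp)).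
rewrite (partial_logf 0 sh h_gt0 Up) (partial_logf 1 sh h_gt0 Up).
by move: (partial 0 _ _) (partial 1 _ _) => a b; ring.
Qed.

Lemma is_derive_H p u : M p -> is_derive p u (fun q => H (base q)) (H (base p) *
    (u 0 i1 * n2 H (base p) - u 0 i2 * l2 H (base p))).
Proof.
move=> Mp; have [Up _] := Mp; apply: (is_derive_eq (is_derive_smooth_base u sH Mp)).
rewrite (partial_logf 0 sH H_gt0 Up) (partial_logf 1 sH H_gt0 Up) /n2 /l2.
by move: (partial 0 _ _) (partial 1 _ _) => a b; ring.
Qed.

Lemma is_derive_n2 p u : M p -> is_derive p u (fun q => n2 H (base q))
  (u 0 i1 * partial 0 (partial 0 (logf H)) (base p)
   + u 0 i2 * partial 0 (partial 1 (logf H)) (base p)).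
Proof.
move=> Mp; have [Up _] := Mp.
have sk : smooth_on U (partial 0 (logf H)) by exact: smooth_derive.
apply: (is_derive_eq (is_derive_smooth_base u sk Mp)); have := partial_comm slH Up.
by move: (partial 1 (partial 0 _) _) => a ->.
Qed.

Lemma is_derive_l2 p u : M p -> is_derive p u (fun q => l2 H (base q))
  (- (u 0 i1 * partial 0 (partial 1 (logf H)) (base p)
   + u 0 i2 * (2 * h (base p) ^+ 2 - partial 0 (partial 0 (logf H)) (base p)))).
Proof.
move=> Mp; have [Up _] := Mp; apply: is_derive_opp.
have E : partial 1 (partial 1 (logf H)) (base p) =
    2 * h (base p) ^+ 2 - partial 0 (partial 0 (logf H)) (base p).
  rewrite -(lapH Up) laplacianE.
  by move: (partial 0 _ _) (partial 1 _ _) => a b; ring.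
have sk : smooth_on U (partial 1 (logf H)) by exact: smooth_derive.
apply: (is_derive_eq (is_derive_smooth_base u sk Mp)); move: E.
by move: (partial 1 (partial 1 _) _) => a ->.
Qed.

Lemma is_derive_coframe k p u v : M p ->
  is_derive p u (fun q => coframe h H k q v)
    (coframe_deriv_at (p 0 i3) (h (base p)) (H (base p)) (l2 H (base p))
      (n2 H (base p)) (sin (p 0 i4 / 2)) (cos (p 0 i4 / 2))
      (partial 0 (logf h) (base p)) (partial 1 (logf h) (base p))
      (partial 0 (partial 0 (logf H)) (base p))
      (partial 0 (partial 1 (logf H)) (base p)) k u v).
Proof.
move=> Mp; exact: is_derive_coframe_at (is_derive_h u Mp) (is_derive_H u Mp) (is_derive_l2 u Mp) (is_derive_n2 u Mp).
Qed.

(** In components this is d theta = theta /\ A on pairs of constant fields, which is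
    [torsion_identity]. *)
Lemma coframe_torsion_free p u v : M p ->
  v *m coframe_deriv (coframe_mx h H) (connection h H) p u =
  u *m coframe_deriv (coframe_mx h H) (connection h H) p v.
Proof.
move=> Mp; apply/rowP => k.
have E a b : (b *m coframe_deriv (coframe_mx h H) (connection h H) p a) 0 k =
    'D_a (fun q => coframe h H k q b) p
    + \sum_l coframe h H l p b * connection h H p a l k.
  have DT : derivable (coframe_mx h H) p a.
    apply/diff_derivable/differentiable_mx => i j; under eq_fun do rewrite mxE.
    by apply: smooth_differentiable Mp; exact: smooth_coframe.
  rewrite /coframe_deriv mulmxDr mxE mulmxA [X in _ + X]mxE; congr (_ + _); last first.
    by apply: eq_bigr => l _; rewrite coframeE.
  have DvT := derivable_mulmx (derivable_cst b p a) DT; have [DvT1 DvT2] := DvT.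
  have -> : b *m 'D_a (coframe_mx h H) p = 'D_a (fun q => b *m coframe_mx h H q) p.
    by apply: etrans (esym DvT2); rewrite derive_cst mul0mx add0r.
  apply: etrans (derive_entry 0 k DvT1) _.
  by congr ('D_a _ p); apply/funext => q; rewrite coframeE.
apply: etrans (E u v) (etrans _ (esym (E v u))).
have [_ ->] := is_derive_coframe k u v Mp; have [_ ->] := is_derive_coframe k v u Mp.
under eq_bigr do rewrite coframe_atE.
under [in RHS]eq_bigr do rewrite coframe_atE.
exact: torsion_identity.
Qed.

End ExplicitCurvature.

(** * The curvature form of the explicit connection *)

Section ConnectionDerivative.
Context {R : realType}.
Local Notation R4 := 'rV[R]_4.

Lemma is_derive_connection_mx (a b x y : R4 -> R) p v da db dx dy :
  is_derive p v a da -> is_derive p v b db -> is_derive p v x dx ->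
  is_derive p v y dy ->
  is_derive p v (fun q => connection_mx (a q) (b q) (x q) (y q))
    (connection_mx da db dx dy).
Proof.
move=> Da Db Dx Dy; apply: is_derive_mx.
apply: ord4_ind; apply: ord4_ind; rewrite !mxE /=;
  under eq_fun do rewrite !mxE /=;
  by repeat first [exact: is_derive_cst | exact: Da | exact: Db | exact: Dx
                  | exact: Dy | apply: is_derive_opp].
Qed.

Lemma is_derive_connection_at (h l n m1 m2 : R4 -> R)
    (p u v : R4) (dh dl dn dm1 dm2 : R) :
  is_derive p u h dh -> is_derive p u l dl -> is_derive p u n dn ->
  is_derive p u m1 dm1 -> is_derive p u m2 dm2 ->
  let db := dl * v 0 i1 + dn * v 0 i2 in
  is_derive p u (fun q => connection_at (h q) (l q) (n q) (m1 q) (m2 q) v)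
    (connection_mx (db - dm2 * v 0 i1 + dm1 * v 0 i2) db (dh * v 0 i1) (dh * v 0 i2)).
Proof.
move=> Dh Dl Dn Dm1 Dm2 db.
apply: is_derive_connection_mx; apply: is_derive_eq;
  repeat first [ exact: Dh | exact: Dl | exact: Dn | exact: Dm1 | exact: Dm2
    | exact: is_derive_cst
    | apply: is_derive_mul | apply: is_derive_add | apply: is_derive_opp ].
all: by rewrite /db /GRing.scale/=; ring.
Qed.

Variables (h l n m1 m2 L11 L12 m11 m12 m22 : R).
Implicit Types u v : R4.

Definition connection_deriv_at u v : 'M[R]_4 :=
  let dh := h * (u 0 i1 * m1 + u 0 i2 * m2) in
  let dl := - (u 0 i1 * L12 + u 0 i2 * (2 * h ^+ 2 - L11)) in
  let dn := u 0 i1 * L11 + u 0 i2 * L12 in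
  let db := dl * v 0 i1 + dn * v 0 i2 in
  connection_mx
    (db - (u 0 i1 * m12 + u 0 i2 * m22) * v 0 i1
     + (u 0 i1 * m11 + u 0 i2 * m12) * v 0 i2)
    db (dh * v 0 i1) (dh * v 0 i2).

(** By the equation for ln H, db = 2 h^2 dx /\ dy. The quadratic term adds -2 h^2 to the entry [b],
    which cancels, and +2 h^2 to the entry [a], which thus becomes the Laplacian of ln h plus 4
    h^2. *)
Lemma curvature_identity u v :
  connection_deriv_at u v - connection_deriv_at v u
  + connection_at h l n m1 m2 v *m connection_at h l n m1 m2 u
  - connection_at h l n m1 m2 u *m connection_at h l n m1 m2 v =
  connection_mx ((m11 + m22 + 4 * h ^+ 2) * (u 0 i1 * v 0 i2 - u 0 i2 * v 0 i1)) 0 0 0.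
Proof.
apply/matrixP; apply: ord4_ind; apply: ord4_ind;
  by rewrite mxE [in X in X + _]mxE [in X in X + _ + _]mxE !mxE !sum_ord4 !mxE /=; field.
Qed.

End ConnectionDerivative.

Section ExplicitCurvatureForm.
Context {R : realType}.
Local Notation R4 := 'rV[R]_4.
Variables (U : set 'rV[R]_2) (h H : 'rV[R]_2 -> R).
Hypothesis oU : open U.
Hypothesis sh : smooth_on U h.
Hypothesis sH : smooth_on U H.
Hypothesis h_gt0 : forall q, U q -> 0 < h q.
Hypothesis H_gt0 : forall q, U q -> 0 < H q.
Hypothesis lapH : forall q, U q -> laplacian (logf H) q = 2 * h q ^+ 2.
Local Notation M := (total_space U).
Implicit Types (p u v : R4).

Let slh : smooth_on U (logf h). Proof. exact: smooth_logf. Qed.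

Lemma is_derive_connection p u v : M p ->
  is_derive p u (fun q => connection h H q v)
    (connection_deriv_at (h (base p)) (partial 0 (logf h) (base p))
      (partial 1 (logf h) (base p))
      (partial 0 (partial 0 (logf H)) (base p))
      (partial 0 (partial 1 (logf H)) (base p))
      (partial 0 (partial 0 (logf h)) (base p))
      (partial 0 (partial 1 (logf h)) (base p))
      (partial 1 (partial 1 (logf h)) (base p)) u v).
Proof.
move=> Mp; have [Up _] := Mp.
have dh := is_derive_h sh h_gt0 u Mp.
have dl := is_derive_l2 oU sH H_gt0 lapH u Mp.
have dn := is_derive_n2 oU sH H_gt0 u Mp.
have s0 : smooth_on U (partial 0 (logf h)) by exact: smooth_derive.
have s1 : smooth_on U (partial 1 (logf h)) by exact: smooth_derive.
have dm2 := is_derive_smooth_base u s1 Mp.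
have dm1 : is_derive p u (fun q => partial 0 (logf h) (base q))
   (u 0 i1 * partial 0 (partial 0 (logf h)) (base p)
    + u 0 i2 * partial 0 (partial 1 (logf h)) (base p)).
  apply: (is_derive_eq (is_derive_smooth_base u s0 Mp)).
  have := partial_comm oU slh Up.
  by move: (partial 1 (partial 0 _) _) => a ->.
exact: is_derive_connection_at dh dl dn dm1 dm2.
Qed.

Lemma curvature_formE p u v : M p -> curvature_form (connection h H) p u v =
  connection_mx ((laplacian (logf h) (base p) + 4 * h (base p) ^+ 2)
                 * (u 0 i1 * v 0 i2 - u 0 i2 * v 0 i1)) 0 0 0.
Proof.
move=> Mp; rewrite /curvature_form laplacianE.
have [_ D1] := is_derive_connection u v Mp.
have [_ D2] := is_derive_connection v u Mp.
by rewrite [X in X - _ + _ - _]D1 [X in _ - X + _ - _]D2 curvature_identity.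
Qed.

End ExplicitCurvatureForm.

(** * Curvature quantities *)

(* The curvature of (M, g) is concentrated on the plane spanned by E_1 and E_2:
   R(u, v, w, s) = - K (theta_1 /\ theta_2)(u, v) (theta_1 /\ theta_2)(w, s).
   All curvature quantities are then algebraic in K. *)
Section PlaneCurvature.
Context {R : realType}.
Local Notation R4 := 'rV[R]_4.
Variables (theta : 'I_4 -> R4 -> R4 -> R) (p : R4) (K : R).
Local Notation g := (metric theta).
Local Notation E := (dual_frame theta).
Hypothesis theta_dual : forall j k, theta k p (E j p) = (j == k)%:R.
Hypothesis frame_decomposition : forall u, u = \sum_i theta i p u *: E i p.
Hypothesis riemK : forall u v w s, riem g p u v w s =
  - K * (theta i1 p u * theta i2 p v - theta i2 p u * theta i1 p v)
      * (theta i1 p w * theta i2 p s - theta i2 p w * theta i1 p s).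
Implicit Types (u v w s : R4) (f : R4 -> R4 -> R).

Let th11 : theta i1 p (E i1 p) = 1. Proof. exact: theta_dual. Qed.
Let th12 : theta i2 p (E i1 p) = 0. Proof. exact: theta_dual. Qed.
Let th13 : theta i3 p (E i1 p) = 0. Proof. exact: theta_dual. Qed.
Let th14 : theta i4 p (E i1 p) = 0. Proof. exact: theta_dual. Qed.
Let th21 : theta i1 p (E i2 p) = 0. Proof. exact: theta_dual. Qed.
Let th22 : theta i2 p (E i2 p) = 1. Proof. exact: theta_dual. Qed.
Let th23 : theta i3 p (E i2 p) = 0. Proof. exact: theta_dual. Qed.
Let th24 : theta i4 p (E i2 p) = 0. Proof. exact: theta_dual. Qed.
Let th31 : theta i1 p (E i3 p) = 0. Proof. exact: theta_dual. Qed.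
Let th32 : theta i2 p (E i3 p) = 0. Proof. exact: theta_dual. Qed.
Let th33 : theta i3 p (E i3 p) = 1. Proof. exact: theta_dual. Qed.
Let th34 : theta i4 p (E i3 p) = 0. Proof. exact: theta_dual. Qed.
Let th41 : theta i1 p (E i4 p) = 0. Proof. exact: theta_dual. Qed.
Let th42 : theta i2 p (E i4 p) = 0. Proof. exact: theta_dual. Qed.
Let th43 : theta i3 p (E i4 p) = 0. Proof. exact: theta_dual. Qed.
Let th44 : theta i4 p (E i4 p) = 1. Proof. exact: theta_dual. Qed.
Let thE := (th11, th12, th13, th14, th21, th22, th23, th24,
            th31, th32, th33, th34, th41, th42, th43, th44).

Lemma plane_ricci u v : ricci g E p u v =
  K * (theta i1 p u * theta i1 p v + theta i2 p u * theta i2 p v).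
Proof. by rewrite /ricci sum_ord4 !riemK !thE; ring. Qed.

Lemma plane_scal : scal g E p = 2 * K.
Proof. by rewrite /scal sum_ord4 !plane_ricci !thE; ring. Qed.

Lemma plane_sec12 : sec g p (E i1 p) (E i2 p) = K.
Proof. by rewrite /sec riemK !thE; ring. Qed.

Lemma plane_sec34 : sec g p (E i3 p) (E i4 p) = 0.
Proof. by rewrite /sec riemK !thE; ring. Qed.

Lemma form2_expand f u v : is_form2 f ->
  let F i j := f (E i p) (E j p) in
  let W i j := theta i p u * theta j p v - theta j p u * theta i p v in
  f u v = W i1 i2 * F i1 i2 + W i1 i3 * F i1 i3 + W i1 i4 * F i1 i4
        + W i2 i3 * F i2 i3 + W i2 i4 * F i2 i4 + W i3 i4 * F i3 i4.
Proof.
move=> [fl fa] F W.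
have f0 w : f 0 w = 0.
  have := fl 1 0 0 w; rewrite scale1r addr0 mul1r => /eqP.
  by rewrite -subr_eq subrr => /eqP.
have fs (c : 'I_4 -> R) (e : 'I_4 -> R4) w :
    f (\sum_i c i *: e i) w = \sum_i c i * f (e i) w.
  elim/big_ind2 : _ => // [x a y b <- <-|i _].
    by have := fl 1 a b w; rewrite scale1r mul1r.
  by have := fl (c i) (e i) 0 w; rewrite addr0 f0 addr0.
have ft (c : 'I_4 -> R) (e : 'I_4 -> R4) w :
    f w (\sum_i c i *: e i) = \sum_i c i * f w (e i).
  by rewrite fa fs -sumrN; apply: eq_bigr => i _; rewrite fa mulrN opprK.
have fd w : f w w = 0 by have := fa w w; lra.
rewrite [in LHS](frame_decomposition u) fs sum_ord4.
have ev w : f w v = theta i1 p v * f w (E i1 p) + theta i2 p v * f w (E i2 p)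
    + theta i3 p v * f w (E i3 p) + theta i4 p v * f w (E i4 p).
  by rewrite [in LHS](frame_decomposition v) ft sum_ord4.
rewrite !ev !fd (fa (E i2 p) (E i1 p)) (fa (E i3 p) (E i1 p)) (fa (E i4 p) (E i1 p)).
rewrite (fa (E i3 p) (E i2 p)) (fa (E i4 p) (E i2 p)) (fa (E i4 p) (E i3 p)).
rewrite /W /F; ring.
Qed.

(** The last factor is the form Om. The operator is -K / 6 plus an extra K / 2 on the Om-component,
    so one formula gives both eigenvalues: -K / 6 + K / 2 = K / 3 on Om, and -K / 6 where f_12
    vanishes. *)
Lemma plane_weyl_op f u v : is_form2 f -> f (E i1 p) (E i2 p) = f (E i3 p) (E i4 p) ->
  weyl_op g E p f u v = - (K / 6) * f u v
   + K / 2 * f (E i1 p) (E i2 p) * (theta i1 p u * theta i2 p v - theta i2 p u * theta i1 p v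
      + (theta i3 p u * theta i4 p v - theta i4 p u * theta i3 p v)).
Proof.
move=> ff f1234; have [_ fa] := ff.
have fd w : f w w = 0 by have := fa w w; lra.
rewrite (form2_expand u v ff) /weyl_op !sum_ord4 !fd.
rewrite (fa (E i2 p) (E i1 p)) (fa (E i3 p) (E i1 p)) (fa (E i4 p) (E i1 p)).
rewrite (fa (E i3 p) (E i2 p)) (fa (E i4 p) (E i2 p)) (fa (E i4 p) (E i3 p)) -f1234.
rewrite /weyl plane_scal !riemK !plane_ricci /metric !sum_ord4 !thE.
by field.
Qed.

Let Ombar q u v := wedge11 (theta i1) (theta i2) q u v + wedge11 (theta i4) (theta i3) q u v.
Let Om q u v := wedge11 (theta i1) (theta i2) q u v + wedge11 (theta i3) (theta i4) q u v.

Hypothesis theta_linear : forall k (a : R) u v,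
  theta k p (a *: u + v) = a * theta k p u + theta k p v.

Lemma asd_part_id f : anti_self_dual E Ombar p f -> asd_part E Ombar p f = f.
Proof.
move=> af; apply/funext => u; apply/funext => v; rewrite /asd_part af; by field.
Qed.

Lemma asd_scale f (c : R) : anti_self_dual E Ombar p f ->
  anti_self_dual E Ombar p (fun u v => c * f u v).
Proof.
move=> af u v; rewrite -mulrN -af /hodge mulrCA; congr (_ * _).
rewrite mulr_sumr; apply: eq_bigr => i _; rewrite mulr_sumr; apply: eq_bigr => j _.
by rewrite mulrCA.
Qed.

Lemma asd_Om : anti_self_dual E Ombar p (Om p).
Proof.
move=> u v; rewrite /hodge !sum_ord4 /volume /Ombar /Om /wedge11 !thE; by field.
Qed.

Lemma form2_Om : is_form2 (Om p).
Proof.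
split=> [a u v w|u v]; rewrite /Om /wedge11 ?theta_linear; ring.
Qed.

(** In the orientation of [Ombar] the Hodge partner of (E_1, E_2) is (E_4, E_3), hence the positive
    sign. *)
Lemma asd_coef f : anti_self_dual E Ombar p f ->
  is_form2 f -> f (E i1 p) (E i2 p) = f (E i3 p) (E i4 p).
Proof.
move=> af [_ fa]; have := af (E i1 p) (E i2 p).
have fd w : f w w = 0 by have := fa w w; lra.
rewrite /hodge !sum_ord4 /volume /Ombar /Om /wedge11 !thE !fd.
by rewrite (fa (E i4 p) (E i3 p)); lra.
Qed.

Lemma weyl_minus_Om u v : weyl_minus g E Ombar p (Om p) u v = K / 3 * Om p u v.
Proof.
rewrite /weyl_minus (asd_part_id asd_Om).
have -> : weyl_op g E p (Om p) = fun u v => K / 3 * Om p u v.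
  apply/funext => a; apply/funext => b; rewrite plane_weyl_op.
  - by rewrite /Om /wedge11 !thE; field.
  - exact: form2_Om.
  - exact: asd_coef asd_Om form2_Om.
by rewrite (asd_part_id (asd_scale _ asd_Om)).
Qed.

Lemma weyl_minus_LM f u v : is_form2 f -> anti_self_dual E Ombar p f ->
  inner2 E p f (Om p) = 0 -> weyl_minus g E Ombar p f u v = - (K / 6) * f u v.
Proof.
move=> ff af; have f1234 := asd_coef af ff.
have [_ fa] := ff; have fd w : f w w = 0 by have := fa w w; lra.
(* Orthogonality to Om reads f_12 + f_34 = 0, while anti-self-duality gives f_12 = f_34. *)
move=> fOm; have f12 : f (E i1 p) (E i2 p) = 0.
  move: fOm; rewrite /inner2 !sum_ord4 /Om /wedge11 !thE !fd.
  by rewrite (fa (E i2 p) (E i1 p)) (fa (E i4 p) (E i3 p)) -f1234; lra.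
rewrite /weyl_minus (asd_part_id af).
have -> : weyl_op g E p f = fun u v => - (K / 6) * f u v.
  by apply/funext => a; apply/funext => b; rewrite plane_weyl_op// f12; ring.
by rewrite (asd_part_id (asd_scale _ af)).
Qed.

End PlaneCurvature.

(** * The Lee form *)

Section LeeIdentity.
Context {R : realType}.
Local Notation R4 := 'rV[R]_4.
Variables (z h H l n s c m1 m2 L11 L12 : R).
Hypothesis z_neq0 : z != 0.
Implicit Types (u v w : R4).

Definition Om_deriv_at u v w : R :=
  let a := coframe_at z h H l n s c in
  let da k u v := coframe_deriv_at z h H l n s c m1 m2 L11 L12 k u v in
  (da i1 u v * a i2 w + a i1 v * da i2 u w - (da i2 u v * a i1 w + a i2 v * da i1 u w))
  + (da i3 u v * a i4 w + a i3 v * da i4 u w - (da i4 u v * a i3 w + a i4 v * da i3 u w)).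

Lemma lee_identity u v w :
  let a := coframe_at z h H l n s c in
  let Om u v := a i1 u * a i2 v - a i2 u * a i1 v + (a i3 u * a i4 v - a i4 u * a i3 v) in
  Om_deriv_at u v w - Om_deriv_at v u w + Om_deriv_at w u v =
  2 * (2 / z * a i4 u * Om v w - 2 / z * a i4 v * Om u w + 2 / z * a i4 w * Om u v).
Proof. by rewrite /Om_deriv_at /coframe_deriv_at /coframe_at /=; field. Qed.

End LeeIdentity.

(** * Curvatures of the given metric *)

Section Curvatures.
Context {R : realType}.
Local Notation R4 := 'rV[R]_4.
Variables (U : set 'rV[R]_2) (h H : 'rV[R]_2 -> R).
Hypothesis oU : open U.
Hypothesis sh : smooth_on U h.
Hypothesis sH : smooth_on U H.
Hypothesis h_gt0 : forall q, U q -> 0 < h q.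
Hypothesis H_gt0 : forall q, U q -> 0 < H q.
Hypothesis lapH : forall q, U q -> laplacian (logf H) q = 2 * h q ^+ 2.
Local Notation M := (total_space U).
Local Notation theta := (coframe h H).
Local Notation g := (metric theta).
Local Notation E := (dual_frame theta).
Implicit Types (p u v w : R4).

(** The double negation is the literal form of -alpha with alpha = -2 / z. *)
Lemma lee_form : is_lee_form M
  (fun p u v => wedge11 (theta i1) (theta i2) p u v + wedge11 (theta i3) (theta i4) p u v)
  (fun p u => - - (2 / p 0 i3) * theta i4 p u).
Proof.
move=> p Mp u v w; have [Up z0] := Mp.
have zn0 : p 0 i3 != 0 by rewrite lt_eqF.
have D u v w := is_derive_add
  (is_derive_add (is_derive_mul (is_derive_coframe oU sh sH h_gt0 H_gt0 lapH i1 u v Mp)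
                     (is_derive_coframe oU sh sH h_gt0 H_gt0 lapH i2 u w Mp))
    (is_derive_opp (is_derive_mul (is_derive_coframe oU sh sH h_gt0 H_gt0 lapH i2 u v Mp)
                     (is_derive_coframe oU sh sH h_gt0 H_gt0 lapH i1 u w Mp))))
  (is_derive_add (is_derive_mul (is_derive_coframe oU sh sH h_gt0 H_gt0 lapH i3 u v Mp)
                     (is_derive_coframe oU sh sH h_gt0 H_gt0 lapH i4 u w Mp))
    (is_derive_opp (is_derive_mul (is_derive_coframe oU sh sH h_gt0 H_gt0 lapH i4 u v Mp)
                     (is_derive_coframe oU sh sH h_gt0 H_gt0 lapH i3 u w Mp)))).
have {D} DE u v w := derive_val (is_derive := D u v w).
apply: etrans (congr2 +%R (congr2 (fun a b => a - b) (DE u v w) (DE v u w)) (DE w u v)) _.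
rewrite /wedge12 /wedge11 !opprK !coframe_atE; exact: lee_identity.
Qed.

Let oM := open_total_space oU.

Let sTh i j : smooth_on M (fun q => coframe_mx h H q i j).
Proof. under eq_fun do rewrite mxE. exact: smooth_coframe. Qed.

Let uTh p : M p -> coframe_mx h H p \in unitmx.
Proof. exact: unit_coframe. Qed.

Let torsion p u v : M p ->
  v *m coframe_deriv (coframe_mx h H) (connection h H) p u =
  u *m coframe_deriv (coframe_mx h H) (connection h H) p v.
Proof. exact: coframe_torsion_free. Qed.

Definition plane_curvature p : R :=
  - (laplacian (logf h) (base p) + 4 * h (base p) ^+ 2) / (p 0 i3 ^+ 2 * h (base p) ^+ 2).
Local Notation K := (plane_curvature).

Lemma coframe_dual_frame p j k : M p -> theta k p (E j p) = (j == k)%:R.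
Proof. exact: (theta_dual_frame (@coframeE R h H) uTh). Qed.

Lemma coframe_decomposition p u : M p -> u = \sum_i theta i p u *: E i p.
Proof.
move=> Mp; apply: (can_inj (mulmxK (uTh Mp))); rewrite mulmx_suml.
rewrite [LHS]row_sum_delta; apply: eq_bigr => i _.
by rewrite -scalemxAl (dual_frame_coframe (@coframeE R h H) uTh)// coframeE.
Qed.

Lemma coframe_linear p k (a : R) u v : theta k p (a *: u + v) = a * theta k p u + theta k p v.
Proof. by rewrite !coframeE mulmxDl -scalemxAl !mxE. Qed.

Lemma coframe_Gamma p i j k : M p -> Gamma g E i j k p = connection h H p (E i p) j k.
Proof.
apply: (GammaE oM (@coframeE R h H) sTh uTh).
- exact: connection_linear.
- exact: connection_skew.
- by move=> *; exact: torsion.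
Qed.

(** Since theta_1 = z h dx and theta_2 = z h dy, passing from dx /\ dy to theta_1 /\ theta_2
    produces the denominator z^2 h^2 of K. *)
Lemma coframe_riem p u v w s : M p -> riem g p u v w s =
  - K p * (theta i1 p u * theta i2 p v - theta i2 p u * theta i1 p v)
      * (theta i1 p w * theta i2 p s - theta i2 p w * theta i1 p s).
Proof.
move=> Mp; have [Up z0] := Mp.
have zn0 : p 0 i3 != 0 by rewrite lt_eqF.
have hn0 : h (base p) != 0 by rewrite gt_eqF// h_gt0.
rewrite (riemE oM (@coframeE R h H) sTh uTh (connection_linear h H) (connection_skew h H)
  (smooth_connection oU sh sH h_gt0 H_gt0) torsion)//.
rewrite (curvature_formE oU sh sH h_gt0 H_gt0 lapH)//.
have tE k x : (x *m coframe_mx h H p) 0 k = theta k p x by rewrite coframeE.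
move: (tE ^~ w) (tE ^~ s); move: (w *m _) (s *m _) => x y xE yE.
rewrite mxE sum_ord4 !mxE !sum_ord4 !mxE /= !xE !yE.
by rewrite /plane_curvature /coframe /=; field; rewrite zn0 hn0.
Qed.

Lemma coframe_Gamma112 p : M p -> Gamma g E i1 i1 i2 p =
  - (cos (p 0 i4 / 2) * H (base p) / (p 0 i3 ^+ 2 * h (base p)))
  - partial 1 h (base p) / (p 0 i3 * h (base p) ^+ 2).
Proof.
move=> Mp; have [Up z0] := Mp.
have zn0 : p 0 i3 != 0 by rewrite lt_eqF.
have hn0 : h (base p) != 0 by rewrite gt_eqF// h_gt0.
rewrite coframe_Gamma// (dual_frame_mx H h_gt0 i1 Mp) (partial_logf 1 sh h_gt0 Up).
rewrite /connection !mxE /= ?mxE /=.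
move: (partial 0 _ _) (partial 1 _ _) => m1 m2; field.
by rewrite zn0 hn0.
Qed.

Lemma coframe_Gamma221 p : M p -> Gamma g E i2 i2 i1 p =
  - (sin (p 0 i4 / 2) * H (base p) / (p 0 i3 ^+ 2 * h (base p)))
  - partial 0 h (base p) / (p 0 i3 * h (base p) ^+ 2).
Proof.
move=> Mp; have [Up z0] := Mp.
have zn0 : p 0 i3 != 0 by rewrite lt_eqF.
have hn0 : h (base p) != 0 by rewrite gt_eqF// h_gt0.
rewrite coframe_Gamma// (dual_frame_mx H h_gt0 i2 Mp) (partial_logf 0 sh h_gt0 Up).
rewrite /connection !mxE /= ?mxE /=.
move: (partial 0 _ _) (partial 1 _ _) => m1 m2; field.
by rewrite zn0 hn0.
Qed.

Lemma plane_curvatureE p : M p -> plane_curvature p =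
  - (laplacian (logf h) (base p) / (p 0 i3 ^+ 2 * h (base p) ^+ 2)) - 4 / p 0 i3 ^+ 2.
Proof.
move=> [Up z0]; have zn0 : p 0 i3 != 0 by rewrite lt_eqF.
have hn0 : h (base p) != 0 by rewrite gt_eqF// h_gt0.
by rewrite /plane_curvature; field; rewrite zn0 hn0.
Qed.

Let lee (p u : R4) : R := - - (2 / p 0 i3) * theta i4 p u.

Lemma coframe_sqnorm p : M p -> sqnorm E lee p = 4 / p 0 i3 ^+ 2.
Proof.
move=> Mp; have [Up z0] := Mp; have zn0 : p 0 i3 != 0 by rewrite lt_eqF.
by rewrite /sqnorm sum_ord4 /lee !coframe_dual_frame//=; field.
Qed.

(** The derivative term contributes only for i = 4, namely -2 / z^2, since E_4 is the coordinate
    field of z. For i = 1, 2, 3 the E_4-component of nabla_{E_i} E_i is -1 / z. The sum is the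
    opposite of |theta|^2, which is why the conformal scalar curvature equals the scalar
    curvature. *)
Lemma coframe_codiff p : M p -> codiff g E lee p = - (4 / p 0 i3 ^+ 2).
Proof.
move=> Mp; have [Up z0] := Mp; have zn0 : p 0 i3 != 0 by rewrite lt_eqF.
have hn0 : h (base p) != 0 by rewrite gt_eqF// h_gt0.
have Dlee i : 'D_(E i p) (fun q => lee q (E i q)) p =
    - (2 / p 0 i3 ^+ 2) * E i p 0 i3 * (i == i4)%:R.
  have Eq q : M q -> lee q (E i q) = (2 * (i == i4)%:R) * (q 0 i3)^-1.
    by move=> Mq; rewrite /lee coframe_dual_frame//; ring.
  rewrite (eq_on_derive _ oM Eq Mp).
  have dz : differentiable (fun q : R4 => q 0 i3) p by exact: differentiable_coord.
  have dV := differentiable_Rinv zn0.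
  have D : is_derive p (E i p) (fun q : R4 => (q 0 i3)^-1)
      (- ((p 0 i3)^-1 * (p 0 i3)^-1) * E i p 0 i3).
    split.
      apply: diff_derivable.
      exact: (@differentiable_comp _ _ _ _ (fun q : R4 => q 0 i3) (@GRing.inv R)).
    apply: etrans (derive_comp1 _ dz dV) _; rewrite derive_inv// mulr1.
    by have [_ ->] := is_derive_coord p (E i p) i3.
  have [_ ->] := is_derive_mul (is_derive_cst (2 * (i == i4)%:R : R) p (E i p)) D.
  by rewrite mul0r add0r /=; move: (_ == _)%:R (E i p 0 i3) => a b; field.
have Nab i : theta i4 p (nabla g (E i) (E i) p) = connection h H p (E i p) i i4.
  rewrite -coframe_Gamma// /Gamma.
  by rewrite (metric_dual_frame (@coframeE R h H) uTh).
rewrite /codiff /nabla_form sum_ord4 !Dlee /lee !Nab !(dual_frame_mx H h_gt0 _ Mp).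
rewrite /connection !mxE /= ?mxE /=.
by field; rewrite zn0 hn0.
Qed.

Lemma coframe_conf_scal p : M p -> conf_scal g E lee p = 2 * plane_curvature p.
Proof.
move=> Mp; rewrite /conf_scal coframe_sqnorm// coframe_codiff// subrr mulr0 subr0.
apply: plane_scal => [j k|u v w s]; first exact: coframe_dual_frame.
exact: coframe_riem.
Qed.

Let Ombar p u v := wedge11 (theta i1) (theta i2) p u v + wedge11 (theta i4) (theta i3) p u v.

Lemma complex_structure_frame p : M p ->
  complex_structure E Ombar p (E i1 p) = E i2 p /\
  complex_structure E Ombar p (E i4 p) = E i3 p.
Proof.
move=> Mp; rewrite /complex_structure !sum_ord4 /Ombar /wedge11 !coframe_dual_frame//=.
by split; apply/rowP => j; rewrite !mxE; ring.
Qed.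

Lemma metric_frame p i : M p -> g p (E i p) (E i p) = 1.
Proof.
by move=> Mp; rewrite (metric_dual_frame (@coframeE R h H) uTh)// coframe_dual_frame// eqxx.
Qed.

Lemma hol_sec_constP (c : R) : hol_sec_const M g (complex_structure E Ombar) c ->
  forall p, M p -> plane_curvature p = 0.
Proof.
move=> Hc p Mp; have [J1 J4] := complex_structure_frame Mp.
have := Hc p Mp _ (metric_frame i4 Mp); rewrite J4 coframe_riem// !coframe_dual_frame//=.
have := Hc p Mp _ (metric_frame i1 Mp); rewrite J1 coframe_riem// !coframe_dual_frame//=.
by move=> <-; rewrite !(mulr0, mulr1, mul0r, subr0, sub0r) mulrN mulr1 opprK.
Qed.

(** Carries a pointwise conclusion on the total space over to all of [U]. *)
Lemma total_space_point q : U q -> exists2 p, M p & base p = q.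
Proof.
move=> Uq; pose p : R4 := \row_i nth 0 [:: q 0 0; q 0 1; -1; 0] i.
have bp : base p = q.
  by apply/rowP => j; rewrite !mxE /=; case: j => [[|[|//]] j2] /=;
    congr (q 0 _); exact: val_inj.
by exists p => //; split; rewrite ?bp// mxE /= ltrN10.
Qed.

Lemma space_form_laplacian :
  space_form M g (complex_structure E Ombar) <->
  forall q, U q -> laplacian (logf h) q = - (4 * h q ^+ 2).
Proof.
split=> [[c Hc] q Uq|L].
  have [p Mp bp] := total_space_point Uq.
  have [_ z0] := Mp; have zn0 : p 0 i3 != 0 by rewrite lt_eqF.
  have hn0 : h q != 0 by rewrite gt_eqF// h_gt0.
  have /eqP := hol_sec_constP Hc Mp.
  rewrite /plane_curvature bp mulf_eq0 invr_eq0 mulf_eq0 !expf_eq0/= (negbTE zn0).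
  by rewrite (negbTE hn0) !orbF oppr_eq0 addr_eq0 => /eqP.
exists 0 => p Mp u _; have [Up _] := Mp; rewrite coframe_riem// /plane_curvature L//.
by rewrite addNr oppr0 mul0r oppr0 !mul0r.
Qed.

End Curvatures.

(** * Flat metrics *)

Section SmoothInverse.
Context {R : realType} {n : nat}.
Local Notation V := 'rV[R]_n.
Variables (A W : set V) (G : V -> V) (D : V -> 'M[R]_n).
Hypothesis oA : open A.
Hypothesis oW : open W.
Hypothesis WA : forall q, W q -> A (G q).
Hypothesis dG : forall q, W q -> differentiable G q.
Hypothesis GD : forall q v, W q -> 'D_v G q = v *m D (G q).
Hypothesis sD : forall i j, smooth_on A (fun x => D x i j).

(* Functions of the form phi \o G with phi smooth are differentiable, and their
   derivatives are again of this form. *)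
Lemma smooth_comp_inverse (phi : V -> R) : smooth_on A phi ->
  smooth_on W (fun q => phi (G q)).
Proof.
move=> sphi; apply/smooth_ndiff => k; elim: k phi sphi => [|k IH] phi sphi;
  have dphi q : W q -> differentiable (fun q => phi (G q)) q.
- move=> Wq; apply: (@differentiable_comp _ _ _ _ G phi); first exact: dG.
  exact: smooth_differentiable (WA Wq).
- by split.
- move=> Wq; apply: (@differentiable_comp _ _ _ _ G phi); first exact: dG.
  exact: smooth_differentiable (WA Wq).
split=> // v.
pose psi x := \sum_l (v *m D x) 0 l * 'D_(delta_mx 0 l) phi x.
apply: (eq_ndiff oW (f := fun q => psi (G q))).
  move=> q Wq; have dp := smooth_differentiable sphi (WA Wq).
  rewrite [RHS]deriveE; last exact: dphi.
  rewrite (@diff_comp _ _ _ _ G phi)//=; last exact: dG.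
  rewrite -(deriveE v (dG Wq)) -(deriveE _ dp) GD//.
  exact: esym (derive_sum_partial _ dp).
apply: IH; apply: smooth_sum => // l _; apply: smoothM => //; last exact: smooth_derive.
under eq_fun do rewrite mxE.
apply: smooth_sum => // j _; apply: smoothM => //; exact: smooth_cst.
Qed.

Lemma smooth_inverse : smooth_on W G.
Proof.
apply: smooth_mx => // i j; rewrite (ord1 i).
by apply: (smooth_comp_inverse (phi := fun x : V => x 0 j)); exact: smooth_coord.
Qed.

End SmoothInverse.

(** * Isometric charts of a flat metric *)

Section FlatMetric.
Context {R : realType}.
Local Notation R4 := 'rV[R]_4.
Variables (M : set R4) (theta : 'I_4 -> R4 -> R4 -> R) (Th : R4 -> 'M[R]_4).
Variable A : R4 -> R4 -> 'M[R]_4.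
Hypothesis oM : open M.
Hypothesis thetaE : forall k p u, theta k p u = (u *m Th p) 0 k.
Hypothesis sTh : forall i j, smooth_on M (fun q => Th q i j).
Hypothesis uTh : forall p, M p -> Th p \in unitmx.
Hypothesis linA : forall p a u v, A p (a *: u + v) = a *: A p u + A p v.
Hypothesis skewA : forall p u, (A p u)^T = - A p u.
Hypothesis sA : forall u i j, smooth_on M (fun q => A q u i j).
Hypothesis torsion_free : forall p u v, M p ->
  v *m coframe_deriv Th A p u = u *m coframe_deriv Th A p v.
Hypothesis flat : forall p u v, M p -> curvature_form A p u v = 0.

(* A row (f, P) satisfies the total differential equation with matrix [B] iff
   df = sum_k P_k theta_k and P is a parallel family of frame components, that
   is, iff f is an affine function with gradient P. *)
Let B p u : 'M[R]_(1 + 4) := block_mx 0 0 (u *m Th p)^T (A p u)^T.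

Let linB p (a : R) u v : B p (a *: u + v) = a *: B p u + B p v.
Proof.
rewrite /B scale_block_mx add_block_mx !scaler0 !addr0 linA mulmxDl -scalemxAl.
by rewrite !linearP.
Qed.

Let smB u i j : smooth_on M (fun p => B p u i j).
Proof.
case: (split_ordP i) => k ->; case: (split_ordP j) => l ->.
- apply: (eq_smooth oM (f := fun=> (0 : R))) => [p _|]; last exact: smooth_cst.
  by rewrite /B block_mxEul mxE.
- apply: (eq_smooth oM (f := fun=> (0 : R))) => [p _|]; last exact: smooth_cst.
  by rewrite /B block_mxEur mxE.
- apply: (eq_smooth oM (f := fun p => \sum_x u 0 x * Th p x k)) => [p _|].
    by rewrite /B block_mxEdl !mxE (ord1 l).
  by apply: smooth_sum => // x _; apply: smoothM => //; exact: smooth_cst.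
- apply: (eq_smooth oM (f := fun p => A p u l k)) => [p _|]; last exact: sA.
  by rewrite /B block_mxEdr mxE.
Qed.

Let dTh p : M p -> differentiable Th p.
Proof.
by move=> Mp; apply: differentiable_mx => i j; exact: smooth_differentiable (sTh i j) Mp.
Qed.

Let dA p u : M p -> differentiable (A ^~ u) p.
Proof.
by move=> Mp; apply: differentiable_mx => i j; exact: smooth_differentiable (sA u i j) Mp.
Qed.

Let B_derive p u v : M p ->
  'D_u (B ^~ v) p = block_mx 0 0 (v *m 'D_u Th p)^T ('D_u (A ^~ v) p)^T.
Proof.
move=> Mp; have dT : derivable Th p u by exact/diff_derivable/dTh.
have dAv : derivable (A ^~ v) p u by exact/diff_derivable/dA.
have [dvT vT] := derivable_mulmx (derivable_cst v p u) dT.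
suff D : is_derive p u (B ^~ v)
    (block_mx 0 0 (v *m 'D_u Th p)^T ('D_u (A ^~ v) p)^T) by case: D.
apply: is_derive_mx => i j.
have eqD (f k : R4 -> R) (d e : R) : (forall q, f q = k q) -> d = e ->
    is_derive p u k e -> is_derive p u f d.
  by move=> /funext -> ->.
case: (split_ordP i) => k ->; case: (split_ordP j) => l ->.
- apply: (eqD _ (fun=> (0 : R)) _ 0).
  + by move=> q; rewrite /B block_mxEul mxE.
  + by rewrite block_mxEul mxE.
- apply: (eqD _ (fun=> (0 : R)) _ 0).
  + by move=> q; rewrite /B block_mxEur mxE.
  + by rewrite block_mxEur mxE.
- apply: (eqD _ (fun q => (v *m Th q) l k) _ ((v *m 'D_u Th p) l k)).
  + by move=> q; rewrite /B block_mxEdl mxE.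
  + by rewrite block_mxEdl mxE.
  split; first by have /derivable_mxP := dvT; exact.
  apply: etrans (esym (derive_entry l k dvT)) _.
  by rewrite vT derive_cst mul0mx add0r.
- apply: (eqD _ (fun q => A q v l k) _ ('D_u (A ^~ v) p l k)).
  + by move=> q; rewrite /B block_mxEdr mxE.
  + by rewrite block_mxEdr mxE.
  split; first by have /derivable_mxP := dAv; exact.
  exact: esym (derive_entry l k dAv).
Qed.

Let flatB p u v : M p ->
  'D_u (B ^~ v) p + B p u *m B p v = 'D_v (B ^~ u) p + B p v *m B p u.
Proof.
have blockD (c x y : 'rV[R]_4) (d X Y : 'M[R]_4) :
    block_mx 0 0 c^T d^T + block_mx 0 0 x^T X^T *m block_mx 0 0 y^T Y^T =
    block_mx 0 0 (c + y *m X)^T (d + Y *m X)^T :> 'M[R]_(1 + 4).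
  rewrite mulmx_block add_block_mx !mul0mx !mulmx0 !addr0 !add0r.
  by rewrite -!trmx_mul -!linearD.
move=> Mp; rewrite (B_derive u v Mp) (B_derive v u Mp) [LHS]blockD [RHS]blockD.
have -> : v *m 'D_u Th p + v *m Th p *m A p u = u *m 'D_v Th p + u *m Th p *m A p v.
  by rewrite -!mulmxA -!mulmxDr; exact: torsion_free.
congr (block_mx _ _ _ _^T); apply: subr0_eq.
have := @flat p u v Mp; rewrite /curvature_form.
move: ('D_u _ p) ('D_v _ p) (A p v *m _) (A p u *m _) => a b c d <-.
by apply/matrixP => i j; rewrite !mxE; ring.
Qed.

(** The lower four rows of the fundamental solution are four affine functions: their values form
    [F], their gradients form [P], and [P] is the identity at p0. [P] stays orthogonal, so the
    differential v Th P^T of [F] is isometric and invertible, and the local inverse makes [F] a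
    chart. *)
Lemma flat_locally_isometric : locally_isometric_to_C2 M (metric theta).
Proof.
move=> p0 Mp0.
have [r r_gt0 [rM [Y Y0 dY]]] := flat_total_differential oM Mp0 linB smB flatB.
pose ball0 := [set p : R4 | `|p - p0| < r].
have oball : open ball0.
  rewrite (_ : ball0 = ball p0 r); first exact: ball_open.
  by apply/seteqP; split=> y; rewrite -ball_normE /= distrC.
(* Bootstrapping: every derivative of [Y] is a product of [Y] with the smooth [B]. *)
have sY i j : smooth_on ball0 (fun p => Y p i j).
  apply/smooth_ndiff => k; elim: k i j => [|k IH] i j.
    by split=> // p /dY[dYp _]; exact: differentiable_entry.
  split=> [p /dY[dYp _]|v]; first exact: differentiable_entry.
  apply: (eq_ndiff oball (f := fun p => \sum_l Y p i l * B p v l j)).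
    move=> p /dY[dYp vY]; rewrite -derive_entry; last exact: diff_derivable.
    by rewrite vY mxE.
  apply: ndiff_sum => // l _; apply: ndiffM => //.
  have : smooth_on ball0 (fun p => B p v l j).
    exact: smooth_subset rM (smB v l j).
  by move=> /smooth_ndiff.
pose P p : 'M[R]_4 := @drsubmx R 1 4 1 4 (Y p).
pose F p : R4 := (@dlsubmx R 1 4 1 4 (Y p))^T.
have sF i j : smooth_on ball0 (fun p => F p i j).
  by under eq_fun do rewrite !mxE; exact: sY.
have sP i j : smooth_on ball0 (fun p => P p i j).
  by under eq_fun do rewrite !mxE; exact: sY.
have dF p : ball0 p -> differentiable F p.
  by move=> bp; apply: differentiable_mx => i j; exact: smooth_differentiable (sF i j) bp.
have dP p : ball0 p -> differentiable P p.
  by move=> bp; apply: differentiable_mx => i j; exact: smooth_differentiable (sP i j) bp.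
have YB p v : ball0 p -> 'D_v Y p = block_mx
    (@ursubmx R 1 4 1 4 (Y p) *m (v *m Th p)^T) (@ursubmx R 1 4 1 4 (Y p) *m (A p v)^T)
    (P p *m (v *m Th p)^T) (P p *m (A p v)^T).
  move=> /dY[_ ->]; rewrite -{1}(submxK (Y p : 'M[R]_(1 + 4))) /B mulmx_block.
  by rewrite !mulmx0 !add0r.
have FJ p v : ball0 p -> 'D_v F p = v *m (Th p *m (P p)^T).
  move=> bp; have [dYp _] := dY p bp; apply/matrixP => i j.
  have dFp : derivable F p v by exact/diff_derivable/dF.
  apply: etrans (derive_entry i j dFp) _.
  have -> : (fun q => F q i j) = (fun q => Y q (rshift 1 j) (lshift 4 i)).
    by apply/funext => q; rewrite !mxE.
  apply: etrans (esym (derive_entry _ _ (diff_derivable dYp))) _.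
  rewrite YB// block_mxEdl mulmxA.
  transitivity ((v *m Th p *m (P p)^T)^T j i); first by rewrite [in RHS]trmx_mul trmxK.
  by rewrite mxE.
have PA p v : ball0 p -> 'D_v P p = P p *m (A p v)^T.
  move=> bp; have [dYp _] := dY p bp; apply/matrixP => i j.
  have dPp : derivable P p v by exact/diff_derivable/dP.
  apply: etrans (derive_entry i j dPp) _.
  have -> : (fun q => P q i j) = (fun q => Y q (rshift 1 i) (rshift 1 j)).
    by apply/funext => q; rewrite !mxE.
  apply: etrans (esym (derive_entry _ _ (diff_derivable dYp))) _.
  by rewrite YB// block_mxEdr.
have P0 : P p0 = 1%:M.
  by rewrite /P Y0 -[1%:M]/(@scalar_mx R (1 + 4) 1) scalar_mx_block block_mxKdr.
have dPt p : ball0 p -> differentiable (fun q => (P q)^T) p.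
  move=> bp; apply: differentiable_mx => i j; under eq_fun do rewrite mxE.
  exact: smooth_differentiable (sP j i) bp.
have PtA p v : ball0 p -> 'D_v (fun q => (P q)^T) p = A p v *m (P p)^T.
  move=> bp; have dPtp : derivable (fun q => (P q)^T) p v by exact/diff_derivable/dPt.
  have dPp : derivable P p v by exact/diff_derivable/dP.
  apply/matrixP => i j; apply: etrans (derive_entry i j dPtp) _.
  have -> : (fun q => (P q)^T i j) = (fun q => P q j i) by apply/funext => q; rewrite mxE.
  apply: etrans (esym (derive_entry j i dPp)) _.
  rewrite PA//; transitivity ((A p v *m (P p)^T)^T j i); last by rewrite mxE.
  by rewrite trmx_mul trmxK.
(* The derivative of P P^T is P (A^T + A) P^T = 0, so P P^T keeps its value at p0 along segments in
   the ball. *)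
have orth p : ball0 p -> P p *m (P p)^T = 1%:M.
  move=> bp; rewrite -[1%:M]mulmx1 -[X in _ = _ *m X]trmx1 -P0.
  apply/matrixP => i j.
  have seg (s : R) : 0 <= s <= 1 -> ball0 (p0 + s *: (p - p0)).
    by apply: segment_ball; rewrite ?subrr ?normr0// subrKC.
  have dPP (s : R) : 0 <= s <= 1 ->
      differentiable (fun q => P q *m (P q)^T) (p0 + s *: (p - p0)).
    by move=> /seg bs; apply: differentiable_mulmx; [exact: dP|exact: dPt].
  have := @derive_eq0_line _ _ (fun q => (P q *m (P q)^T) i j) p0 (p - p0).
  rewrite subrKC; apply=> [s s01|s s01].
    by apply: differentiable_entry; exact: dPP.
  rewrite -(derive_entry i j (diff_derivable (dPP s s01))).
  have bs := seg s s01.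
  have d1 : derivable P (p0 + s *: (p - p0)) (p - p0) by exact/diff_derivable/dP.
  have d2 : derivable (fun q => (P q)^T) (p0 + s *: (p - p0)) (p - p0).
    exact/diff_derivable/dPt.
  have [_ ->] := derivable_mulmx d1 d2.
  by rewrite PA// PtA// skewA mulmxN mulNmx mulmxA addNr mxE.
have orth' p : ball0 p -> (P p)^T *m P p = 1%:M.
  by move=> bp; apply: mulmx1C; exact: orth.
have uP p : ball0 p -> (P p)^T \in unitmx.
  by move=> bp; have [] := mulmx1_unit (orth' p bp).
have uJ p : ball0 p -> Th p *m (P p)^T \in unitmx.
  by move=> bp; rewrite unitmx_mul uP// uTh//; exact: rM.
have sJ i j : smooth_on ball0 (fun p => (Th p *m (P p)^T) i j).
  apply: (eq_smooth oball (f := fun p => \sum_k Th p i k * P p j k)).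
    by move=> p _; rewrite mxE; apply: eq_bigr => k _; rewrite [in RHS]mxE.
  apply: smooth_sum => // k _; apply: smoothM => //.
  exact: smooth_subset rM (sTh i k).
have dJ p : ball0 p -> differentiable (fun p => Th p *m (P p)^T) p.
  by move=> bp; apply: differentiable_mx => i j; exact: smooth_differentiable (sJ i j) bp.
have b0 : ball0 p0 by rewrite /ball0 /= subrr normr0.
have [V [W [G [[oV Vp0 Vr oW] [VW WV dG]]]]] :=
  local_inverse r_gt0 dF FJ uJ (differentiable_continuous (dJ p0 b0)).
exists V, W, F, G; split; split=> //.
- by move=> p /Vr; exact: rM.
- apply: smooth_mx => // i j; exact: smooth_subset Vr (sF i j).
- apply: (@smooth_inverse _ _ V W G (fun x => invmx (Th x *m (P x)^T))) => //.
  + by move=> q /WV[].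
  + by move=> q /dG[].
  + by move=> q v /dG[].
  move=> i j; apply: smooth_invmx => // [k l|q /Vr]; last exact: uJ.
  exact: smooth_subset Vr (sJ k l).
move=> q u v /Vr bq; rewrite !FJ// (metricE thetaE) /euclid.
transitivity ((u *m (Th q *m (P q)^T) *m (v *m (Th q *m (P q)^T))^T) 0 0).
  by rewrite [RHS]mxE; apply: eq_bigr => i _; congr (_ * _); rewrite [RHS]mxE.
(* P^T P = 1 removes [P] from the pulled-back metric, leaving Th Th^T. *)
rewrite !mulmxA trmx_mul trmxK -!mulmxA [(P q)^T *m (P q *m _)]mulmxA orth'//.
by rewrite mul1mx.
Qed.

End FlatMetric.

Theorem theorem4p5 (R : realType) (U : set 'rV[R]_2) (h H : 'rV[R]_2 -> R)
    (U_open : open U)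
    (h_smooth : smooth_on U h) (H_smooth : smooth_on U H)
    (h_gt0 : forall q, U q -> 0 < h q) (H_gt0 : forall q, U q -> 0 < H q)
    (lap_lnH : forall q, U q -> laplacian (logf H) q = 2 * h q ^+ 2) :
  let M := total_space U in
  let theta := coframe h H in
  let g := metric theta in
  let E := dual_frame theta in
  let Ombar := fun p u v =>
    wedge11 (theta i1) (theta i2) p u v + wedge11 (theta i4) (theta i3) p u v in
  let Om := fun p u v =>
    wedge11 (theta i1) (theta i2) p u v + wedge11 (theta i3) (theta i4) p u v in
  let Jbar := complex_structure E Ombar in
  let alpha := fun p : 'rV[R]_4 => - (2 / p 0 i3) in
  let lee := fun p u => - alpha p * theta i4 p u in
  (* (i) *)
  (forall q, U q -> laplacian (logf H) q = 2 * h q ^+ 2) /\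
  is_lee_form M Om lee /\
  (forall p, M p ->
     let q := base p in
     let z := p 0 i3 in
     let t := p 0 i4 in
     let L := laplacian (logf h) q in
     (* (ii) *)
     (Gamma g E i1 i1 i2 p =
        - (cos (t / 2) * H q / (z ^+ 2 * h q)) - partial 1 h q / (z * h q ^+ 2) /\
      Gamma g E i2 i2 i1 p =
        - (sin (t / 2) * H q / (z ^+ 2 * h q)) - partial 0 h q / (z * h q ^+ 2)) /\
     (* (iii) *)
     \matrix_(i, j) ricci g E p (E i p) (E j p) =
       diag_mx (\row_(i < 4) [:: - (L / (z ^+ 2 * h q ^+ 2)) - 4 / z ^+ 2;
                                 - (L / (z ^+ 2 * h q ^+ 2)) - 4 / z ^+ 2;
                                 0; 0]`_i) /\
     (* (iv) *)
     scal g E p = - (2 * L / (z ^+ 2 * h q ^+ 2)) - 8 / z ^+ 2 /\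
     (* (v) *)
     conf_scal g E lee p = - (2 * L / (z ^+ 2 * h q ^+ 2)) - 8 / z ^+ 2 /\
     (* (vi) *)
     (forall phi psi : 'rV[R]_4 -> 'rV[R]_4 -> R,
        LM_orthonormal E Ombar Om p phi psi ->
        forall u v,
        [/\ weyl_minus g E Ombar p (Om p) u v =
              (- (L / (3 * z ^+ 2 * h q ^+ 2)) - 4 / (3 * z ^+ 2)) * Om p u v,
            weyl_minus g E Ombar p phi u v =
              (L / (6 * z ^+ 2 * h q ^+ 2) + 2 / (3 * z ^+ 2)) * phi u v &
            weyl_minus g E Ombar p psi u v =
              (L / (6 * z ^+ 2 * h q ^+ 2) + 2 / (3 * z ^+ 2)) * psi u v]) /\
     (* (vii) *)
     (sec g p (E i1 p) (E i2 p) = - (L / (z ^+ 2 * h q ^+ 2)) - 4 / z ^+ 2 /\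
      sec g p (E i3 p) (E i4 p) = 0)) /\
  (* (viii) *)
  (space_form M g Jbar <->
     forall q, U q -> laplacian (logf h) q = - (4 * h q ^+ 2)) /\
  (space_form M g Jbar ->
     hol_sec_const M g Jbar 0 /\ locally_isometric_to_C2 M g).
Proof.
cbv zeta.
have oM : open (total_space U) by exact: open_total_space.
have flat p u v : (forall q, U q -> laplacian (logf h) q = - (4 * h q ^+ 2)) ->
    total_space U p -> curvature_form (connection h H) p u v = 0.
  move=> L Mp; have [Up _] := Mp.
  rewrite (curvature_formE U_open h_smooth H_smooth h_gt0 H_gt0 lap_lnH)// L//.
  rewrite addNr mul0r; apply/matrixP; apply: ord4_ind; apply: ord4_ind;
    by rewrite !mxE /= ?oppr0.
split; first exact: lap_lnH.
split; first exact: lee_form U_open h_smooth H_smooth h_gt0 H_gt0 lap_lnH.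
split=> [p Mp|].
  have [Up z0] := Mp.
  pose z := p 0 i3; pose q := base p; pose L := laplacian (logf h) q.
  rewrite -/z -/q -/L; have zn0 : z != 0 by rewrite lt_eqF.
  have hn0 : h q != 0 by rewrite gt_eqF// h_gt0.
  have dual j k : coframe h H k p (dual_frame (coframe h H) j p) = (j == k)%:R.
    exact: (coframe_dual_frame H h_gt0 j k Mp).
  have dec u := coframe_decomposition H h_gt0 u Mp.
  have lin k a u v := coframe_linear h H p k a u v.
  have riemK u v w s := coframe_riem U_open h_smooth H_smooth h_gt0 H_gt0 lap_lnH u v w s Mp.
  pose K := plane_curvature h p.
  have KE := plane_curvatureE h_gt0 Mp; rewrite -/K -/q -/L -/z in KE.
  split; first split.
  - by have := coframe_Gamma112 U_open h_smooth H_smooth h_gt0 H_gt0 lap_lnH Mp.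
  - by have := coframe_Gamma221 U_open h_smooth H_smooth h_gt0 H_gt0 lap_lnH Mp.
  split; [|split; [|split; [|split]]].
  - apply/matrixP; apply: ord4_ind; apply: ord4_ind;
      by rewrite !mxE (plane_ricci dual riemK) !dual /= -/K KE; ring.
  - by rewrite (plane_scal dual riemK) -/K KE; field; rewrite zn0 hn0.
  - rewrite (coframe_conf_scal U_open h_smooth H_smooth h_gt0 H_gt0 lap_lnH Mp) -/K KE.
    by field; rewrite zn0 hn0.
  - move=> phi psi [[phi2 psi2 phiA psiA] [phiO psiO _ _ _]] u v; split.
    + rewrite (weyl_minus_Om dual dec riemK lin) -/K KE; congr (_ * _).
      by field; rewrite zn0 hn0.
    + rewrite (weyl_minus_LM dual dec riemK _ _ phi2 phiA phiO) -/K KE; congr (_ * _).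
      by field; rewrite zn0 hn0.
    + rewrite (weyl_minus_LM dual dec riemK _ _ psi2 psiA psiO) -/K KE; congr (_ * _).
      by field; rewrite zn0 hn0.
  by rewrite (plane_sec12 dual riemK) (plane_sec34 dual riemK) -/K KE.
have SF := space_form_laplacian U_open h_smooth H_smooth h_gt0 H_gt0 lap_lnH.
split; first exact: SF.
move=> /SF L; split.
  move=> p Mp u _; have [Up _] := Mp.
  rewrite (coframe_riem U_open h_smooth H_smooth h_gt0 H_gt0 lap_lnH)//.
  by rewrite /plane_curvature L// addNr oppr0 mul0r oppr0 !mul0r.
apply: (@flat_locally_isometric _ _ _ (coframe_mx h H) (connection h H)) => //.
- exact: coframeE.
- by move=> i j; under eq_fun do rewrite mxE; exact: smooth_coframe.
- exact: unit_coframe.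
- exact: connection_linear.
- exact: connection_skew.
- exact: smooth_connection.
- exact: coframe_torsion_free.
by move=> p u v; exact: flat.
Qed.
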